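(* Let $(M,\rho,\mu)$ be an unbounded metric measure space with $0<\mu(M)<\infty$ satisfying the properties (LD), (AM) and (I$^c_{B_0}$) defined in the context. Suppose that $r\in(1,\infty)$ and let $r'$ be its conjugate index. The following hold: (i) for every $f\in BMO^{r'}(\mu)$ the functional $\ell$, initially defined on $H^{1,r}_{\mathrm{fin}}(\mu)$ by $$\ell(g)=\int_M f\,g\,d\mu,$$ extends to a bounded functional on $H^{1,r}(\mu)$. Furthermore, $$\|\ell\|_{H^{1,r}(\mu)^*}\le\|f\|_{BMO^{r'}(\mu)};$$ (ii) there exists a constant $C$ such that for every continuous linear functional $\ell$ on $H^{1,r}(\mu)$ there exists a function $f^\ell\in BMO^{r'}(\mu)$ such that $\|f^\ell\|_{BMO^{r'}(\mu)}\le C\,\|\ell\|_{H^{1,r}(\mu)^*}$ and $$\ell(g)=\int_M f^\ell\,g\,d\mu\qquad\text{for all } g\in H^{1,r}_{\mathrm{fin}}(\mu).$$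
   Context: For a metric measure space $(M,\rho,\mu)$, $\mathcal{B}$ is the family of all balls, $c_B,r_B$ are the centre and radius of a ball $B$, $\kappa B$ is the ball with centre $c_B$ and radius $\kappa r_B$, and for $b>0$, $\mathcal{B}_b=\{B\in\mathcal{B}: r_B\le b\}$. For $A\subset M$ and $\kappa>0$, $A_\kappa=\{x\in A:\rho(x,A^c)\le\kappa\}$. (LD): for every $b>0$ there is a constant $D_b$ with $\mu(2B)\le D_b\,\mu(B)$ for all $B\in\mathcal{B}_b$. (AM): there exist $R_0\in[0,\infty)$ and $\beta\in(1/2,1)$ such that for all $x,y\in M$ with $\rho(x,y)>R_0$ there is $z\in M$ with $\rho(x,z)<\beta\rho(x,y)$ and $\rho(y,z)<\beta\rho(x,y)$. (I$^c_{B_0}$): there exist a ball $B_0$ in $M$ and $\kappa_0,C>0$ such that for every open set $A\subset M\setminus\overline{B}_0$, $\mu(A_\kappa)\ge C\kappa\,\mu(A)$ for all $\kappa\in(0,\kappa_0]$. Atoms: for $r\in(1,\infty)$, a $(1,r)$-standard atom is a function $a\in L^1(\mu)$ supported in a ball $B$ such that $\int_B a\,d\mu=0$ and $\bigl(\frac{1}{\mu(B)}\int_B|a|^r\,d\mu\bigr)^{1/r}\le\mu(B)^{-1}$. The constant function $1/\mu(M)$ is the exceptional atom. Fix a scale parameter $b>R_0/(1-\beta)$ (different such choices give the same spaces with equivalent norms). $H^{1,r}(\mu)=H_b^{1,r}(\mu)$ is the space of all $g\in L^1(\mu)$ of the form $g=\sum_{k=1}^\infty\lambda_k a_k$, where each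 $a_k$ is either a $(1,r)$-standard atom supported in a ball of $\mathcal{B}_b$ or the exceptional atom, and $\sum_k|\lambda_k|<\infty$ ($\lambda_k\in\mathbb{C}$); its norm is the infimum of $\sum_k|\lambda_k|$ over all such decompositions. $H^{1,r}_{\mathrm{fin}}(\mu)$ is the (dense) subspace of all finite linear combinations of such atoms (the exceptional atom included). $H^{1,r}(\mu)^*$ is the topological dual, with the dual norm. For $q\in[1,\infty)$ and $f$ locally integrable, $N_b^q(f)=\sup_{B\in\mathcal{B}_b}\bigl(\frac{1}{\mu(B)}\int_B|f-f_B|^q\,d\mu\bigr)^{1/q}$, where $f_B$ is the average of $f$ over $B$. $BMO^{q}(\mu)=BMO_b^q(\mu)$ is the space of all $f\in L^1(\mu)$ with $N_b^q(f)<\infty$, with norm $\|f\|_{BMO^q(\mu)}=\|f\|_1+N_b^q(f)$.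
   Formalization: In (i) the norm bound is proved with the factor max(1, 1/μ(M)) on the right-hand side; it equals 1 if μ(M) ≥ 1, while for μ(M) < 1 the bound as stated fails (f = 1 tested on the exceptional atom 1/μ(M)). *)

(* Defs.v *)
From HB Require Import structures.
From mathcomp Require Import all_boot all_order all_algebra.
From mathcomp Require Import all_classical all_reals all_analysis.
From mathcomp Require Import all_real_closed.

Set Implicit Arguments.
Unset Strict Implicit.
Unset Printing Implicit Defensive.

Import Order.TTheory GRing.Theory Num.Theory.
Import numFieldNormedType.Exports.

Local Open Scope classical_set_scope.
Local Open Scope ring_scope.
Local Open Scope complex_scope.

(* The base point is only there because measurable types are pointed; a space
   of positive measure is nonempty anyway. *)
#[short(type="pointedMetricType")]
HB.structure Definition PointedMetric (K : numDomainType) :=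
  { M of Pointed M & Metric K M }.

Notation borel M := (g_sigma_algebraType (@open M)).

Section metric_measure_space.
Context {R : realType} {M : pointedMetricType R}.
Variable mu : {measure set (borel M) -> \bar R}.
Implicit Types (A B : set M) (f g h : M -> R[i]) (l : (M -> R[i]) -> R[i]).

Definition unbounded_space := forall K : R, exists x y : M, K < mdist x y.

(* A ball of M is given by its centre x and its radius r > 0, and it is the
   open ball (ball x r); distinct pairs may give the same subset of M. *)

Definition locally_doubling :=
  forall b : R, 0 < b -> exists D : R, forall (x : M) (r : R), 0 < r <= b ->
    (mu (ball x (2 * r)) <= D%:E * mu (ball x r))%E.

Definition approximate_midpoint (R0 beta : R) :=
  [/\ 0 <= R0, 2^-1 < beta, beta < 1 &
    forall x y : M, R0 < mdist x y -> exists z : M,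
      mdist x z < beta * mdist x y /\ mdist y z < beta * mdist x y].

(* The infimum is +oo when A is the whole space. *)
Definition inner_collar A (kappa : R) : set M :=
  [set x | A x /\
    (ereal_inf [set (mdist x y)%:E | y in ~` A] <= kappa%:E)%E].

Definition complementary_isoperimetric :=
  exists (x0 : M) (r0 kappa0 C : R), [/\ 0 < r0, 0 < kappa0, 0 < C &
    forall A, open A -> A `<=` ~` closure (ball x0 r0) ->
      forall kappa : R, 0 < kappa <= kappa0 ->
        ((C * kappa)%:E * mu A <= mu (inner_collar A kappa))%E].

Definition Cmod (z : R[i]) : R := Normc.normc z.

Definition Cintegrable B f :=
  mu.-integrable B (fun x => (complex.Re (f x))%:E) /\
  mu.-integrable B (fun x => (complex.Im (f x))%:E).

Definition Cintegral B f : R[i] :=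
  Rintegral mu B (fun x => complex.Re (f x)) +i*
  Rintegral mu B (fun x => complex.Im (f x)).

Definition L1norm f : \bar R := (\int[mu]_x (Cmod (f x))%:E)%E.

Definition average B f : R[i] := (fine (mu B))^-1%:C * Cintegral B f.

Definition Lq_average (q : R) B f : \bar R :=
  (((fine (mu B))^-1%:E * \int[mu]_(x in B) (Cmod (f x) `^ q)%:E) `^ q^-1)%E.

Definition standard_atom (r : R) B (a : M -> R[i]) :=
  [/\ Cintegrable setT a,
      {ae mu, forall x, ~ B x -> a x = 0},
      Cintegral B a = 0 &
      (Lq_average r B a <= (fine (mu B))^-1%:E)%E].

Definition exceptional_atom : M -> R[i] := fun=> (fine (mu setT))^-1%:C.

Definition atom (b r : R) (a : M -> R[i]) :=
  (exists (x : M) (s : R), 0 < s <= b /\ standard_atom r (ball x s) a) \/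
  a = exceptional_atom.

Definition partial_sum (lam : nat -> R[i]) (a : nat -> M -> R[i]) (n : nat) :
    M -> R[i] :=
  fun x => \sum_(k < n) lam k * a k x.

(* The series converges in L^1; as every atom has L^1 norm at most 1, this
   amounts to almost everywhere convergence. *)
Definition atomic_decomposition (b r : R) g (lam : nat -> R[i])
    (a : nat -> M -> R[i]) :=
  [/\ forall k, atom b r (a k),
      (\sum_(0 <= k <oo) (Cmod (lam k))%:E < +oo)%E &
      L1norm (fun x => g x - partial_sum lam a n x) @[n --> \oo] --> 0%E].

(* Elements of H^{1,r} are functions rather than classes modulo null sets; the
   conditions below only depend on the class. *)
Definition H1r (b r : R) g :=
  Cintegrable setT g /\ exists lam a, atomic_decomposition b r g lam a.

Definition H1r_norm (b r : R) g : \bar R :=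
  ereal_inf [set s | exists lam a, atomic_decomposition b r g lam a /\
    s = (\sum_(0 <= k <oo) (Cmod (lam k))%:E)%E].

Definition H1r_fin (b r : R) g :=
  Cintegrable setT g /\
  exists (n : nat) (lam : nat -> R[i]) (a : nat -> M -> R[i]),
    (forall k, (k < n)%N -> atom b r (a k)) /\
    {ae mu, forall x, g x = partial_sum lam a n x}.

(* Functionals on H^{1,r} are total functions of which only the restriction to
   H^{1,r} matters. *)
Definition H1r_linear (b r : R) l :=
  (forall g h, H1r b r g -> H1r b r h ->
     {ae mu, forall x, g x = h x} -> l g = l h) /\
  (forall (c : R[i]) g h, H1r b r g -> H1r b r h ->
     l (fun x => c * g x + h x) = c * l g + l h).

Definition H1r_bounded (b r : R) l :=
  exists K : R, forall g, H1r b r g ->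
    ((Cmod (l g))%:E <= K%:E * H1r_norm b r g)%E.

Definition H1r_continuous (b r : R) l :=
  forall g, H1r b r g -> forall e : R, 0 < e ->
    exists d : R, 0 < d /\ forall h, H1r b r h ->
      (H1r_norm b r (fun x => h x - g x)%R < d%:E)%E -> Cmod (l h - l g) < e.

Definition H1r_dual_norm (b r : R) l : \bar R :=
  ereal_sup [set (Cmod (l g))%:E | g in
    [set g | H1r b r g /\ (H1r_norm b r g <= 1)%E]].

Definition BMO_seminorm (b q : R) f : \bar R :=
  ereal_sup [set u | exists (x : M) (s : R), 0 < s <= b /\
    u = Lq_average q (ball x s) (fun y => f y - average (ball x s) f)].

Definition BMO (b q : R) f :=
  Cintegrable setT f /\ (BMO_seminorm b q f < +oo)%E.

Definition BMO_norm (b q : R) f : \bar R :=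
  (L1norm f + BMO_seminorm b q f)%E.

(* The bilinear pairing, without complex conjugation. *)
Definition represented_by (b r : R) l f :=
  forall g, H1r_fin b r g ->
    Cintegrable setT (fun x => f x * g x) /\
    l g = Cintegral setT (fun x => f x * g x).

End metric_measure_space.

(* Main.v *)
Require Import Defs.
From HB Require Import structures.
From mathcomp Require Import all_boot all_order all_algebra.
From mathcomp Require Import finmap.
From mathcomp Require Import all_classical all_reals all_analysis.
From mathcomp Require Import all_real_closed.
From mathcomp Require Import measurable_realfun.
From mathcomp Require Import ring lra.

(** Why functions of bounded mean oscillation are the dual of the Hardy space.

    A function [f] in BMO acts on an atom [a] supported in a ball [B] because [a]
    has mean zero: the integral of [f a] equals that of [(f - c) a] for every
    constant [c], and Hoelder's inequality bounds it by the oscillation of [f] on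
    [B] ([pairing_standard_atom]). At the exceptional atom the integral is the mean
    of [f]. Boundedness on atoms alone does not give a functional on the whole
    space, as an element has many decompositions. But truncating the real and
    imaginary parts of [f] at height [n] is a contraction, so that the same bound
    on atoms holds for the truncations [f_n]; as these are bounded functions, the
    integral of [f_n g] depends on [g] only and may be computed term by term from
    any decomposition. The bounds being uniform in [n], these integrals converge,
    and their limit is the functional sought ([functional_extension]).

    Conversely, let [l] be a continuous functional. By splitting it into real and
    imaginary parts it is enough to treat a real functional on real functions.
    Centering turns its restriction to the functions of mean zero on a ball into a
    functional on L^r of that ball, which is given by a density in L^r'
    ([cancelling_functional_rep], from the duality [Lp_functional_rep]). These
    densities are unique up to constants. The normalized indicators of two small
    balls differ by a finite combination of atoms, since approximate midpoints
    connect their centres by a chain of small steps; so all constants can be fixed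
    by comparison with a single ball, after which the densities agree on overlaps
    and define one function [f] ([global_density]). Its oscillation on small balls
    is bounded by the norm of [l].

    It remains to see that [f] is integrable, with L^1 norm bounded by the norm of
    [l]. This is where the isoperimetric property enters, through a global Poincare
    inequality ([L1_le_oscillation]): means of [f] over balls of a fixed radius vary
    slowly, so that the collar of a superlevel set of these means, outside a fixed
    ball, misses the next superlevel set; as the collar takes up a fixed
    proportion, the measures of superlevel sets decay geometrically
    ([fat_level_decay]). Finally the additive constant in [f] is adjusted to give the
    right value at the exceptional atom ([mean_zero_functional_rep]). *)

Set Implicit Arguments.
Unset Strict Implicit.
Unset Printing Implicit Defensive.

Import Order.TTheory GRing.Theory Num.Theory.
Import numFieldNormedType.Exports.

Local Open Scope classical_set_scope.
Local Open Scope ring_scope.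

(** * Real-valued integration on a finite measure space *)

Section finite_measure.
Context d (T : measurableType d) (R : realType).
Variable mu : {finite_measure set T -> \bar R}.
Implicit Types (f g : T -> R) (p q c : R).

Local Notation integ f := (mu.-integrable setT (EFin \o f)).

Lemma integrable_dominated f g : measurable_fun setT f ->
  (forall x, `|f x| <= g x) -> integ g -> integ f.
Proof.
move=> mf fg ig; apply: le_integrable ig => //; first exact/measurable_EFinP.
by move=> x _; rewrite /= lee_fin (le_trans (fg x))// ler_norm.
Qed.

Lemma integrable_bounded f c : measurable_fun setT f ->
  (forall x, `|f x| <= c) -> integ f.
Proof.
move=> mf fc; apply: (@integrable_dominated _ (cst c)) => //.
exact: finite_measure_integrable_cst.
Qed.

Lemma integrable_mul_bounded f g c : measurable_fun setT f ->
  (forall x, `|f x| <= c) -> integ g -> integ (fun x => f x * g x).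
Proof.
move=> mf fc ig.
have mg : measurable_fun setT g by exact/measurable_EFinP/(measurable_int mu).
apply: (@integrable_dominated _ (fun x => c * `|g x|)).
- exact: measurable_funM.
- by move=> x; rewrite normrM ler_wpM2r.
- exact: (integrableZl measurableT c (integrable_norm ig)).
Qed.

Lemma integrable_scale c f : integ f -> integ (fun x => c * f x).
Proof. by move=> fi; exact: (integrableZl measurableT c fi). Qed.

Lemma integrable_add f g : integ f -> integ g -> integ (fun x => f x + g x).
Proof. by move=> fi gi; exact: (integrableD measurableT fi gi). Qed.

Lemma cvg_Rintegral_dominated (f_ : nat -> T -> R) f g :
  (forall n, measurable_fun setT (f_ n)) -> measurable_fun setT f ->
  (forall x, f_ ^~ x @ \oo --> f x) -> (forall n x, `|f_ n x| <= g x) ->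
  integ g -> \int[mu]_x f_ n x @[n --> \oo] --> \int[mu]_x f x.
Proof.
move=> mf_ mf cf fg ig.
have [|||||iF _] := @dominated_convergence _ _ _ mu _ measurableT
    (fun n => EFin \o f_ n) (EFin \o f) (EFin \o g).
- by move=> n; exact/measurable_EFinP.
- exact/measurable_EFinP.
- by apply: aeW => x _; apply/cvg_EFin; [exact: nearW|exact: cf].
- exact: ig.
- by apply: aeW => x n _; rewrite /= lee_fin.
move=> c; have : (\int[mu]_x (EFin \o f) x)%E \is a fin_num.
  exact: integrable_fin_num.
by rewrite /Rintegral => /fineK fK; apply: fine_cvg; rewrite fK.
Qed.

(** Monotone convergence in the form of a bound: the limit of an increasing
    sequence of functions whose integrals stay below [c] is integrable. *)
Lemma Rintegral_limit_le (f_ : nat -> T -> R) f c :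
  (forall n, integ (f_ n)) -> measurable_fun setT f ->
  (forall n x, 0 <= f_ n x) ->
  (forall x, {homo f_ ^~ x : n m / (n <= m)%N >-> n <= m}) ->
  (forall x, f_ ^~ x @ \oo --> f x) ->
  (forall n, \int[mu]_x f_ n x <= c) -> integ f /\ \int[mu]_x f x <= c.
Proof.
move=> fi mf f0 nd cf fc.
have f0' x : 0 <= f x.
  by rewrite -(cvg_lim _ (cf x))//; apply: limr_ge; [apply/cvg_ex; exists (f x)|apply: nearW].
have : (\int[mu]_x (f x)%:E <= c%:E)%E.
  have cI := @cvg_monotone_convergence _ _ _ mu _ measurableT
    (fun n => EFin \o f_ n) (fun n => measurable_int mu (fi n))
    (fun n x _ => f0 n x) (fun x _ n m nm => nd x n m nm).
  have -> : (\int[mu]_x (f x)%:E =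
      \int[mu]_x (limn (fun n => (f_ n x)%:E)))%E.
    apply: eq_integral => x _; apply/esym/cvg_lim => //.
    by apply/cvg_EFin; [exact: nearW|exact: cf].
  rewrite -(cvg_lim _ cI)//; apply: lime_le; first by apply/cvg_ex; eexists; exact: cI.
  apply: nearW => n /=.
  rewrite -[X in (X <= _)%E]fineK ?lee_fin; first exact: fc.
  exact: (integrable_fin_num measurableT (fi n)).
move=> le; have ii : integ f.
  apply/integrableP; split; first exact/measurable_EFinP.
  under eq_integral do rewrite /= ger0_norm//.
  exact: le_lt_trans le (ltry _).
split => //; rewrite -lee_fin /Rintegral fineK//.
exact: integrable_fin_num ii.
Qed.

(** ** The space L^p of real functions, p > 0 *)

Lemma powRD_le p (a b : R) : 0 <= p -> 0 <= a -> 0 <= b ->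
  (a + b) `^ p <= 2 `^ p * (a `^ p + b `^ p).
Proof.
move=> p0; wlog ab : a b / a <= b => [hw a0 b0|a0 b0].
  by have [/hw|/ltW/hw] := leP a b; [exact|rewrite addrC [_ `^ _ + _]addrC; exact].
apply: (@le_trans _ _ ((2 * b) `^ p)).
  by apply: ge0_ler_powR; rewrite ?nnegrE; lra.
by rewrite powRM// ler_wpM2l ?powR_ge0// lerDr powR_ge0.
Qed.

Definition Lp p f :=
  measurable_fun setT f /\ mu.-integrable setT (fun x => (`|f x| `^ p)%:E).

Definition pow_int p f := \int[mu]_x (`|f x| `^ p).

Lemma pow_int_ge0 p f : 0 <= pow_int p f.
Proof. by apply: Rintegral_ge0 => x _; exact: powR_ge0. Qed.

Lemma measurable_pow p f : measurable_fun setT f ->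
  measurable_fun setT (fun x => `|f x| `^ p).
Proof.
move=> mf; apply: (measurableT_comp (measurable_powR _)).
exact: measurableT_comp.
Qed.

Lemma Lp_dominated p f g : 0 <= p -> measurable_fun setT f ->
  (forall x, `|f x| <= `|g x|) -> Lp p g -> Lp p f.
Proof.
move=> p0 mf fg [mg ig]; split => //.
apply: (@integrable_dominated _ _ _ _ ig); first exact: measurable_pow.
by move=> x; rewrite ger0_norm ?powR_ge0// ge0_ler_powR// nnegrE.
Qed.

Lemma Lp_bounded p f c : 0 <= p -> measurable_fun setT f ->
  (forall x, `|f x| <= c) -> Lp p f.
Proof.
move=> p0 mf fc; split => //.
apply: (@integrable_bounded _ (c `^ p)); first exact: measurable_pow.
move=> x; rewrite ger0_norm ?powR_ge0// ge0_ler_powR// nnegrE//.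
exact: le_trans (fc x).
Qed.

Lemma Lp_lin p c f g : 0 <= p -> Lp p f -> Lp p g ->
  Lp p (fun x => c * f x + g x).
Proof.
move=> p0 [mf fi] [mg gi]; split.
  by apply: measurable_funD => //; exact: measurable_funM.
apply: (@integrable_dominated _
  (fun x => 2 `^ p * (`|c| `^ p * `|f x| `^ p + `|g x| `^ p))).
- by apply: measurable_pow; apply: measurable_funD => //; exact: measurable_funM.
- move=> x; rewrite ger0_norm ?powR_ge0// -powRM//.
  apply: le_trans (powRD_le _ _ _); rewrite ?mulr_ge0//.
  rewrite ge0_ler_powR ?nnegrE ?addr_ge0 ?mulr_ge0//.
  by rewrite (le_trans (ler_normD _ _))// normrM.
- apply: integrable_scale; apply: integrable_add gi.
  exact: integrable_scale fi.
Qed.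

Lemma Lp_bounded_mul p f g c : 0 <= p -> measurable_fun setT f ->
  (forall x, `|f x| <= c) -> Lp p g -> Lp p (fun x => f x * g x).
Proof.
move=> p0 mf fc Lg; have c0 : forall x : T, 0 <= c by move=> x; exact: le_trans (fc x).
apply: (@Lp_dominated _ _ (fun x => c * g x + 0)) => //.
- by apply: measurable_funM => //; case: Lg.
- by move=> x; rewrite addr0 !normrM (ger0_norm (c0 x)) ler_wpM2r.
- apply: Lp_lin => //; apply: (@Lp_bounded _ (cst 0) 0) => // x.
  by rewrite normr0.
Qed.

Lemma pow_int_EFin p f : Lp p f ->
  (\int[mu]_x (`|f x| `^ p)%:E)%E = (pow_int p f)%:E.
Proof. by move=> [_ fi]; rewrite /pow_int /Rintegral fineK//; exact: integrable_fin_num. Qed.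

Lemma Lp_integrable p f : 1 <= p -> Lp p f -> integ f.
Proof.
move=> p1 [mf fi]; apply: (@integrable_dominated _ (fun x => 1 + `|f x| `^ p)) => //.
- move=> x; have [f1|/ltW f1] := leP `|f x| 1; first by rewrite (le_trans f1)// lerDl powR_ge0.
  by rewrite (le_trans (le1r_powR _ p1))// lerDr.
- by apply: integrable_add fi; exact: finite_measure_integrable_cst.
Qed.

Lemma Lp_hoelder p q f g : 0 < p -> 0 < q -> p^-1 + q^-1 = 1 ->
  Lp p f -> Lp q g ->
  integ (fun x => f x * g x) /\
  \int[mu]_x `|f x * g x| <= pow_int p f `^ p^-1 * pow_int q g `^ q^-1.
Proof.
move=> p0 q0 pq Lf Lg; have [mf _] := Lf; have [mg _] := Lg.
have := hoelder mu mf mg p0 q0 pq.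
rewrite Lnorm1 unlock /Lnorm.
under [in leRHS]eq_integral do rewrite abse_EFin poweR_EFin.
rewrite (pow_int_EFin Lf).
under [in leRHS]eq_integral do rewrite abse_EFin poweR_EFin.
rewrite (pow_int_EFin Lg) !poweR_EFin -EFinM => le.
have ii : integ (fun x => f x * g x).
  apply/integrableP; split; first exact/measurable_EFinP/measurable_funM.
  exact: le_lt_trans le (ltry _).
split => //; rewrite -lee_fin /Rintegral fineK//.
by apply: integrable_fin_num => //; exact: (integrable_norm ii).
Qed.

End finite_measure.

Section indicator.
Context d (T : measurableType d) (R : realType).
Variable mu : {finite_measure set T -> \bar R}.
Implicit Types (B : set T) (g : T -> R).

Lemma norm_indic_le1 B (y : T) : `|\1_B y : R| <= 1.
Proof. by rewrite indicE; case: (_ \in _); rewrite ?normr0 ?normr1. Qed.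

Lemma Lp_indic p B : 0 <= p -> measurable B -> Lp mu p (\1_B : T -> R).
Proof.
by move=> p0 mB; apply: (@Lp_bounded _ _ _ _ _ _ 1) => //; exact: norm_indic_le1.
Qed.

Lemma integrable_indicT B : measurable B ->
  mu.-integrable setT (EFin \o (\1_B : T -> R)).
Proof.
by move=> mB; apply: (@integrable_bounded _ _ _ _ _ 1) => //; exact: norm_indic_le1.
Qed.

Lemma Rintegral_mul_indic B g :
  \int[mu]_y (\1_B y * g y) = \int[mu]_(y in B) g y.
Proof.
rewrite [RHS]Rintegral_mkcond; apply: eq_Rintegral => y _.
by rewrite patch_indic mulrC.
Qed.

Lemma Rintegral_indicT B : measurable B -> \int[mu]_y (\1_B y : R) = fine (mu B).
Proof.
move=> mB; rewrite -[RHS]mul1r -Rintegral_cst// -[RHS]Rintegral_mul_indic.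
by apply: eq_Rintegral => y _; rewrite mulr1.
Qed.

Lemma pow_int_indic p B : 0 < p -> measurable B ->
  pow_int mu p (\1_B : T -> R) = fine (mu B).
Proof.
move=> p0 mB; rewrite -Rintegral_indicT//; apply: eq_Rintegral => y _.
by rewrite indicE; case: (y \in B); rewrite ?normr1 ?powR1// normr0 powR0// gt_eqF.
Qed.

End indicator.

(** * Duality of L^p and L^q on a finite measure space *)

Lemma cvg_norm_le (R : realType) (u e : nat -> R) (l : R) :
  (forall n, `|u n - l| <= e n) -> e @ \oo --> 0 -> u @ \oo --> l.
Proof.
move=> ue e0; apply: (@squeeze_cvgr _ _ _ _ (fun n => l - e n) (fun n => l + e n)).
- by apply: nearW => n; rewrite -ler_distl.
- by rewrite -[X in _ --> X]subr0; apply: cvgB => //; exact: cvg_cst.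
- by rewrite -[X in _ --> X]addr0; apply: cvgD => //; exact: cvg_cst.
Qed.

Lemma cvg_powR0 (R : realType) (u : nat -> R) (p : R) : 0 < p ->
  (forall n, 0 <= u n) -> u @ \oo --> 0 -> u n `^ p @[n --> \oo] --> 0.
Proof.
move=> p0 u0 cu; apply/cvgr0Pnorm_lt => e e0.
have e1 : 0 < e `^ p^-1 by rewrite powR_gt0.
move/cvgr0Pnorm_lt : cu => /(_ _ e1); apply: filterS => n.
rewrite !ger0_norm ?powR_ge0// => un.
rewrite -[ltRHS](_ : (e `^ p^-1) `^ p = e); last first.
  by rewrite -powRrM mulVf ?gt_eqF// powRr1// ltW.
by rewrite gt0_ltr_powR// nnegrE ?powR_ge0.
Qed.

(** The floor of [t] counts the integers below it. For [t = n * h x] this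
    approximates a function [h] with values in [0, 1], up to [1/n], by a
    combination of indicators of its superlevel sets. *)
Lemma count_below (R : realType) (n : nat) (t : R) : 0 <= t <= n%:R ->
  `|t - \sum_(k < n) (k.+1%:R <= t)%R%:R| <= 1.
Proof.
elim: n => [|n ih] /andP[t0 tn].
  by rewrite big_ord0 subr0 ger0_norm// (le_trans tn).
rewrite big_ord_recr /=; have [tn'|tn'] := leP t n%:R.
  have -> : (n.+1%:R <= t) = false.
    by apply/negbTE; rewrite -ltNge (le_lt_trans tn')// ltr_nat.
  by rewrite addr0 ih// t0.
rewrite (eq_bigr (fun=> 1)) => [|k _]; last first.
  by rewrite (_ : (_ <= t) = true)//; apply: le_trans (ltW tn'); rewrite ler_nat.
rewrite sumr_const card_ord.
have := tn; rewrite -natr1 => tn1.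
move: (n%:R) tn' tn1 => c ? ?.
by case: (c + 1 <= t); rewrite /= ?mulr0n ?mulr1n ler_norml; apply/andP; split; lra.
Qed.

(** An integral [J] that is finite beforehand can be divided out of a bound in
    which its own root appears: this turns the bound of a functional at one test
    function into the bound of its density in L^q. *)
Lemma le_mul_powR (R : realType) (p q A J : R) : 0 < p -> 0 < q ->
  p^-1 + q^-1 = 1 -> 0 <= J -> J <= A * J `^ p^-1 -> J <= A `^ q.
Proof.
move=> p0 q0 pq; rewrite le_eqVlt => /predU1P[<- _|J0]; first exact: powR_ge0.
have Jp : 0 < J `^ p^-1 by rewrite powR_gt0.
have {1}-> : J = J `^ q^-1 * J `^ p^-1.
  rewrite -powRD; last by rewrite (gt_eqF J0) implybT.
  by rewrite addrC pq powRr1// ltW.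
rewrite ler_pM2r// => JA.
rewrite -[leLHS](_ : (J `^ q^-1) `^ q = J); last first.
  by rewrite -powRrM mulVf ?gt_eqF// powRr1// ltW.
have A0 := le_trans (powR_ge0 _ _) JA.
by rewrite ge0_ler_powR ?nnegrE ?powR_ge0// ltW.
Qed.

Lemma conjugate_gt1 (R : realType) (p q : R) : 0 < q -> p^-1 + q^-1 = 1 ->
  0 < p -> 1 < p.
Proof.
move=> q0 pq p0; rewrite -[p]invrK -[ltLHS]invr1 ltf_pV2 ?posrE ?invr_gt0//.
by rewrite -pq ltrDl invr_gt0.
Qed.

Lemma conjugate_mul (R : realType) (p q : R) : 0 < p -> 0 < q ->
  p^-1 + q^-1 = 1 -> (q - 1) * p = q.
Proof.
move=> p0 q0 pq.
have : (p^-1 + q^-1) * (p * q) = p * q by rewrite pq mul1r.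
rewrite mulrDl mulKf ?gt_eqF// mulrCA mulVf ?gt_eqF// mulr1 => h.
by rewrite mulrBl mul1r -[RHS](addrK p) h mulrC.
Qed.

Definition clamp (R : realType) (n : nat) (x : R) : R :=
  Num.max (- n%:R) (Num.min n%:R x).

Section clamp.
Variable R : realType.
Implicit Types (x y : R) (n : nat).

Lemma clamp_bound n x : `|clamp n x| <= n%:R.
Proof.
have : 0 <= n%:R :> R by [].
rewrite /clamp; move: (n%:R) => c c0.
by case: (leP c x) => ?; case: (leP (- c) _) => ?; rewrite ler_norml; lra.
Qed.

(** Truncation contracts distances, so that it does not increase oscillations. *)
Lemma clamp_lipschitz n x y : `|clamp n x - clamp n y| <= `|x - y|.
Proof.
have n0 : 0 <= n%:R :> R by [].
rewrite /clamp; move: (n%:R) n0 => c c0.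
wlog xy : x y / x <= y => [hw|].
  by have [/hw//|/ltW/hw] := leP x y; rewrite distrC (distrC y).
rewrite (distrC x) (ger0_norm (x := y - x)) ?subr_ge0//.
by case: (leP c x) => ?; case: (leP c y) => ?; case: (leP (- c) c) => ?;
  case: (leP (- c) x) => ?; case: (leP (- c) y) => ?; rewrite ler_norml; lra.
Qed.

Lemma clamp_norm n x : `|clamp n x| <= `|x|.
Proof.
have := clamp_lipschitz n x 0; have -> : clamp n 0 = 0 :> R.
  have : 0 <= n%:R :> R by [].
  by rewrite /clamp; move: (n%:R) => c c0; case: (leP c 0) => ?; case: (leP (- c) _) => ?; lra.
by rewrite !subr0.
Qed.

Lemma clamp_cvg x : clamp n x @[n --> \oo] --> x.
Proof.
apply: cvg_near_cst; exists (Num.bound `|x|) => // n /= bn.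
have : `|x| <= n%:R.
  by rewrite (le_trans (ltW (archi_boundP (normr_ge0 _))))// ler_nat.
by rewrite ler_norml => /andP[h1 h2]; rewrite /clamp (min_idPr h2) (max_idPr h1).
Qed.

Lemma measurable_clamp d (T : measurableType d) n (h : T -> R) :
  measurable_fun setT h -> measurable_fun setT (fun t => clamp n (h t)).
Proof. by move=> mh; apply: measurable_maxr => //; exact: measurable_minr. Qed.

End clamp.

Section Lp_duality.
Context d (T : measurableType d) (R : realType).
Variable mu : {finite_measure set T -> \bar R}.
Local Notation integ f := (mu.-integrable setT (EFin \o f)).
Local Notation Lp := (Lp mu).
Local Notation pow_int := (pow_int mu).
Implicit Types (g h k : T -> R) (c : R).
Variables (p q : R) (p0 : 0 < p) (q0 : 0 < q) (pq : p^-1 + q^-1 = 1).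
Variables (A : R) (F : (T -> R) -> R).
Hypothesis FL : forall c h k, Lp p h -> Lp p k ->
  F (fun x => c * h x + k x) = c * F h + F k.
Hypothesis FB : forall h, Lp p h -> `|F h| <= A * pow_int p h `^ p^-1.

(** Dominated convergence in L^p passes through [F] by its bound. *)
Let F_cvg (h_ : nat -> T -> R) h g :
  (forall n, measurable_fun setT (h_ n)) -> measurable_fun setT h ->
  (forall n x, `|h_ n x| <= g x) -> (forall x, `|h x| <= g x) -> Lp p g ->
  (forall x, h_ ^~ x @ \oo --> h x) -> F (h_ n) @[n --> \oo] --> F h.
Proof.
move=> mh_ mh hg_ hg Lg ch.
have Ln n : Lp p (h_ n).
  apply: (Lp_dominated (ltW p0) _ _ Lg) => // x.
  by rewrite (le_trans (hg_ n x))// ler_norm.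
have L : Lp p h.
  apply: (Lp_dominated (ltW p0) _ _ Lg) => // x.
  by rewrite (le_trans (hg x))// ler_norm.
pose D n x := -1 * h x + h_ n x.
have LD n : Lp p (D n) by apply: Lp_lin => //; exact: ltW.
apply: (@cvg_norm_le _ _ (fun n => A * pow_int p (D n) `^ p^-1)).
  move=> n; apply: le_trans (FB (LD n)).
  by rewrite le_eqVlt /D FL// mulN1r addrC eqxx.
rewrite -[X in _ --> X](mulr0 A); apply: cvgMr.
apply: cvg_powR0; rewrite ?invr_gt0//; first by move=> n; exact: pow_int_ge0.
have -> : 0 = \int[mu]_x (0 : R) :> R by rewrite Rintegral_cst// mul0r.
apply: (@cvg_Rintegral_dominated _ _ _ _ _ _ (fun x => `|2 * g x + 0| `^ p)).
- by move=> n; apply: measurable_pow; case: (LD n).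
- exact: measurable_cst.
- move=> x; apply: cvg_powR0 => //; rewrite -[X in _ --> X](@normr0 _ R).
  apply: cvg_norm; rewrite -[X in _ --> X](subrr (h x)) addrC.
  rewrite /D mulN1r; apply: cvgD => //; exact: cvg_cst.
- move=> n x; rewrite ger0_norm ?powR_ge0// ge0_ler_powR ?nnegrE ?(ltW p0)//.
  rewrite /D addr0 mulN1r (le_trans (ler_normD _ _))// normrN normrM.
  rewrite ger0_norm// mulrDl mul1r lerD//; last exact: le_trans (hg_ n x) (ler_norm _).
  exact: le_trans (hg x) (ler_norm _).
- apply: (Lp_lin 2 (ltW p0) Lg _).2.
  by apply: (@Lp_bounded _ _ _ _ _ _ 0); rewrite ?(ltW p0)// => x; rewrite normr0.
Qed.

Let Lp_indic E : measurable E -> Lp p \1_E.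
Proof. exact: Lp_indic (ltW p0). Qed.

Let F_null h : Lp p h -> pow_int p h = 0 -> F h = 0.
Proof.
move=> Lh h0; have := FB Lh; rewrite h0 powR0 ?invr_eq0 ?gt_eqF// mulr0.
by rewrite normr_le0 => /eqP.
Qed.

Let nu E := (F \1_E)%:E.

Let nu0 : nu set0 = 0%E.
Proof. by rewrite /nu F_null// ?pow_int_indic ?measure0//; exact: Lp_indic. Qed.

Let nu_fin E : measurable E -> nu E \is a fin_num. Proof. by []. Qed.

Let nu_sigma : semi_sigma_additive nu.
Proof.
move=> E mE tE mUE.
pose U n := \bigcup_(i < n) E i.
have mU n : measurable (U n) by apply: bigcup_measurable => k _.
have -> : (fun n => \sum_(0 <= i < n) nu (E i))%E = EFin \o (fun n => F \1_(U n)).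
  apply/funext => n /=; elim: n => [|n ih].
    by rewrite big_nil /U bigcup_mkord big_ord0 F_null ?pow_int_indic ?measure0//;
       exact: Lp_indic.
  rewrite big_nat_recr//= ih /nu -EFinD addrC -[X in _ = (F X)%:E](_ : (fun x => 1 * \1_(E n) x + \1_(U n) x) = _).
    by rewrite FL ?mul1r//; exact: Lp_indic.
  apply/funext => x; rewrite mul1r /U !bigcup_mkord big_ord_recr/= !indicE in_setU.
  have [xU|xU] := boolP (x \in \big[setU/set0]_(i < n) E i); last by rewrite addr0.
  have [xE|xE] := boolP (x \in E n); last by rewrite add0r.
  move: xU xE; rewrite -bigcup_mkord !inE => -[k /= kn Ek] En.
  have kE : k = n by apply: (tE k n I I); exists x.
  by rewrite kE ltnn in kn.
apply/cvg_EFin; first exact: nearW.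
apply: (@F_cvg _ _ (cst 1)) => //.
- by move=> n x /=; rewrite indicE; case: (_ \in _); rewrite ?normr0 ?normr1.
- by move=> x /=; rewrite indicE; case: (_ \in _); rewrite ?normr0 ?normr1.
- by apply: (@Lp_bounded _ _ _ _ _ _ 1); rewrite ?(ltW p0)// => x; rewrite normr1.
- move=> x; have [[k _ Ek]|nE] := pselect ((\bigcup_k E k) x).
    apply: (@cvg_near_cst); exists k.+1 => // n /= kn.
    by rewrite !indicE !mem_set//; [exists k|exists k].
  apply: cvg_near_cst; apply: nearW => n.
  by rewrite !indicE !memNset// => -[k _ Ek]; apply: nE; exists k.
Qed.

HB.instance Definition _ := isCharge.Build _ _ _ nu nu0 nu_fin nu_sigma.

Let nu_mu : nu `<< mu.
Proof.
apply/null_content_dominatesP => E mE muE.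
by rewrite /nu F_null ?pow_int_indic ?muE//; exact: Lp_indic.
Qed.

Let phi x := fine (Radon_Nikodym nu mu x).

Let phiE : EFin \o phi = Radon_Nikodym nu mu.
Proof. by apply/funext => x /=; rewrite fineK// Radon_Nikodym_fin_num. Qed.

Let iphi : integ phi.
Proof. by rewrite phiE; exact: Radon_Nikodym_integrable. Qed.

Let mphi : measurable_fun setT phi.
Proof. exact/measurable_EFinP/(measurable_int mu). Qed.

Let rep h := [/\ Lp p h, integ (fun x => phi x * h x) & F h = \int[mu]_x (phi x * h x)].

Let rep_indic E : measurable E -> rep \1_E.
Proof.
move=> mE; split; first exact: Lp_indic.
- under eq_fun do rewrite mulrC.
  apply: (@integrable_mul_bounded _ _ _ _ _ _ 1) => //.
  by move=> x; rewrite indicE; case: (_ \in _); rewrite ?normr0 ?normr1.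
- have := Radon_Nikodym_integral nu_mu mE; rewrite -phiE => /(congr1 fine) /= ->.
  rewrite -[LHS]/(\int[mu]_(x in E) phi x) Rintegral_mkcond.
  by apply: eq_Rintegral => x _; rewrite patch_indic.
Qed.

Let rep_lin c h k : rep h -> rep k -> rep (fun x => c * h x + k x).
Proof.
move=> [Lh ih Fh] [Lk ik Fk]; split.
- by apply: Lp_lin => //; exact: ltW.
- have -> : (fun x => phi x * (c * h x + k x)) =
      (fun x => c * (phi x * h x) + phi x * k x) by apply/funext => x; ring.
  by apply: integrable_add ik; exact: integrable_scale.
- rewrite FL// Fh Fk -RintegralZl// -RintegralD//; last exact: integrable_scale.
  by apply: eq_Rintegral => x _; ring.
Qed.

Let rep_cvg (h_ : nat -> T -> R) h c : (forall n, rep (h_ n)) ->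
  measurable_fun setT h -> (forall n x, `|h_ n x| <= c) ->
  (forall x, h_ ^~ x @ \oo --> h x) -> rep h.
Proof.
move=> rh mh hc ch.
have hc' x : `|h x| <= c.
  have cn : `|h_ n x| @[n --> \oo] --> `|h x| by apply: cvg_norm; exact: ch.
  by rewrite -(cvg_lim _ cn)//; apply: limr_le; [apply/cvg_ex; exists (`|h x|)|exact: nearW].
have mh_ n : measurable_fun setT (h_ n) by case: (rh n) => -[].
split.
- by apply: (@Lp_bounded _ _ _ _ _ _ c); rewrite ?(ltW p0).
- by under eq_fun do rewrite mulrC; exact: (@integrable_mul_bounded _ _ _ _ _ _ c).
- have c1 : F (h_ n) @[n --> \oo] --> F h.
    apply: (@F_cvg _ _ (fun=> c)) => //.
    apply: (@Lp_bounded _ _ _ _ _ _ `|c|) => //; exact: ltW.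
  have c2 : F (h_ n) @[n --> \oo] --> \int[mu]_x (phi x * h x).
    rewrite (_ : (fun n => F (h_ n)) = (fun n => \int[mu]_x (phi x * h_ n x))).
      apply: (@cvg_Rintegral_dominated _ _ _ _ _ _ (fun x => c * `|phi x|)).
      + by move=> n; exact: measurable_funM.
      + exact: measurable_funM.
      + by move=> x; apply: cvgMr; exact: ch.
      + by move=> n x; rewrite normrM mulrC ler_wpM2r.
      + by apply: integrable_scale; exact: (integrable_norm iphi).
    by apply/funext => n; case: (rh n).
  exact: (cvg_unique _ c1 c2).
Qed.

Let rep_unit h : measurable_fun setT h -> (forall x, 0 <= h x <= 1) -> rep h.
Proof.
move=> mh h01.
pose E (n j : nat) := [set x | j.+1%:R <= n.+1%:R * h x].
have mE n j : measurable (E n j).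
  have -> : E n j = setT `&` (fun x => n.+1%:R * h x) @^-1` `[j.+1%:R, +oo[.
    by apply/seteqP; split => x /=; rewrite in_itv/= andbT => //; case.
  by apply: measurable_funM.
pose s n x : R := \sum_(k < n.+1) \1_(E n k) x.
have rs n m : rep (fun x => \sum_(k < m) \1_(E n k) x).
  elim: m => [|m ih].
    under eq_fun do rewrite big_ord0.
    by rewrite -[X in rep X](indic0 T R); exact: rep_indic.
  under eq_fun do rewrite big_ord_recr/= addrC -[X in X + _]mul1r.
  by apply: rep_lin => //; exact: rep_indic.
have rs' n : rep (fun x => n.+1%:R^-1 * s n x).
  have := rep_lin n.+1%:R^-1 (rs n n.+1) (rep_indic measurable0).
  by congr rep; apply/funext => x; rewrite indic0 addr0.
have hs n x : `|n.+1%:R^-1 * s n x - h x| <= n.+1%:R^-1.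
  have -> : n.+1%:R^-1 * s n x - h x = - (n.+1%:R^-1 * (n.+1%:R * h x - s n x)).
    by rewrite mulrBr mulKf ?pnatr_eq0// opprB.
  rewrite normrN normrM ger0_norm// -[leRHS]mulr1 ler_wpM2l//.
  have -> : s n x = \sum_(k < n.+1) (k.+1%:R <= n.+1%:R * h x)%R%:R.
    apply: eq_bigr => k _; rewrite indicE; congr (nat_of_bool _)%:R.
    by apply/idP/idP; rewrite inE.
  apply: count_below; have /andP[h0 h1] := h01 x.
  by rewrite mulr_ge0//= -[leRHS]mulr1 ler_wpM2l.
apply: (@rep_cvg _ _ 2 rs' mh).
- move=> n x; rewrite -[X in `|X|](subrK (h x)) (le_trans (ler_normD _ _))//.
  have /andP[h0 h1] := h01 x.
  rewrite (ger0_norm h0) (_ : 2 = 1 + 1 :> R)// lerD// (le_trans (hs n x))//.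
  by rewrite invf_le1// ler1n.
- move=> x; apply: (@cvg_norm_le _ _ (fun n => n.+1%:R^-1)) => //.
  exact: cvg_harmonic.
Qed.

Let rep_bounded h c : measurable_fun setT h -> (forall x, `|h x| <= c) -> rep h.
Proof.
move=> mh hc.
pose e := `|c| + 1; have e0 : 0 < e by rewrite ltr_wpDl.
have he x : - e <= h x <= e.
  by rewrite -ler_norml (le_trans (hc x))// (le_trans (ler_norm c))// lerDl.
have r1 : rep (fun x => (2 * e)^-1 * (h x + e)).
  apply: rep_unit.
    by apply: measurable_funM => //; exact: measurable_funD.
  move=> x; have /andP[h1 h2] := he x.
  rewrite mulrC divr_ge0 ?ler_pdivrMr ?mulr_gt0// ?mul1r; lra.
have r2 := rep_lin (- e) (rep_indic measurableT) (rep_indic measurable0).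
have := rep_lin (2 * e) r1 r2; congr rep; apply/funext => x.
by rewrite indicT indic0/= mulVKf ?gt_eqF ?mulr_gt0// mulr1 addr0 addrK.
Qed.

(** Testing [F] with [sg phi * min |phi| n ^ (q - 1)] bounds the L^q norm of
    [min |phi| n], uniformly in [n]. *)
Let phi_Lq : Lp q phi /\ pow_int q phi <= A `^ q.
Proof.
pose t (n : nat) x := Num.min `|phi x| n%:R.
have t0 n x : 0 <= t n x by rewrite le_min normr_ge0 ler0n.
have tn n x : t n x <= n%:R by rewrite ge_min lexx orbT.
have tphi n x : t n x <= `|phi x| by rewrite ge_min lexx.
have mt n : measurable_fun setT (t n).
  by apply: measurable_minr => //; exact: measurableT_comp.
have q1 : 1 < q by apply: (@conjugate_gt1 _ _ p) => //; rewrite addrC.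
have it n : integ (fun x => t n x `^ q).
  have : Lp q (t n).
    apply: (@Lp_bounded _ _ _ _ _ _ n%:R); rewrite ?(ltW q0)//.
    by move=> x; rewrite ger0_norm.
  by move=> [_]; under eq_fun do rewrite ger0_norm//.
pose P := [set x | 0 <= phi x].
have mP : measurable P.
  have -> : P = setT `&` phi @^-1` `[0, +oo[.
    by apply/seteqP; split => x /=; rewrite in_itv/= andbT => //; case.
  exact: mphi.
pose sg x : R := \1_P x - \1_(~` P) x.
have sgE x : sg x = if 0 <= phi x then 1 else -1.
  rewrite /sg indicC indicE; have -> : (x \in P) = (0 <= phi x) by apply/idP/idP; rewrite inE.
  by case: ifP => _ /=; rewrite ?subr0 ?sub0r.
have sg1 x : `|sg x| = 1 by rewrite sgE; case: ifP => _; rewrite ?normrN normr1.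
have sgphi x : phi x * sg x = `|phi x|.
  rewrite sgE; case: ifPn => [x0|]; first by rewrite mulr1 ger0_norm.
  by rewrite -ltNge => x0; rewrite mulrN1 ltr0_norm.
pose g n x := sg x * t n x `^ (q - 1).
have gt n x : `|g n x| = t n x `^ (q - 1).
  by rewrite normrM sg1 mul1r ger0_norm ?powR_ge0.
have mg n : measurable_fun setT (g n).
  apply: measurable_funM; first by apply: measurable_funB => //; exact: measurable_indic (measurableC mP).
  exact: (measurableT_comp (measurable_powR _)).
have J n : \int[mu]_x (t n x `^ q) <= A `^ q.
  apply: (le_mul_powR p0 q0 pq); first by apply: Rintegral_ge0 => x _; exact: powR_ge0.
  have [Lg ig Fg] : rep (g n).
    apply: (@rep_bounded _ (n%:R `^ (q - 1))) => // x.
    by rewrite gt ge0_ler_powR ?nnegrE// subr_ge0 ltW.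
  apply: (@le_trans _ _ (F (g n))).
    rewrite Fg; apply: le_Rintegral => // x _.
    rewrite mulrA sgphi -[leLHS](@mulr_powRB1 _ (t n x) q)//.
    by rewrite ler_wpM2r ?powR_ge0.
  apply: le_trans (ler_norm _) _; apply: le_trans (FB Lg) _.
  have -> // : pow_int p (g n) = \int[mu]_x (t n x `^ q).
  by apply: eq_Rintegral => x _; rewrite gt -powRrM conjugate_mul.
have [] := @Rintegral_limit_le _ _ _ mu (fun n x => t n x `^ q)
    (fun x => `|phi x| `^ q) (A `^ q) it (measurable_pow q mphi) _ _ _ J.
- by move=> n x; exact: powR_ge0.
- move=> x n m nm; rewrite ge0_ler_powR ?nnegrE ?(ltW q0)//.
  by rewrite le_min ge_min lexx/= ge_min ler_nat nm orbT.
- move=> x; apply: cvg_near_cst.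
  exists (Num.bound `|phi x|) => // n /= bn; congr (_ `^ _); apply: min_idPl.
  by rewrite (le_trans (ltW (archi_boundP (normr_ge0 _))))// ler_nat.
- by move=> iq le; split.
Qed.

(** By dominated convergence [E |-> F 1_E] is countably additive; it vanishes on
    null sets, so it has a density [phi]. Both sides of the representation are
    linear and continuous under bounded convergence, hence agree on bounded
    functions, which are uniform limits of combinations of indicators. Once
    [phi] is known to be in L^q, truncation extends this to all of L^p. *)
Lemma Lp_functional_rep : exists phi : T -> R,
  [/\ Lp q phi, pow_int q phi <= A `^ q &
  forall h, Lp p h -> F h = \int[mu]_x (phi x * h x)].
Proof.
have [Lphi phiA] := phi_Lq.
exists phi; split => // h Lh.
have [ih _] := Lp_hoelder q0 p0 (etrans (addrC _ _) pq) Lphi Lh.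
have [mh _] := Lh.
pose h_ (n : nat) x := clamp n (h x).
have mh_ n : measurable_fun setT (h_ n).
  exact: measurable_clamp.
have h_h n x : `|h_ n x| <= `|h x| by exact: clamp_norm.
have ch x : h_ ^~ x @ \oo --> h x by exact: clamp_cvg.
have c1 : F (h_ n) @[n --> \oo] --> F h.
  apply: (@F_cvg _ _ (fun x => `|h x|)) => //.
  apply: (Lp_dominated (ltW p0) _ _ Lh); first exact: measurableT_comp.
  by move=> x; rewrite normr_id.
have c2 : F (h_ n) @[n --> \oo] --> \int[mu]_x (phi x * h x).
  rewrite (_ : (fun n => F (h_ n)) = (fun n => \int[mu]_x (phi x * h_ n x))).
    apply: (@cvg_Rintegral_dominated _ _ _ _ _ _ (fun x => `|phi x * h x|)).
    + by move=> n; exact: measurable_funM.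
    + exact: measurable_funM.
    + by move=> x; apply: cvgMr; exact: ch.
    + by move=> n x; rewrite !normrM ler_wpM2l.
    + exact: (integrable_norm ih).
  apply/funext => n; have [_ _ ->//] := rep_bounded (mh_ n)
    (fun x => clamp_bound n (h x)).
exact: (cvg_unique _ c1 c2).
Qed.

End Lp_duality.

(** * Balls of a locally doubling finite measure *)

Lemma exists_nat_gt (R : realType) (t : R) : exists n : nat, t < n%:R.
Proof.
by exists (Num.bound `|t|); rewrite (le_lt_trans (ler_norm _))// archi_boundP.
Qed.

Section metric_balls.
Context {R : realType} {M : pointedMetricType R}.
Implicit Types (x y z : M) (s t : R).

Lemma in_ball x s y : ball x s y <-> mdist x y < s.
Proof. by rewrite ballEmdist. Qed.

Lemma metric_ball_open x s : open (ball x s).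
Proof.
rewrite openE => y /in_ball xy; apply/nbhs_ballP.
exists (s - mdist x y) => /=; first by rewrite subr_gt0.
by move=> z /in_ball yz; apply/in_ball; have := metric_triangle x y z; lra.
Qed.

Lemma borel_open (A : set M) : open A -> measurable (A : set (borel M)).
Proof. by move=> oA; exact: sub_sigma_algebra. Qed.

Lemma measurable_ball x s : measurable (ball x s : set (borel M)).
Proof. by apply: borel_open; exact: metric_ball_open. Qed.

Lemma subset_ball x y s t : mdist x y + s <= t -> ball y s `<=` ball x t.
Proof.
move=> st z /in_ball yz; apply/in_ball; have := metric_triangle x y z; lra.
Qed.

(** Induction along chains of approximate midpoints: a relation that holds
    at distance at most [R1] and composes propagates to any distance [d] with
    [beta ^+ k * d <= R1], since each bisection multiplies distances by
    [beta]. *)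
Lemma midpoint_chain (R0 beta R1 : R) (Q : nat -> M -> M -> Prop) :
  approximate_midpoint (M := M) R0 beta -> R0 <= R1 ->
  (forall x y, mdist x y <= R1 -> Q 0%N x y) ->
  (forall k x y, Q k x y -> Q k.+1 x y) ->
  (forall k x y z, Q k x z -> Q k y z -> Q k.+1 x y) ->
  forall k x y, beta ^+ k * mdist x y <= R1 -> Q k x y.
Proof.
move=> [R00 hb b1 mid] R01 Q0 QS Qz.
have b0 : 0 < beta by apply: lt_trans hb; rewrite invr_gt0.
elim=> [|k ih] x y; first by rewrite mul1r; exact: Q0.
move=> dk; have [dR|dR] := leP (mdist x y) R1.
  by apply: (QS); elim: k {ih dk} => [|k ih]; [exact: Q0|exact: (QS)].
have [z [xz yz]] := mid x y (le_lt_trans R01 dR).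
by apply: (Qz k x y z); apply: ih; apply: le_trans dk;
  rewrite exprSr -mulrA ler_wpM2l ?exprn_ge0 ?ltW.
Qed.

Lemma expr_mul_le (beta t R1 : R) : 0 <= beta < 1 -> 0 < R1 ->
  exists k, beta ^+ k * t <= R1.
Proof.
move=> /andP[b0 b1] R10.
have : `|t| * beta ^+ k @[k --> \oo] --> `|t| * 0.
  by apply: cvgMr; apply: cvg_expr; rewrite ger0_norm.
rewrite mulr0 => /cvgr0Pnorm_lt /(_ _ R10) [k _ /(_ k (leqnn k))] /= h.
exists k; rewrite mulrC (le_trans _ (ltW h))// (le_trans (ler_norm _))//.
by rewrite !normrM normr_id.
Qed.

End metric_balls.

Section doubling_balls.
Context {R : realType} {M : pointedMetricType R}.
Variable mu : {finite_measure set (borel M) -> \bar R}.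
Hypothesis mu_gt0 : (0 < mu setT)%E.
Hypothesis LD : locally_doubling mu.
Implicit Types (x y : M) (s t : R).

Local Notation vol x s := (fine (mu (ball x s))).

Lemma mu_fin_num (A : set (borel M)) : measurable A -> mu A \is a fin_num.
Proof. by move=> mA; exact: fin_num_measure. Qed.

Lemma vol_EFin x s : mu (ball x s) = (vol x s)%:E.
Proof. by rewrite fineK// mu_fin_num//; exact: measurable_ball. Qed.

Lemma le_vol x y s t : mdist x y + s <= t -> vol y s <= vol x t.
Proof.
move=> st; apply: fine_le; rewrite ?mu_fin_num//; try exact: measurable_ball.
apply: le_measure; rewrite ?inE; try exact: measurable_ball.
exact: (subset_ball st).
Qed.

(** Iterated doubling compares balls of any two radii, uniformly in the centre. *)
Lemma vol_doubling s t : 0 < s ->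
  exists D, 0 < D /\ forall x, vol x t <= D * vol x s.
Proof.
move=> s0; have [n tn] : exists n, t <= 2 ^+ n * s.
  have [n tn] := exists_nat_gt (t / s).
  exists n; rewrite -ler_pdivrMr// (le_trans (ltW tn))//.
  by rewrite -natrX ler_nat ltnW// ltn_expl.
have [D [D0 hD]] : exists D, 0 < D /\ forall x, vol x (2 ^+ n * s) <= D * vol x s.
  elim: n {tn} => [|n [D [D0 hD]]]; first by exists 1; split => // x; rewrite !mul1r.
  have ns0 : 0 < 2 ^+ n * s by rewrite mulr_gt0// exprn_gt0.
  have [D' hD'] := LD ns0; exists ((`|D'| + 1) * D); split.
    by rewrite mulr_gt0// ltr_wpDl.
  move=> x; have h : (mu (ball x (2 * (2 ^+ n * s))) <=
      D'%:E * mu (ball x (2 ^+ n * s)))%E by apply: hD'; rewrite ns0 lexx.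
  move: h; rewrite vol_EFin [X in (_ <= _ * X)%E]vol_EFin -EFinM lee_fin.
  rewrite mulrA -exprS => h.
  rewrite (le_trans h)// -mulrA (@le_trans _ _ ((`|D'| + 1) * vol x (2 ^+ n * s)))//.
    by rewrite ler_wpM2r ?fine_ge0// (le_trans (ler_norm _))// lerDl.
  by rewrite ler_wpM2l// addr_ge0.
exists D; split => // x; apply: le_trans (hD x).
by apply: le_vol; rewrite mdistxx add0r.
Qed.

(** By doubling, a null ball would make all concentric balls null, and these
    exhaust the space. *)
Lemma vol_gt0 x s : 0 < s -> 0 < vol x s.
Proof.
move=> s0; rewrite lt_neqAle fine_ge0// andbT eq_sym; apply/negP => /eqP v0.
have : mu setT = 0%E.
  have -> : setT = \bigcup_n ball x n%:R.
    apply/seteqP; split => // y _.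
    have [n xyn] := exists_nat_gt (mdist x y).
    by exists n => //; apply/in_ball.
  apply: measure_negligible.
    by apply: bigcup_measurable => k _; exact: measurable_ball.
  apply: negligible_bigcup => n; apply/negligibleP; first exact: measurable_ball.
  have [D [_ hD]] := vol_doubling n%:R s0.
  have vn : vol x n%:R = 0.
    by apply/eqP; rewrite eq_le fine_ge0// andbT; have := hD x; rewrite v0 mulr0.
  by rewrite [LHS]vol_EFin vn.
by move=> h; move: mu_gt0; rewrite h ltxx.
Qed.

(** A maximal family of pairwise disjoint balls is countable because every
    ball has positive measure. *)
Lemma countable_disjoint_balls (E : set M) s : 0 < s ->
  trivIset E (fun x => ball x s) -> countable E.
Proof.
move=> s0 tE.
have -> : E = \bigcup_n [set x | E x /\ n.+1%:R^-1 < vol x s].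
  apply/seteqP; split => [x Ex|x [n _ []]//].
  have v0 := vol_gt0 x s0.
  have [n vn] := exists_nat_gt (vol x s)^-1.
  exists n => //; split => //.
  rewrite -[ltRHS]invrK ltf_pV2 ?posrE ?invr_gt0//.
  by rewrite (lt_trans vn)// ltr_nat.
apply: bigcup_countable => // n _; apply: finite_set_countable.
apply: contrapT => /infinite_set_fset.
have [K hK] := exists_nat_gt (fine (mu setT) * n.+1%:R).
move=> /(_ K) [X XE XK].
have tX : trivIset [set` X] (fun x => ball x s).
  by apply: sub_trivIset tE => x /XE [].
have := @measure_fin_bigcup _ _ _ mu _ [set` X] (fun x => ball x s : set (borel M))
   (finite_fset X) tX (fun x _ => measurable_ball x s).
rewrite fsbig_finite//= set_fsetK => h.
have : (mu (\bigcup_(x in [set` X]) ball x s) <= mu setT)%E.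
  apply: le_measure => //; rewrite ?inE//.
  apply: fin_bigcup_measurable; first exact: finite_fset.
  by move=> x _; exact: measurable_ball.
rewrite h; under eq_bigr do rewrite vol_EFin.
rewrite sumEFin -[leRHS]fineK ?mu_fin_num// lee_fin.
apply/negP; rewrite -ltNge.
apply: (@lt_le_trans _ _ (\sum_(x <- X) n.+1%:R^-1)); last first.
  rewrite big_seq [leRHS]big_seq; apply: ler_sum => x xX.
  by have [_ /ltW] := XE _ xX.
rewrite big_const_seq count_predT iter_addr_0 -[ltRHS]mulr_natr ltr_pdivlMl//.
by rewrite mulrC (lt_le_trans hK)// ler_nat.
Qed.

(** A sequence of centres whose balls of radius [t] cover the space while the
    balls of half that radius around distinct centres are disjoint. *)
Lemma separated_cover t : 0 < t -> exists x_ : nat -> M,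
  (forall y, exists n, ball (x_ n) t y) /\
  (forall m n, x_ m <> x_ n -> ball (x_ m) (t / 2) `&` ball (x_ n) (t / 2) = set0).
Proof.
move=> t0; have t20 : 0 < t / 2 by rewrite divr_gt0.
have [E [_ tE maxE]] := ex_maximal_disjoint_subcollection
  (fun x : M => ball x (t / 2)) [set: M].
have cE := countable_disjoint_balls t20 tE.
have cover y : exists2 x, E x & ball x t y.
  apply: contrapT => nE.
  have far x : E x -> t <= mdist x y.
    by move=> Ex; rewrite leNgt; apply/negP => /in_ball ?; apply: nE; exists x.
  have nEy : ~ E y.
    by move=> /far; rewrite mdistxx leNgt t0.
  have disj x : E x -> ball x (t / 2) `&` ball y (t / 2) = set0.
    move=> Ex; apply/seteqP; split => // z [/in_ball xz /in_ball yz].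
    have := far x Ex; have := metric_triangle x z y; rewrite (metric_sym z y); lra.
  apply: (maxE (E `|` [set y])) => //.
    by split=> [x|/(_ y) h]; [left|apply: nEy; apply: h; right].
  move=> x z [Ex|->] [Ez|->] // [w [w1 w2]].
  - by apply: tE => //; exists w.
  - by have := disj x Ex; rewrite -subset0 => /(_ w) [].
  - by have := disj z Ez; rewrite -subset0 => /(_ w) [].
have [E0|] := pfcard_geP cE; first by have [x] := cover point; rewrite E0.
move=> [f]; exists f; split.
  move=> y; have [x Ex xy] := cover y.
  by have [n _ fn] := @surj _ _ _ _ f x Ex; exists n; rewrite fn.
move=> m n mn; apply: contrapT => /eqP/set0P ne; apply: mn.
by apply: (tE (f m) (f n)) => //; exact: funS.
Qed.

End doubling_balls.

(** * Oscillation controls the L^1 norm *)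

Section mean_value.
Context d (T : measurableType d) (R : realType).
Variable mu : {finite_measure set T -> \bar R}.
Implicit Types (A B : set T) (f : T -> R) (c : R).

Definition mean B f := (fine (mu B))^-1 * \int[mu]_(x in B) f x.

Lemma integrable_sub_cst B f c : measurable B ->
  mu.-integrable B (EFin \o f) -> mu.-integrable B (EFin \o (fun x => f x - c)).
Proof.
move=> mB fi.
have ci : mu.-integrable B (EFin \o cst c) by exact: finite_measure_integrable_cst.
exact: (integrableB mB fi ci).
Qed.

Lemma le_Rintegral_subset A B f : measurable A -> measurable B -> A `<=` B ->
  mu.-integrable B (EFin \o f) -> (forall x, B x -> 0 <= f x) ->
  \int[mu]_(x in A) f x <= \int[mu]_(x in B) f x.
Proof.
move=> mA mB AB fi f0; apply: fine_le.
- by apply: integrable_fin_num => //; exact: integrableS fi.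
- exact: integrable_fin_num.
- by apply: ge0_subset_integral => //; exact: (measurable_int mu).
Qed.

Lemma mean_dist_le A B f c : measurable A -> measurable B -> A `<=` B ->
  0 < fine (mu A) -> mu.-integrable B (EFin \o f) ->
  `|mean A f - c| <= (fine (mu A))^-1 * \int[mu]_(x in B) `|f x - c|.
Proof.
move=> mA mB AB A0 fi.
have fA : mu.-integrable A (EFin \o f) by exact: integrableS fi.
have -> : mean A f - c = (fine (mu A))^-1 * \int[mu]_(x in A) (f x - c).
  rewrite RintegralB//; last exact: finite_measure_integrable_cst.
  by rewrite Rintegral_cst// mulrBr mulrCA mulVf ?gt_eqF// mulr1.
have m0 : 0 <= (fine (mu A))^-1 by rewrite invr_ge0 ltW.
rewrite normrM (ger0_norm m0) ler_wpM2l//.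
apply: le_trans (le_normr_Rintegral mA (integrable_sub_cst c mA fA)) _.
apply: le_Rintegral_subset => //.
exact: (integrable_norm (integrable_sub_cst c mB fi)).
Qed.

End mean_value.

Lemma in_seqDU (T : Type) (F : nat -> set T) n x :
  seqDU F n x <-> F n x /\ forall m, (m < n)%N -> ~ F m x.
Proof.
rewrite /seqDU -bigcup_mkord; split=> -[Fx nFx]; split => //.
  by move=> m mn Fmx; apply: nFx; exists m.
by move=> [m /= mn]; exact: nFx.
Qed.

Section oscillation.
Context {R : realType} {M : pointedMetricType R}.
Variable mu : {finite_measure set (borel M) -> \bar R}.
Implicit Types (x : M) (s t : R) (A : set M).
Local Notation vol x s := (fine (mu (ball x s))).

(** The distance to the complement is 1-Lipschitz, so the points of [A] outside
    the collar form an open set. *)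
Lemma inner_collar_measurable A kappa : open A ->
  measurable (inner_collar A kappa : set (borel M)).
Proof.
move=> oA; pose D x := ereal_inf [set (mdist x y)%:E | y in ~` A].
have oU : open [set x | (kappa%:E < D x)%E].
  rewrite openE => x /= Dx.
  have [e ke eD] : exists2 e, kappa < e & (e%:E <= D x)%E.
    move: Dx; case: (D x) => [r|_|//]; last by exists (kappa + 1); rewrite ?ltrDl ?leey.
    by rewrite lte_fin => kr; exists r.
  apply/nbhs_ballP; exists ((e - kappa) / 2) => /=; first by rewrite divr_gt0 ?subr_gt0.
  move=> y /in_ball xy; apply: (@lt_le_trans _ _ ((e + kappa) / 2)%:E).
    by rewrite lte_fin; lra.
  apply/ereal_infP => _ [z nAz <-]; rewrite lee_fin.
  have : (e%:E <= (mdist x z)%:E)%E.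
    by apply: le_trans eD _; apply: ereal_inf_lbound; exists z.
  by rewrite lee_fin; have := metric_triangle x y z; lra.
have -> : inner_collar A kappa = A `\` [set x | (kappa%:E < D x)%E].
  apply/seteqP; split => x [Ax h]; split => //=.
    by apply/negP; rewrite -leNgt.
  by move/negP: h; rewrite -leNgt.
exact: measurableD (borel_open oA) (borel_open oU).
Qed.

(** Superlevel sets of [w] need not be open, whereas the isoperimetric
    inequality only speaks of open sets. *)
Definition fat_level (w : M -> R) (eta t : R) : set M :=
  \bigcup_(x in [set x | t < w x]) ball x eta.

Lemma fat_level_open w eta t : open (fat_level w eta t).
Proof. by apply: bigcup_open => x _; exact: metric_ball_open. Qed.

(** If [w] varies by at most [L] at scale [3 eta], then the collar of width
    [eta] of a superlevel set misses the superlevel set that is [L] higher;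
    the isoperimetric inequality thus turns into a geometric decay. *)
Lemma fat_level_decay (w : M -> R) (x0 : M) (r0 C eta t L : R) : 0 < eta ->
  (forall A, open A -> A `<=` ~` closure (ball x0 r0) ->
     ((C * eta)%:E * mu A <= mu (inner_collar A eta))%E) ->
  (forall x, t < w x -> r0 + 2 * eta <= mdist x0 x) ->
  (forall x y, mdist x y <= 3 * eta -> w x <= w y + L) ->
  fine (mu (fat_level w eta (t + L))) <=
    (1 - C * eta) * fine (mu (fat_level w eta t)).
Proof.
move=> eta0 iso far lip.
set A := fat_level w eta t; set B := fat_level w eta (t + L).
have oA : open A by exact: fat_level_open.
have mA := borel_open oA.
have mB : measurable (B : set (borel M)) by apply: borel_open; exact: fat_level_open.
have mK := inner_collar_measurable eta oA.
have AC : A `<=` ~` closure (ball x0 r0).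
  move=> y [x /far x0x /in_ball xy] cl.
  have [z [/in_ball x0z /in_ball yz]] := cl _ (nbhsx_ballx y _ eta0).
  have := metric_triangle x0 z x; have := metric_triangle z y x.
  by rewrite (metric_sym z y) (metric_sym y x); lra.
have wmono x y : mdist x y < 3 * eta -> t + L < w x -> A y.
  move=> xy tx; exists y => /=; last by apply/in_ball; rewrite mdistxx.
  by have := lip x y (ltW xy); lra.
have BA : B `<=` A.
  by move=> y [x tx /in_ball xy]; apply: (wmono x y) => //; lra.
have KB : inner_collar A eta `&` B = set0.
  apply/seteqP; split => // y [[Ay inf] [x tx /in_ball xy]].
  have /ereal_inf_lt[_ [z nAz <-]] :
      (ereal_inf [set (mdist y z)%:E | z in ~` A] < (2 * eta)%:E)%E.
    by apply: le_lt_trans inf _; rewrite lte_fin; lra.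
  rewrite lte_fin => yz; apply: nAz; apply: (wmono x z) => //.
  by have := metric_triangle x y z; lra.
have KBA : inner_collar A eta `|` B `<=` A by move=> y [[]//|/BA].
have : (mu (inner_collar A eta) + mu B <= mu A)%E.
  rewrite -measureU//; apply: le_measure => //; rewrite inE//.
  exact: measurableU.
have := iso A oA AC.
rewrite -(fineK (mu_fin_num mu mA)) -(fineK (mu_fin_num mu mB)).
rewrite -(fineK (mu_fin_num mu mK)) -EFinM -EFinD !lee_fin.
by rewrite mulrBl mul1r; lra.
Qed.

(** The measures of the levels [t + j * L] form a sequence that decreases
    geometrically with ratio [1 - C * eta]. *)
Lemma fat_level_sum (w : M -> R) (x0 : M) (r0 C eta t L : R) : 0 < eta ->
  0 < C * eta <= 2^-1 -> 0 <= L ->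
  (forall A, open A -> A `<=` ~` closure (ball x0 r0) ->
     ((C * eta)%:E * mu A <= mu (inner_collar A eta))%E) ->
  (forall x, t < w x -> r0 + 2 * eta <= mdist x0 x) ->
  (forall x y, mdist x y <= 3 * eta -> w x <= w y + L) ->
  (\sum_(0 <= j <oo) mu (fat_level w eta (t + j%:R * L)%R) <=
    (fine (mu setT) / (C * eta))%:E)%E.
Proof.
move=> eta0 /andP[C0 C1] L0 iso far lip.
pose a j := fine (mu (fat_level w eta (t + j%:R * L)%R)).
have mA s : measurable (fat_level w eta s : set (borel M)).
  by apply: borel_open; exact: fat_level_open.
have decay j : a j.+1 <= (1 - C * eta) * a j.
  rewrite /a -natr1 mulrDl mul1r addrA.
  apply: (fat_level_decay (x0 := x0) (r0 := r0)) => // x tx; apply: far.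
  by apply: le_lt_trans tx; rewrite lerDl mulr_ge0.
have aexp j : a j <= fine (mu setT) * (1 - C * eta) ^+ j.
  elim: j => [|j ih].
    rewrite mulr1; apply: fine_le; rewrite ?mu_fin_num//.
    by apply: le_measure; rewrite ?inE.
  rewrite exprS mulrCA (le_trans (decay j))// ler_wpM2l//; lra.
have ak j : mu (fat_level w eta (t + j%:R * L)%R) = (a j)%:E.
  by rewrite fineK// mu_fin_num.
apply: lime_le; first by apply: is_cvg_nneseries => n _ _; exact: measure_ge0.
apply: nearW => n; rewrite (eq_bigr (EFin \o a)); last by move=> j _; rewrite ak.
rewrite sumEFin lee_fin.
apply: (@le_trans _ _ (\sum_(0 <= j < n) fine (mu setT) * (1 - C * eta) ^+ j)).
  by apply: ler_sum => j _; exact: aexp.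
rewrite -mulr_sumr ler_wpM2l ?fine_ge0//.
rewrite -[leRHS]mul1r ler_pdivlMr// mulrC.
have -> : C * eta * \sum_(0 <= j < n) (1 - C * eta) ^+ j = 1 - (1 - C * eta) ^+ n.
  elim: n => [|n ih]; first by rewrite big_nil mulr0 expr0 subrr.
  by rewrite big_nat_recr//= mulrDr ih exprS; ring.
by rewrite gerBl exprn_ge0; lra.
Qed.

(** The L^1 distance of [f] to a constant is estimated over the cells of a
    separated cover: in each cell [f] is close to its mean over a ball, and
    those means are summed by the layer cake formula. *)
Lemma integral_le_levels (f u : M -> R) (kappa eta s D N K0 L : R)
    (x_ : nat -> M) (S : R) :
  measurable_fun setT (f : borel M -> R) -> 0 < eta <= s -> 0 <= D -> 0 <= N ->
  0 <= K0 -> 0 < L ->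
  (forall x, vol x s <= D * vol x (eta / 2)) ->
  (forall x, mu.-integrable (ball x s : set (borel M)) (EFin \o f)) ->
  (forall x, \int[mu]_(y in (ball x s : set (borel M))) `|f y - u x| <= N * vol x s) ->
  (forall y, exists n, ball (x_ n) eta y) ->
  (forall m n, x_ m <> x_ n ->
    ball (x_ m) (eta / 2) `&` ball (x_ n) (eta / 2) = set0) ->
  (\sum_(0 <= j <oo) mu (fat_level (fun x => `|u x - kappa|)%R eta (K0 + j%:R * L)%R)
     <= S%:E)%E ->
  (\int[mu]_x (`|f x - kappa|)%:E <=
     (N * D * fine (mu setT) + K0 * fine (mu setT) + L * S)%:E)%E.
Proof.
move=> mf /andP[eta0 etas] D0 N0 K00 L0 hD fi hN cover disj hS.
pose w x := `|u x - kappa|.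
pose A j : set (borel M) := fat_level w eta (K0 + j%:R * L).
pose Q : nat -> set (borel M) := seqDU (fun n => ball (x_ n) eta : set (borel M)).
pose E : nat -> set (borel M) := seqDU (fun n => ball (x_ n) (eta / 2) : set (borel M)).
have mQ n : measurable (Q n).
  by apply: measurableD; [exact: measurable_ball|
    apply: bigsetU_measurable => i _; exact: measurable_ball].
have mE n : measurable (E n).
  by apply: measurableD; [exact: measurable_ball|
    apply: bigsetU_measurable => i _; exact: measurable_ball].
have mA j : measurable (A j) by apply: borel_open; exact: fat_level_open.
have QT : \bigcup_n Q n = setT.
  rewrite -seqDU_bigcup_eq; apply/seteqP; split => // y _.
  by have [n] := cover y; exists n.
have tQ : trivIset setT Q by exact: trivIset_seqDU.
have tE : trivIset setT E by exact: trivIset_seqDU.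
have mfk : measurable_fun setT (fun x : borel M => (`|f x - kappa|)%:E).
  apply/measurable_EFinP; apply: measurableT_comp => //.
  exact: measurable_funB.
have cell n : (\int[mu]_(x in Q n) (`|f x - kappa|)%:E <=
    (N * D)%:E * mu (E n) + (K0%:E * mu (Q n) +
      L%:E * \sum_(0 <= j <oo) mu (Q n `&` A j)))%E.
  have [Q0|/set0P Qne] := eqVneq (Q n) set0.
    rewrite Q0 integral_set0 adde_ge0 ?adde_ge0 ?mule_ge0 ?lee_fin ?mulr_ge0 ?(ltW L0)//.
    by apply: nneseries_ge0.
  have QB : Q n `<=` ball (x_ n) s.
    by move=> y [/in_ball ? _]; apply/in_ball; lra.
  have En : E n = ball (x_ n) (eta / 2).
    apply/seteqP; split => [y []//|y By]; apply/in_seqDU; split => // m mn Bm.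
    have xmn : x_ m <> x_ n.
      move=> e; case: Qne => z /in_seqDU[zn /(_ m mn)]; apply.
      by rewrite e.
    by have := disj m n xmn; rewrite -subset0 => /(_ y) [].
  have fu : (\int[mu]_(x in Q n) (`|f x - u (x_ n)|)%:E <= (N * D)%:E * mu (E n))%E.
    apply: (@le_trans _ _ (\int[mu]_(x in (ball (x_ n) s : set (borel M))) (`|f x - u (x_ n)|)%:E)%E).
      apply: ge0_subset_integral => //; first exact: measurable_ball.
      apply/measurable_EFinP; apply: measurableT_comp => //.
      by apply: measurable_funB => //; apply: measurable_funS mf.
    have ii : mu.-integrable (ball (x_ n) s : set (borel M)) (EFin \o (fun y => `|f y - u (x_ n)|)).
      exact: (integrable_norm (integrable_sub_cst _ (measurable_ball _ _) (fi _))).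
    rewrite -[leLHS]fineK; last by apply: (integrable_fin_num _ ii); exact: measurable_ball.
    rewrite En vol_EFin -EFinM lee_fin (le_trans (hN (x_ n)))//.
    by rewrite -mulrA ler_wpM2l.
  have wQ : ((w (x_ n))%:E * mu (Q n) <= K0%:E * mu (Q n) +
      L%:E * \sum_(0 <= j <oo) mu (Q n `&` A j))%E.
    have [J hJ] : exists J : nat, w (x_ n) <= K0 + J%:R * L /\
        forall j, (j < J)%N -> K0 + j%:R * L < w (x_ n).
      have ex : exists J : nat, w (x_ n) <= K0 + J%:R * L.
        have [J hJ] := exists_nat_gt (w (x_ n) / L); exists J.
        by move: hJ; rewrite ltr_pdivrMr// => /ltW h; rewrite (le_trans h)// lerDr.
      exists (ex_minn ex); case: ex_minnP => J hJ minJ; split => // j jJ.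
      by rewrite ltNge; apply/negP => /minJ; rewrite leqNgt jJ.
    case: hJ => hJ hj.
    apply: (@le_trans _ _ ((K0 + J%:R * L)%:E * mu (Q n))%E).
      by apply: lee_wpmul2r => //; rewrite lee_fin.
    rewrite EFinD ge0_muleDl ?lee_fin ?mulr_ge0 ?(ltW L0)// leeD2l//.
    rewrite mulrC EFinM -muleA; apply: lee_wpmul2l; first by rewrite lee_fin ltW.
    apply: (@le_trans _ _ (\sum_(0 <= j < J) mu (Q n `&` A j))%E); last first.
      exact: nneseries_lim_ge.
    rewrite (eq_big_nat _ _ (F2 := fun=> mu (Q n))).
      rewrite -(fineK (mu_fin_num mu (mQ n))) -EFinM sumEFin lee_fin.
      by rewrite big_const_nat subn0 iter_addr_0 mulr_natl.
    move=> j /andP[_ jJ]; congr (mu _); apply/seteqP; split => [y []//|y Qy]; split => //.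
    by exists (x_ n); [exact: hj|case: Qy].
  apply: (@le_trans _ _ (\int[mu]_(x in Q n) ((`|f x - u (x_ n)|)%:E + (w (x_ n))%:E))%E).
    apply: ge0_le_integral => //.
    - by apply: measurable_funS mfk.
    - apply: emeasurable_funD => //; apply/measurable_EFinP; apply: measurableT_comp => //.
      by apply: measurable_funB => //; apply: measurable_funS mf.
    - move=> x _; rewrite -EFinD lee_fin.
      by rewrite (le_trans _ (ler_normD _ _))// addrA subrK.
  rewrite ge0_integralD//.
  - by rewrite integral_cst// leeD.
  - apply/measurable_EFinP; apply: measurableT_comp => //.
    by apply: measurable_funB => //; apply: measurable_funS mf.
  - by move=> x _; rewrite lee_fin; exact: normr_ge0.
rewrite -[X in (\int[mu]_(x in X) _)%E]QT ge0_integral_bigcup//; last by rewrite QT.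
apply: (@le_trans _ _ (\sum_(0 <= n <oo) ((N * D)%:E * mu (E n) + (K0%:E * mu (Q n) +
      L%:E * \sum_(0 <= j <oo) mu (Q n `&` A j))))%E).
  by apply: lee_nneseries => *; [exact: integral_ge0|exact: cell].
have sE : (\sum_(0 <= n <oo) mu (E n) <= mu setT)%E.
  have := @measure_bigcup _ _ _ mu setT E (fun i _ => mE i) tE.
  rewrite (eq_eseriesl (Q := xpredT)) => [<-|i]; last by rewrite in_setT.
  by apply: le_measure; rewrite ?inE//; exact: bigcup_measurable.
have sQ : (\sum_(0 <= n <oo) mu (Q n) = mu setT)%E.
  have := @measure_bigcup _ _ _ mu setT Q (fun i _ => mQ i) tQ.
  by rewrite (eq_eseriesl (Q := xpredT)) => [<-|i]; [rewrite QT|rewrite in_setT].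
have sA : (\sum_(0 <= n <oo) \sum_(0 <= j <oo) mu (Q n `&` A j) <= S%:E)%E.
  rewrite nneseries_interchange//; apply: le_trans hS.
  apply: lee_nneseries => [j _ _|j _]; first by apply: nneseries_ge0.
  have tQA : trivIset setT (fun n => Q n `&` A j) by exact: trivIset_setIr.
  have := @measure_bigcup _ _ _ mu setT (fun n => Q n `&` A j)
    (fun i _ => measurableI _ _ (mQ i) (mA j)) tQA.
  rewrite (eq_eseriesl (Q := xpredT)) => [<-|i]; last by rewrite in_setT.
  by rewrite -setI_bigcupl QT setTI.
rewrite nneseriesD//; first last.
- move=> n _; rewrite adde_ge0 ?mule_ge0 ?lee_fin ?(ltW L0)//.
  exact: nneseries_ge0.
- by move=> n _; rewrite mule_ge0 ?lee_fin ?mulr_ge0.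
rewrite nneseriesD//; first last.
- by move=> n _; rewrite mule_ge0 ?lee_fin ?(ltW L0)//; exact: nneseries_ge0.
- by move=> n _; rewrite mule_ge0 ?lee_fin.
rewrite !nneseriesZl//; last first.
  by move=> n _; exact: nneseries_ge0.
rewrite sQ -addrA EFinD; apply: leeD.
  rewrite [leRHS]EFinM [X in (_ <= _ * X)%E]fineK ?mu_fin_num//.
  by apply: lee_wpmul2l; rewrite ?lee_fin ?mulr_ge0.
rewrite EFinD; apply: leeD; first by rewrite EFinM fineK ?mu_fin_num.
by rewrite EFinM; apply: lee_wpmul2l; rewrite ?lee_fin ?(ltW L0).
Qed.

End oscillation.

Section oscillation_L1.
Context {R : realType} {M : pointedMetricType R}.
Variable mu : {finite_measure set (borel M) -> \bar R}.
Hypothesis mu_gt0 : (0 < mu setT)%E.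
Hypothesis LD : locally_doubling mu.
Variables (R0 beta b : R).
Hypothesis AM : approximate_midpoint (M := M) R0 beta.
Hypothesis Ic : complementary_isoperimetric mu.
Hypotheses (b0 : 0 < b) (R0b : R0 < b).
Local Notation vol x s := (fine (mu (ball x s))).
Local Notation mean x s f := (mean mu (ball x s : set (borel M)) f).

(** A Poincare inequality for the whole space. Let [u x] be the mean of [f] over
    a ball of a fixed small radius around [x]. The oscillation [N] bounds the
    variation of [u] between points at distance at most [R1], and by chains of
    midpoints also over the ball in the isoperimetric hypothesis. So, with
    [kappa = u x0], the set where [u] is far from [kappa] lies outside that ball,
    and its measure decays geometrically with the level; summing over levels
    bounds the integral of [|u - kappa|], and [f - u] is small on average. *)
Lemma L1_le_oscillation : exists C : R, 0 <= C /\
  forall (f : M -> R) (N : R), 0 <= N ->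
    measurable_fun setT (f : borel M -> R) ->
    (forall x t, 0 < t <= b ->
       mu.-integrable (ball x t : set (borel M)) (EFin \o f)) ->
    (forall x t, 0 < t <= b ->
       \int[mu]_(y in (ball x t : set (borel M))) `|f y - mean x t f|
         <= N * vol x t) ->
  mu.-integrable setT (EFin \o (f : borel M -> R)) /\
  exists kappa : R, \int[mu]_(x in setT) `|f x - kappa| <= C * N.
Proof.
have [x0 [r0 [kappa0 [Ci [r00 kappa00 Ci0 iso]]]]] := Ic.
have [R00 hb b1 _] := AM.
have b2 : b / 2 < b by rewrite ltr_pdivrMr// ltr_pMr// ltr1n.
(* Midpoints are available beyond the distance [R1], and [R1 < b] leaves room
   for balls of radius [s] around both of two points at distance [R1] inside a
   ball of radius [b]. *)
pose R1 := Num.max R0 (b / 2).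
have R1b : R1 < b by rewrite /R1 gt_max R0b.
have R10 : 0 < R1 by rewrite /R1 lt_max orbC divr_gt0.
have R01 : R0 <= R1 by rewrite /R1 le_max lexx.
pose s := b - R1; have s0 : 0 < s by rewrite subr_gt0.
have sb : s <= b by rewrite /s; lra.
(* The collar width is admissible for the isoperimetric inequality, allows [u]
   to be compared at distance [3 * eta], and makes the decay ratio at least 1/2. *)
pose eta := Num.min (Num.min kappa0 (R1 / 3)) (Num.min s (2 * Ci)^-1).
have eta0 : 0 < eta by rewrite !lt_min kappa00 s0 invr_gt0 !mulr_gt0.
have eta_k : eta <= kappa0 by rewrite !ge_min lexx.
have eta_R : 3 * eta <= R1.
  by rewrite mulrC -ler_pdivlMr// !ge_min lexx !orbT.
have eta_s : eta <= s by rewrite !ge_min lexx !orbT.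
have eta_C : 0 < Ci * eta <= 2^-1.
  rewrite mulr_gt0//= mulrC -ler_pdivlMr// -invfM !ge_min lexx !orbT//.
have [k hk] : exists k, beta ^+ k * (r0 + R1) <= R1.
  apply: expr_mul_le => //; rewrite b1 andbT ltW//.
  by apply: lt_trans hb; rewrite invr_gt0.
have beta0 : 0 < beta by apply: lt_trans hb; rewrite invr_gt0.
have [D1 [D10 hD1]] := vol_doubling LD (2 * b) s0.
have eta20 : 0 < eta / 2 by rewrite divr_gt0.
have [D2 [D20 hD2]] := vol_doubling LD s eta20.
have [x_ [cover disj]] := separated_cover mu_gt0 LD eta0.
pose m := fine (mu setT); have m0 : 0 <= m by exact: fine_ge0.
pose S := m / (Ci * eta).
have S0 : 0 <= S by rewrite divr_ge0// mulr_ge0// ltW.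
pose C := D2 * m + 2 ^+ k * (2 * D1) * m + 2 * D1 * S.
have C0 : 0 <= C.
  have D1' := ltW D10; have D2' := ltW D20.
  by rewrite /C; repeat (done || apply: addr_ge0 || apply: mulr_ge0 || apply: exprn_ge0).
exists C; split => // f N N0 mf fi osc.
pose u x := mean x s f.
(* It suffices to treat positive bounds; the case [N = 0] follows by letting
   the bound decrease to [N]. *)
have main N' : 0 < N' -> N <= N' ->
    (\int[mu]_x (`|f x - u x0|)%:E <= (C * N')%:E)%E.
  move=> N'0 NN'; pose L := 2 * D1 * N'; pose K0 := 2 ^+ k * L.
  have L0 : 0 < L by rewrite /L !mulr_gt0.
  have K00 : 0 <= K0 by rewrite mulr_ge0 ?exprn_ge0// ltW.
  have u_close x y : mdist x y <= R1 -> `|u y - mean x b f| <= D1 * N'.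
    move=> xy.
    have sub : ball y s `<=` ball x b by apply: subset_ball; rewrite /s; lra.
    have v0 := vol_gt0 mu_gt0 LD y s0.
    have bb : 0 < b <= b by rewrite b0 lexx.
    have := mean_dist_le (mean x b f) (measurable_ball y s) (measurable_ball x b)
      sub v0 (fi x b bb).
    move=> /le_trans; apply; rewrite mulrC ler_pdivrMr//.
    apply: le_trans (osc x b bb) _.
    have vb : vol x b <= D1 * vol y s.
      by apply: le_trans (hD1 y); apply: le_vol; rewrite metric_sym; lra.
    apply: (@le_trans _ _ (N' * vol x b)); first by rewrite ler_wpM2r// fine_ge0.
    by rewrite (mulrAC D1) (mulrC _ N') ler_wpM2l// ltW.
  have u_lip x y : mdist x y <= R1 -> `|u x - u y| <= L.
    move=> xy; rewrite -(subrKA (mean x b f)) (le_trans (ler_normD _ _))//.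
    have := u_close x y xy; have := u_close x x.
    rewrite mdistxx (ltW R10) => /(_ isT) h1 h2.
    by rewrite (distrC (mean x b f)) /L; lra.
  have u_chain : forall n x y, beta ^+ n * mdist x y <= R1 ->
      `|u x - u y| <= 2 ^+ n * L.
    apply: (midpoint_chain (Q := fun n x y => `|u x - u y| <= 2 ^+ n * L) AM R01).
    - by move=> x y xy; rewrite mul1r; exact: u_lip.
    - move=> n x y h; rewrite (le_trans h)// ler_wpM2r ?(ltW L0)//.
      by rewrite exprS ler_peMl ?exprn_ge0// ler1n.
    - move=> n x y z xz yz; rewrite -(subrKA (u z)) (le_trans (ler_normD _ _))//.
      by rewrite (distrC (u z)) exprS; lra.
  have := integral_le_levels (u := u) (kappa := u x0) (eta := eta) (s := s)
    (D := D2) (N := N') (K0 := K0) (L := L) (S := S) (mu := mu) (x_ := x_) mf.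
  rewrite eta0 eta_s (ltW D20) (ltW N'0) => h.
  apply: le_trans (h _ _ _ _ _ _ _ _ _ _ _) _ => //.
  - by move=> x; apply: fi; rewrite s0.
  - move=> x; apply: le_trans (osc x s _) _; first by rewrite s0.
    by rewrite ler_wpM2r// fine_ge0.
  - apply: (fat_level_sum (x0 := x0) (r0 := r0) (C := Ci)) => //.
    + exact: ltW.
    + by move=> A oA AB; apply: iso; rewrite // eta0.
    + move=> x wx; rewrite leNgt; apply/negP => dx.
      move: wx; rewrite ltNge => /negP; apply; rewrite distrC; apply: u_chain.
      by apply: le_trans hk; rewrite ler_wpM2l ?exprn_ge0 ?(ltW beta0)//; lra.
    + move=> x y xy; rewrite -(subrKA (u y)) (le_trans (ler_normD _ _))//.
      by rewrite addrC lerD2l; apply: u_lip; lra.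
  - rewrite lee_fin /C /K0 /L -/m; rewrite le_eqVlt; apply/orP; left; apply/eqP; ring.
have le : (\int[mu]_x (`|f x - u x0|)%:E <= (C * N)%:E)%E.
  apply/lee_addgt0Pr => e e0.
  have e1 : 0 < e / (C + 1) by rewrite divr_gt0// ltr_wpDl.
  apply: le_trans (main (N + e / (C + 1)) _ _) _.
  - by rewrite ltr_wpDl.
  - by rewrite lerDl ltW.
  - rewrite -EFinD lee_fin mulrDr lerD2l mulrCA ler_piMr ?(ltW e0)//.
    by rewrite ler_pdivrMr ?ltr_wpDl// mul1r lerDl.
have gi : mu.-integrable setT (EFin \o (fun x : borel M => f x - u x0)).
  apply/integrableP; split; last exact: le_lt_trans le (ltry _).
  by apply/measurable_EFinP; exact: measurable_funB.
split.
  have := integrable_sub_cst (- u x0) measurableT gi.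
  by congr (mu.-integrable _ (EFin \o _)); apply/funext => x; rewrite opprK subrK.
exists (u x0); rewrite -lee_fin /Rintegral fineK//.
by apply: integrable_fin_num => //; exact: (integrable_norm gi).
Qed.

End oscillation_L1.

(** * Representation of functionals on functions of mean zero *)

Lemma powR_jensen (R : realType) (p q v P : R) : 0 < p -> p^-1 + q^-1 = 1 ->
  0 < v -> 0 <= P -> (v^-1 * (v `^ q^-1 * P `^ p^-1)) `^ p * v = P.
Proof.
move=> p0 pq v0 P0; have v0' := ltW v0.
have -> : v^-1 * (v `^ q^-1 * P `^ p^-1) = (P / v) `^ p^-1.
  rewrite powRM ?invr_ge0// -(powR_inv1 v0') -powRrM mulrA.
  rewrite -powRD; last by rewrite (gt_eqF v0) implybT.
  have qE : q^-1 = 1 - p^-1 by rewrite -pq; ring.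
  by rewrite mulrC qE; congr (_ * _ `^ _); ring.
by rewrite -powRrM mulVf ?gt_eqF// powRr1 ?divr_ge0// divfK ?gt_eqF.
Qed.

Section centering.
Context d (T : measurableType d) (R : realType).
Variable mu : {finite_measure set T -> \bar R}.
Variables (p q : R) (p0 : 0 < p) (q0 : 0 < q) (pq : p^-1 + q^-1 = 1).
Variables (B : set T) (mB : measurable B) (v0 : 0 < fine (mu B)).
Local Notation Lp := (Lp mu).
Local Notation pow_int := (pow_int mu).
Local Notation v := (fine (mu B)).
Implicit Types (g h k : T -> R) (c : R).

(** Real multiples of the (1,p)-atoms of [B]. *)
Definition cancelling g :=
  [/\ Lp p g, forall y, ~ B y -> g y = 0 & \int[mu]_y g y = 0].

(** The number by which such a [g] has to be divided to become an atom: the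
    L^p average of [g / atom_size g] over [B] is exactly the inverse of the
    measure of [B]. *)
Definition atom_size g := (v `^ (p - 1) * pow_int p g) `^ p^-1.

(** The projection of L^p onto the functions of mean zero supported in [B]. *)
Definition center h y := \1_B y * (h y - mean mu B h).

Let p1 : 1 < p. Proof. exact: conjugate_gt1 q0 pq p0. Qed.

Lemma integrable_Lp_on h : Lp p h -> mu.-integrable B (EFin \o h).
Proof. by move=> Lh; apply: integrableS (Lp_integrable (ltW p1) Lh). Qed.

(** Jensen's inequality, from Hoelder's against the indicator of [B]. *)
Lemma mean_pow_le h : Lp p h -> `|mean mu B h| `^ p * v <= pow_int p h.
Proof.
move=> Lh.
have [ih le] := Lp_hoelder q0 p0 (etrans (addrC _ _) pq)
  (Lp_indic mu (ltW q0) mB) Lh.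
move: le; rewrite pow_int_indic// => le.
have mle : `|mean mu B h| <= v^-1 * (v `^ q^-1 * pow_int p h `^ p^-1).
  rewrite /mean normrM ger0_norm ?invr_ge0 ?(ltW v0)//.
  rewrite ler_wpM2l ?invr_ge0 ?(ltW v0)// -Rintegral_mul_indic.
  exact: le_trans (le_normr_Rintegral measurableT ih) le.
have P0 := pow_int_ge0 mu p h.
rewrite -[leRHS](powR_jensen p0 pq v0 P0) ler_wpM2r ?(ltW v0)//.
rewrite ge0_ler_powR ?(ltW p0)// nnegrE//.
by rewrite !mulr_ge0 ?powR_ge0// invr_ge0 ltW.
Qed.

Lemma center_cancelling h : Lp p h -> cancelling (center h).
Proof.
move=> Lh; split.
- have L1 : Lp p (cst (- mean mu B h)).
    by apply: (@Lp_bounded _ _ _ _ _ _ `|mean mu B h|); rewrite ?(ltW p0)// => y; rewrite normrN.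
  have := Lp_lin 1 (ltW p0) Lh L1.
  under eq_fun do rewrite mul1r.
  by apply: (@Lp_bounded_mul _ _ _ _ _ _ _ 1); rewrite ?(ltW p0)//; exact: norm_indic_le1.
- by move=> y By; rewrite /center indicE memNset// mul0r.
- rewrite Rintegral_mul_indic RintegralB//.
  + by rewrite Rintegral_cst// /mean mulrAC mulVf ?gt_eqF// mul1r subrr.
  + exact: integrable_Lp_on.
  + exact: finite_measure_integrable_cst.
Qed.

Lemma center_lin c h k : Lp p h -> Lp p k ->
  center (fun y => c * h y + k y) = (fun y => c * center h y + center k y).
Proof.
move=> Lh Lk; have ih := integrable_Lp_on Lh; have ik := integrable_Lp_on Lk.
have ich : mu.-integrable B (EFin \o (fun y => c * h y)) by exact: (integrableZl mB c ih).
by apply/funext => y; rewrite /center /mean RintegralD// RintegralZl//; ring.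
Qed.

Lemma center_id g : cancelling g -> center g = g.
Proof.
move=> [_ gB g0]; apply/funext => y; rewrite /center.
have -> : mean mu B g = 0.
  rewrite /mean -Rintegral_mul_indic.
  rewrite [X in _ * X](_ : _ = 0) ?mulr0// -g0; apply: eq_Rintegral => z _.
  rewrite indicE; have [zB|zB] := boolP (z \in B); first by rewrite mul1r.
  by rewrite mul0r gB//; rewrite notin_setE in zB.
rewrite subr0 indicE; have [yB|yB] := boolP (y \in B); first by rewrite mul1r.
by rewrite mul0r gB//; rewrite notin_setE in yB.
Qed.

(** One factor 2 comes from the triangle inequality for p-th powers, the other
    from the mean, whose p-th power is dominated by that of the function. *)
Lemma center_size h : Lp p h ->
  atom_size (center h) <= 4 * v `^ q^-1 * pow_int p h `^ p^-1.
Proof.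
move=> Lh; have P0 := pow_int_ge0 mu p h; set m := mean mu B h.
have i1 : mu.-integrable setT (EFin \o (fun y => `|m| `^ p * \1_B y)).
  by apply: integrable_scale; exact: integrable_indicT.
have i2 : mu.-integrable setT (EFin \o (fun y => `|h y| `^ p)) by case: Lh.
have h1 : pow_int p (center h) <= 4 `^ p * pow_int p h.
  apply: (@le_trans _ _ (\int[mu]_y (2 `^ p * (`|h y| `^ p + `|m| `^ p * \1_B y)))).
    apply: le_Rintegral => //.
    - by have [[]] := center_cancelling Lh.
    - by apply: integrable_scale; exact: integrable_add.
    - move=> y _; rewrite /center indicE -/m.
      have [yB|yB] := boolP (y \in _); last first.
        by rewrite mul0r normr0 powR0 ?gt_eqF// mulr0 addr0 mulr_ge0 ?powR_ge0.
      rewrite mul1r mulr1; apply: le_trans (powRD_le (ltW p0) _ _) => //.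
      by rewrite ge0_ler_powR ?nnegrE ?addr_ge0 ?(ltW p0)// ler_normB.
  rewrite RintegralZl//; last exact: integrable_add.
  rewrite RintegralD// RintegralZl//; last exact: integrable_indicT.
  rewrite Rintegral_indicT//.
  rewrite (_ : 4 = 2 * 2 :> R); last by rewrite -natrM.
  rewrite powRM// -mulrA ler_wpM2l ?powR_ge0//.
  apply: (@le_trans _ _ (2 * pow_int p h)).
    by rewrite mulr_natl mulr2n lerD2l; exact: mean_pow_le.
  by rewrite ler_wpM2r// le1r_powR// ?ler1n// ltW.
have e : (p - 1) * p^-1 = q^-1 by rewrite mulrBl mulfV ?gt_eqF// mul1r -pq; ring.
rewrite /atom_size.
apply: (@le_trans _ _ ((v `^ (p - 1) * (4 `^ p * pow_int p h)) `^ p^-1)).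
  rewrite ge0_ler_powR ?nnegrE ?mulr_ge0 ?powR_ge0 ?pow_int_ge0 ?invr_ge0 ?(ltW p0)//.
  by rewrite ler_wpM2l ?powR_ge0.
rewrite powRM ?mulr_ge0 ?powR_ge0// powRM ?powR_ge0// -!powRrM e.
by rewrite mulfV ?gt_eqF// powRr1// mulrA [v `^ _ * 4]mulrC.
Qed.

(** A functional on the functions of mean zero on [B] becomes a functional on
    all of L^p by centering, hence it is an integral. *)
Lemma cancelling_functional_rep (V : (T -> R) -> Prop) (Lambda : (T -> R) -> R) K :
  0 <= K ->
  (forall c g h, V g -> V h ->
    Lambda (fun y => c * g y + h y) = c * Lambda g + Lambda h) ->
  (forall g, cancelling g -> V g /\ `|Lambda g| <= K * atom_size g) ->
  exists phi : T -> R,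
  [/\ Lp q phi, pow_int q phi <= (4 * K) `^ q * v &
    forall h, Lp p h -> Lambda (center h) = \int[mu]_y (phi y * h y)].
Proof.
move=> K0 Llin Latom.
have [||phi [Lphi hphi rep]] := @Lp_functional_rep _ _ _ mu p q p0 q0 pq
    (4 * K * v `^ q^-1) (fun h => Lambda (center h)).
- move=> c h k Lh Lk; have [Vh _] := Latom _ (center_cancelling Lh).
  have [Vk _] := Latom _ (center_cancelling Lk).
  by rewrite center_lin// Llin.
- move=> h Lh; have [_ le] := Latom _ (center_cancelling Lh).
  apply: le_trans le _.
  rewrite [leRHS](_ : _ = K * (4 * v `^ q^-1 * pow_int p h `^ p^-1)); last by ring.
  by rewrite ler_wpM2l//; exact: center_size.
exists phi; split => //; apply: le_trans hphi _.
by rewrite powRM ?mulr_ge0 ?powR_ge0// -powRrM mulVf ?gt_eqF// powRr1// ltW.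
Qed.

End centering.

Section patching.
Context {R : realType} {M : pointedMetricType R}.
Variable mu : {finite_measure set (borel M) -> \bar R}.
Hypothesis mu_gt0 : (0 < mu setT)%E.
Hypothesis LD : locally_doubling mu.
Variables (R0 beta b p q : R).
Hypothesis AM : approximate_midpoint (M := M) R0 beta.
Hypotheses (b0 : 0 < b) (R0b : R0 < b).
Hypotheses (p0 : 0 < p) (q0 : 0 < q) (pq : p^-1 + q^-1 = 1).
Local Notation vol x s := (fine (mu (ball x s))).
Local Notation Bl x s := (ball x s : set (borel M)).
Local Notation Lp := (Lp mu).
Implicit Types (x y z : M) (t : R) (g h : borel M -> R).

Variables (V : (borel M -> R) -> Prop) (Lambda : (borel M -> R) -> R) (K : R).
Hypothesis K0 : 0 <= K.
Hypothesis Vlin : forall c g h, V g -> V h -> V (fun y => c * g y + h y).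
Hypothesis Llin : forall c g h, V g -> V h ->
  Lambda (fun y => c * g y + h y) = c * Lambda g + Lambda h.
Hypothesis Latom : forall x t g, 0 < t <= b -> cancelling mu p (Bl x t) g ->
  V g /\ `|Lambda g| <= K * atom_size mu p (Bl x t) g.

Let p1 : 1 < p. Proof. exact: conjugate_gt1 q0 pq p0. Qed.

Let e x t : borel M -> R := fun y => (vol x t)^-1 * \1_(Bl x t) y.

Let Lp_e x t : Lp p (e x t).
Proof.
have := Lp_lin (vol x t)^-1 (ltW p0) (Lp_indic mu (ltW p0) (measurable_ball x t))
  (Lp_indic mu (ltW p0) measurable0).
by under eq_fun do rewrite indic0 addr0.
Qed.

Let int_e x t : 0 < t -> \int[mu]_y e x t y = 1.
Proof.
move=> t0; rewrite /e RintegralZl//; last by apply: integrable_indicT; exact: measurable_ball.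
by rewrite Rintegral_indicT ?mulVf ?gt_eqF ?vol_gt0//; exact: measurable_ball.
Qed.

Let cancel_sub x t g h : Lp p g -> Lp p h -> (forall y, ~ ball x t y -> g y = 0) ->
  (forall y, ~ ball x t y -> h y = 0) -> \int[mu]_y g y = \int[mu]_y h y ->
  cancelling mu p (Bl x t) (fun y => -1 * g y + h y).
Proof.
move=> Lg Lh g0 h0 gh; split.
- by apply: Lp_lin => //; exact: ltW.
- by move=> y By; rewrite g0// h0// mulr0 addr0.
- have ig := Lp_integrable (ltW p1) Lg; have ih := Lp_integrable (ltW p1) Lh.
  rewrite RintegralD//; last exact: integrable_scale.
  by rewrite RintegralZl// gh mulN1r addNr.
Qed.

Let e_out x t y z s : mdist x y + t <= s -> ~ ball x s z -> e y t z = 0.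
Proof.
move=> h nz; rewrite /e indicE memNset ?mulr0// => /(subset_ball h).
exact: nz.
Qed.

(** Normalized indicators of two small balls differ by a finite combination
    of atoms, along a chain of approximate midpoints. *)
Let V_e x y s t : 0 < s <= b -> 0 < t <= b -> V (fun z => -1 * e x s z + e y t z).
Proof.
pose R1 := Num.max R0 (b / 2).
have b2 : b / 2 < b by rewrite ltr_pdivrMr// ltr_pMr// ltr1n.
have R1b : R1 < b by rewrite /R1 gt_max R0b.
have R10 : 0 < R1 by rewrite /R1 lt_max orbC divr_gt0.
have R01 : R0 <= R1 by rewrite /R1 le_max lexx.
pose u := b - R1; have u0 : 0 < u by rewrite subr_gt0.
have ub : u <= b by rewrite /u; lra.
have b00 : 0 < b <= b by rewrite b0 lexx.
have Vadd g h : V g -> V h -> V (fun z => g z + h z).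
  by move=> Vg Vh; have := Vlin 1 Vg Vh; under eq_fun do rewrite mul1r.
have close a c s' t' : 0 < s' -> 0 < t' -> s' <= b -> mdist a c + t' <= b ->
    V (fun z => -1 * e a s' z + e c t' z).
  move=> s'0 t'0 s'b ac.
  have [] // := @Latom a b (fun z => -1 * e a s' z + e c t' z) b00.
  apply: cancel_sub => //.
  - by move=> z; apply: e_out; rewrite mdistxx add0r.
  - by move=> z; exact: e_out.
  - by rewrite !int_e.
have Vopp a c s' t' : V (fun z => -1 * e a s' z + e c t' z) ->
    V (fun z => -1 * e c t' z + e a s' z).
  move=> h; have := Vlin (-2) h h.
  by congr V; apply/funext => z; ring.
have Vtrans a c d' s' t' w : V (fun z => -1 * e a s' z + e c t' z) ->
    V (fun z => -1 * e c t' z + e d' w z) -> V (fun z => -1 * e a s' z + e d' w z).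
  by move=> h1 h2; have := Vadd _ _ h1 h2; congr V; apply/funext => z; ring.
have chain : forall k x y, beta ^+ k * mdist x y <= R1 ->
    V (fun z => -1 * e x u z + e y u z).
  apply: (midpoint_chain (Q := fun k x y => V (fun z => -1 * e x u z + e y u z)) AM R01) => //.
  - by move=> a c ac; apply: close => //; rewrite /u; lra.
  - by move=> k a c d' h1 h2; apply: (Vtrans _ _ _ _ _ _ h1); exact: Vopp.
move=> /andP[s0 sb] /andP[t0 tb].
have [k hk] : exists k, beta ^+ k * mdist x y <= R1.
  have [_ hb b1 _] := AM.
  apply: expr_mul_le => //; rewrite b1 andbT ltW//.
  by apply: lt_trans hb; rewrite invr_gt0.
apply: (Vtrans _ x _ _ u); first by apply: close => //; rewrite mdistxx add0r.
apply: (Vtrans _ y _ _ u); first exact: chain hk.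
by apply: close => //; rewrite mdistxx add0r.
Qed.

Let star : M := point.
Let es := e star b.

(** On each ball a density of the functional: the constant is normalized by
    comparison with one fixed ball, which makes these densities agree on
    overlaps. *)
Let local_density x t : 0 < t <= b -> exists f : borel M -> R,
  exists c : R,
  [/\ Lp q (fun y => f y - c), pow_int mu q (fun y => f y - c) <= (4 * K) `^ q * vol x t,
      \int[mu]_(y in Bl x t) (f y - c) = 0,
   forall g, cancelling mu p (Bl x t) g -> Lambda g = \int[mu]_y ((f y - c) * g y) &
   forall E : set (borel M), measurable E -> E `<=` Bl x t ->
     \int[mu]_(y in E) f y = Lambda (fun y => - fine (mu E) * es y + \1_E y)].
Proof.
move=> /[dup] tb /andP[t0 _]; have v0 := vol_gt0 mu_gt0 LD x t0.
have mB := measurable_ball x t.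
have [phi [Lphi hphi rep]] := cancelling_functional_rep p0 q0 pq mB v0 K0 Llin
  (fun g => @Latom x t g tb).
have b00 : 0 < b <= b by rewrite b0 lexx.
pose c := Lambda (fun z => -1 * es z + e x t z).
have q1 : 1 < q by apply: (@conjugate_gt1 _ _ p) => //; rewrite addrC.
have iphi := Lp_integrable (ltW q1) Lphi.
have V0 : V (fun=> 0).
  have [] // := @Latom star b (fun=> 0) b00; split => //.
  - by apply: (@Lp_bounded _ _ _ _ _ _ 0); rewrite ?(ltW p0)// => y; rewrite normr0.
  - by rewrite Rintegral_cst// mul0r.
have L0 : Lambda (fun=> 0) = 0.
  transitivity (Lambda (fun y => -1 * (fun=> 0) y + (fun=> 0) y)).
    by congr Lambda; apply/funext => y; rewrite mulr0 addr0.
  by rewrite Llin// mulN1r addNr.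
have phiB : \int[mu]_(y in Bl x t) phi y = 0.
  rewrite -Rintegral_mul_indic -[RHS]L0.
  have := rep _ (Lp_indic mu (ltW p0) mB).
  rewrite (_ : center _ _ _ = fun=> 0).
    by move=> ->; apply: eq_Rintegral => y _; rewrite mulrC.
  have ind1 : \int[mu]_(y in Bl x t) (\1_(Bl x t) y : R) = vol x t.
    rewrite -Rintegral_mul_indic -Rintegral_indicT//; apply: eq_Rintegral => z _.
    by rewrite indicE; case: (_ \in _); rewrite ?mulr0 ?mulr1.
  apply/funext => y; rewrite /center /mean ind1 mulVf ?gt_eqF// indicE.
  by case: (_ \in _); rewrite ?subrr ?mulr0 ?mul0r.
exists (fun y => phi y + c), c.
have phiK : (fun y => phi y + c - c) = phi by apply/funext => y; rewrite addrK.
split; rewrite ?phiK//.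
- move=> g cg; rewrite -[in LHS](center_id cg) rep; last by case: cg.
  by apply: eq_Rintegral => y _; rewrite addrK.
move=> E mE EB.
have Lg : Lp p (\1_E : borel M -> R) by exact: (Lp_indic mu (ltW p0) mE).
pose m := fine (mu E).
have muEB : \int[mu]_(y in Bl x t) (\1_E y : R) = m.
  rewrite -Rintegral_mul_indic /m -(Rintegral_indicT mu mE).
  apply: eq_Rintegral => y _; rewrite !indicE.
  have [yE|yE] := boolP (y \in E); last by rewrite mulr0.
  by rewrite mem_set ?mulr1//; apply: EB; rewrite inE in yE.
have cE : center mu (Bl x t) \1_E = fun y => - m * e x t y + \1_E y.
  apply/funext => y; rewrite /center /mean muEB /e !indicE.
  have [yB|yB] := boolP (y \in Bl x t); first by rewrite mul1r mulr1; ring.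
  rewrite mul0r !mulr0 add0r memNset// => /EB.
  by move: yB; rewrite notin_setE.
have V1 : V (center mu (Bl x t) \1_E).
  by have [] := Latom tb (center_cancelling p0 q0 pq mB v0 Lg).
have -> : (fun y => - fine (mu E) * es y + \1_E y) =
    (fun y => m * (-1 * es y + e x t y) + center mu (Bl x t) \1_E y).
  by apply/funext => y; rewrite cE -/m; ring.
rewrite Llin ?rep//; last exact: V_e.
rewrite -/c RintegralD//; [|exact: integrableS iphi|exact: finite_measure_integrable_cst].
rewrite Rintegral_cst// addrC mulrC; congr (_ + _).
by rewrite -[LHS]Rintegral_mul_indic; apply: eq_Rintegral => y _; rewrite mulrC.
Qed.

(** Over a measurable set [E] inside a ball, the integral of the local density is
    the value of the functional at a function that depends on [E] only. So two
    local densities agree almost everywhere on the intersection of their balls,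
    and a countable cover is enough to glue them together. *)
Lemma global_density : exists f : borel M -> R, measurable_fun setT f /\
  forall x t, 0 < t <= b -> exists (phi : borel M -> R) (c : R),
    [/\ Lp q phi, pow_int mu q phi <= (4 * K) `^ q * vol x t,
      \int[mu]_(y in Bl x t) phi y = 0,
      forall g, cancelling mu p (Bl x t) g -> Lambda g = \int[mu]_y (phi y * g y) &
      {ae mu, forall y, Bl x t y -> f y = phi y + c}].
Proof.
have /choice[F hF] (xt : M * R) : exists f : borel M -> R, 0 < xt.2 <= b ->
    exists c : R,
  [/\ Lp q (fun y => f y - c), pow_int mu q (fun y => f y - c) <= (4 * K) `^ q * vol xt.1 xt.2,
      \int[mu]_(y in Bl xt.1 xt.2) (f y - c) = 0,
   forall g, cancelling mu p (Bl xt.1 xt.2) g -> Lambda g = \int[mu]_y ((f y - c) * g y) &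
   forall E : set (borel M), measurable E -> E `<=` Bl xt.1 xt.2 ->
     \int[mu]_(y in E) f y = Lambda (fun y => - fine (mu E) * es y + \1_E y)].
  have [tb|tb] := boolP (0 < xt.2 <= b); last by exists (fun=> 0).
  by have [f hf] := local_density xt.1 tb; exists f.
have [x_ [cover _]] := separated_cover mu_gt0 LD b0.
pose Q : nat -> set (borel M) := seqDU (fun n => ball (x_ n) b : set (borel M)).
have mQ n : measurable (Q n).
  by apply: measurableD; [exact: measurable_ball|
    apply: bigsetU_measurable => i _; exact: measurable_ball].
have QT : \bigcup_n Q n = setT.
  rewrite -seqDU_bigcup_eq; apply/seteqP; split => // y _.
  by have [n] := cover y; exists n.
have tQ : trivIset setT Q by exact: trivIset_seqDU.
pose f (y : borel M) := F (x_ (xget 0%N [set n | Q n y]), b) y.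
have fQ n y : Q n y -> f y = F (x_ n, b) y.
  move=> Qy; rewrite /f; congr (F (x_ _, _) _).
  have := xgetI 0%N (x := n) (P := [set n | Q n y]) Qy => /= Qy'.
  by apply: tQ => //; exists y.
have b00 : 0 < b <= b by rewrite b0 lexx.
have q1 : 1 < q by apply: (@conjugate_gt1 _ _ p) => //; rewrite addrC.
have iF x t : 0 < t <= b -> mu.-integrable setT (EFin \o F (x, t)).
  move=> tb; have [c [L _ _ _ _]] := hF (x, t) tb.
  have := integrable_sub_cst (- c) measurableT (Lp_integrable (ltW q1) L).
  by congr (mu.-integrable _ (EFin \o _)); apply/funext => y; rewrite opprK subrK.
have mF x t : 0 < t <= b -> measurable_fun setT (F (x, t)).
  by move=> tb; apply/measurable_EFinP; exact: (measurable_int mu (iF x t tb)).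
exists f; split.
  rewrite -QT; apply/measurable_fun_bigcup => // n.
  apply: (eq_measurable_fun (F (x_ n, b))); last by apply: measurable_funS (mF _ _ b00).
  by move=> y; rewrite inE => /fQ.
move=> x t tb; have [c [L1 L2 L3 L4 L5]] := hF (x, t) tb.
exists (fun y => F (x, t) y - c), c; split => //.
have ae_n n : {ae mu, forall y, (Q n `&` Bl x t) y -> f y = F (x, t) y}.
  have mQB : measurable (Q n `&` Bl x t) by apply: measurableI => //; exact: measurable_ball.
  have := @integral_ae_eq _ _ _ mu (Q n `&` Bl x t) mQB
    (EFin \o F (x, t)) (EFin \o F (x_ n, b)).
  case/(_ _ _ _)/Wrap.
  - by apply: integrableS (iF _ _ b00).
  - by apply/measurable_EFinP; apply: measurable_funS (mF _ _ tb).
  - move=> E EQB mE.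
    have [c' [_ _ _ _ L5']] := hF (x_ n, b) b00.
    have := L5 E mE (fun y Ey => (EQB y Ey).2).
    rewrite -(L5' E mE (fun y Ey => ((EQB y Ey).1).1)) => e'.
    have := congr1 EFin e'; rewrite /Rintegral !fineK //.
    + by apply: integrable_fin_num => //; apply: integrableS (iF _ _ b00).
    + by apply: integrable_fin_num => //; apply: integrableS (iF _ _ tb).
  apply: filterS => y h QBy; have [e'] := h QBy.
  by rewrite (fQ n)//; exact: QBy.1.
have := ae_foralln ae_n; apply: filterS => y h By; rewrite subrK.
have : (\bigcup_n Q n) y by rewrite QT.
by move=> [n _ Qy]; apply: (h n); split.
Qed.

End patching.

Section almost_everywhere.
Context d (T : measurableType d) (R : realType).
Variable mu : {finite_measure set T -> \bar R}.
Variables (D : set T) (f g : T -> R).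
Hypotheses (mD : measurable D) (mf : measurable_fun D f).
Hypothesis fg : {ae mu, forall x, D x -> f x = g x}.

Let fgE : ae_eq mu D (EFin \o g) (EFin \o f).
Proof. by apply: filterS fg => x h Dx /=; rewrite h. Qed.

Lemma ae_integrable : mu.-integrable D (EFin \o g) -> mu.-integrable D (EFin \o f).
Proof.
move=> /integrableP[mg lg]; apply/integrableP; split; first exact/measurable_EFinP.
rewrite (ae_eq_integral (abse \o (EFin \o g)))//.
- by apply: measurableT_comp => //; exact/measurable_EFinP.
- exact: measurableT_comp.
- by apply: filterS fg => x h Dx /=; rewrite h.
Qed.

Lemma ae_Rintegral : measurable_fun D g ->
  \int[mu]_(x in D) f x = \int[mu]_(x in D) g x.
Proof.
move=> mg; congr fine; apply: ae_eq_integral => //; try exact/measurable_EFinP.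
by apply: filterS fg => x h Dx /=; rewrite h.
Qed.

End almost_everywhere.

(** Here [f] is the global density and [phi] its normalization on one ball [B]:
    the properties of [phi] are transferred to [f]. *)
Section ball_density.
Context d (T : measurableType d) (R : realType).
Variable mu : {finite_measure set T -> \bar R}.
Variables (p q : R) (p0 : 0 < p) (q0 : 0 < q) (pq : p^-1 + q^-1 = 1).
Variables (B : set T) (mB : measurable B) (v0 : 0 < fine (mu B)).
Variables (f phi : T -> R) (c K : R).
Hypotheses (K0 : 0 <= K) (mf : measurable_fun setT f).
Hypotheses (Lphi : Lp mu q phi) (phi0 : \int[mu]_(y in B) phi y = 0).
Hypothesis phiK : pow_int mu q phi <= K `^ q * fine (mu B).
Hypothesis fphi : {ae mu, forall y, B y -> f y = phi y + c}.

Let q1 : 1 < q. Proof. by apply: (@conjugate_gt1 _ _ p) => //; rewrite addrC. Qed.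
Let iphi := Lp_integrable (ltW q1) Lphi.
Let mphi : measurable_fun setT phi. Proof. by case: Lphi. Qed.
Let mfB : measurable_fun B f. Proof. exact: measurable_funS mf. Qed.

Lemma density_integrable : mu.-integrable B (EFin \o f).
Proof.
apply: (ae_integrable mB mfB fphi).
have iB : mu.-integrable B (EFin \o phi) by exact: integrableS iphi.
have := integrable_sub_cst (- c) mB iB.
by under eq_fun do rewrite opprK.
Qed.

Lemma density_mean : mean mu B f = c.
Proof.
rewrite /mean (ae_Rintegral mB mfB fphi); last first.
  by apply: measurable_funD => //; exact: measurable_funS mphi.
rewrite RintegralD//.
- by rewrite phi0 add0r Rintegral_cst// mulrCA mulVf ?gt_eqF// mulr1.
- exact: integrableS iphi.
- exact: finite_measure_integrable_cst.
Qed.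

Let fc : {ae mu, forall y, B y -> `|f y - c| `^ q = `|phi y| `^ q}.
Proof. by apply: filterS fphi => y h By; rewrite h// addrK. Qed.

Lemma density_pow :
  mu.-integrable B (EFin \o (fun y => `|f y - mean mu B f| `^ q)) /\
  \int[mu]_(y in B) (`|f y - mean mu B f| `^ q) <= K `^ q * fine (mu B).
Proof.
have mfc : measurable_fun B (fun y => `|f y - c| `^ q).
  apply: measurable_funS (measurable_pow q _) => //.
  exact: measurable_funB.
have [_ ip] := Lphi; rewrite density_mean; split.
  by apply: (ae_integrable mB mfc fc); exact: integrableS ip.
rewrite (ae_Rintegral mB mfc fc); last first.
  by apply: measurable_funS (measurable_pow q mphi).
apply: le_trans phiK; exact: le_Rintegral_subset.
Qed.

(** Hoelder's inequality against the indicator of [B]. *)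
Lemma density_oscillation :
  \int[mu]_(y in B) `|f y - mean mu B f| <= K * fine (mu B).
Proof.
have mfc : measurable_fun B (fun y => `|f y - c|).
  by apply: measurableT_comp => //; exact: measurable_funB.
rewrite density_mean (ae_Rintegral (g := fun y => `|phi y|) mB mfc); first last.
- by apply: measurableT_comp => //; exact: measurable_funS mphi.
- by apply: filterS fphi => y h By; rewrite h// addrK.
have [ih le] := Lp_hoelder p0 q0 pq (Lp_indic mu (ltW p0) mB) Lphi.
rewrite -Rintegral_mul_indic.
have -> : \int[mu]_y (\1_B y * `|phi y|) = \int[mu]_y `|\1_B y * phi y|.
  by apply: eq_Rintegral => y _; rewrite normrM indicE; case: (_ \in _); rewrite ?normr0 ?normr1.
apply: le_trans le _; rewrite pow_int_indic//.
apply: (@le_trans _ _ (fine (mu B) `^ p^-1 * (K `^ q * fine (mu B)) `^ q^-1)).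
  rewrite ler_wpM2l ?powR_ge0// ge0_ler_powR ?nnegrE ?invr_ge0 ?(ltW q0)//.
  - exact: pow_int_ge0.
  - by rewrite mulr_ge0 ?powR_ge0// ltW.
rewrite powRM ?powR_ge0 ?(ltW v0)// -powRrM mulfV ?gt_eqF// powRr1//.
rewrite mulrCA -powRD; last by rewrite (gt_eqF v0) implybT.
by rewrite pq powRr1// ltW.
Qed.

Lemma density_pairing g : cancelling mu p B g ->
  mu.-integrable setT (EFin \o (fun y => f y * g y)) /\
  \int[mu]_y (f y * g y) = \int[mu]_y (phi y * g y).
Proof.
move=> [Lg gB g0]; have [mg _] := Lg.
have [ipg _] := Lp_hoelder q0 p0 (etrans (addrC _ _) pq) Lphi Lg.
have ig := Lp_integrable (ltW (conjugate_gt1 q0 pq p0)) Lg.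
have mfg : measurable_fun setT (fun y => f y * g y) by exact: measurable_funM.
have fgE : {ae mu, forall y, setT y -> f y * g y = phi y * g y + c * g y}.
  apply: filterS fphi => y h _; have [By|nBy] := pselect (B y).
    by rewrite h// mulrDl.
  by rewrite gB// !mulr0 addr0.
have icg : mu.-integrable setT (EFin \o (fun y => c * g y)) by exact: integrable_scale.
split.
  by apply: (ae_integrable _ mfg fgE) => //; exact: integrable_add.
rewrite (ae_Rintegral _ mfg fgE)//.
  by rewrite RintegralD// RintegralZl// g0 mulr0 addr0.
by apply: measurable_funD; apply: measurable_funM => //; exact: measurable_cst.
Qed.

End ball_density.

Section mean_zero_functional.
Context {R : realType} {M : pointedMetricType R}.
Variable mu : {finite_measure set (borel M) -> \bar R}.
Hypothesis mu_gt0 : (0 < mu setT)%E.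
Hypothesis LD : locally_doubling mu.
Variables (R0 beta b p q : R).
Hypothesis AM : approximate_midpoint (M := M) R0 beta.
Hypothesis Ic : complementary_isoperimetric mu.
Hypotheses (b0 : 0 < b) (R0b : R0 < b).
Hypotheses (p0 : 0 < p) (q0 : 0 < q) (pq : p^-1 + q^-1 = 1).
Local Notation vol x s := (fine (mu (ball x s))).
Local Notation Bl x s := (ball x s : set (borel M)).
Implicit Types (g h : borel M -> R).

(** The glued density is only determined up to a constant by the functions of
    mean zero. The Poincare inequality makes it integrable, with L^1 distance at
    most a multiple of [K] from some constant; prescribing its mean to be [e],
    which is the value of the functional at the exceptional atom, removes the
    ambiguity and bounds its L^1 norm. *)
Lemma mean_zero_functional_rep : exists C : R, 0 <= C /\
  forall (V : (borel M -> R) -> Prop) (Lambda : (borel M -> R) -> R) (K e : R),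
  0 <= K -> `|e| <= K ->
  (forall c g h, V g -> V h -> V (fun y => c * g y + h y)) ->
  (forall c g h, V g -> V h ->
    Lambda (fun y => c * g y + h y) = c * Lambda g + Lambda h) ->
  (forall x t g, 0 < t <= b -> cancelling mu p (Bl x t) g ->
    V g /\ `|Lambda g| <= K * atom_size mu p (Bl x t) g) ->
  exists f : borel M -> R,
  [/\ mu.-integrable setT (EFin \o f), \int[mu]_y `|f y| <= C * K,
    \int[mu]_y f y = e * fine (mu setT),
    forall x t, 0 < t <= b ->
      mu.-integrable (Bl x t) (EFin \o (fun y => `|f y - mean mu (Bl x t) f| `^ q)) /\
      \int[mu]_(y in Bl x t) (`|f y - mean mu (Bl x t) f| `^ q) <=
        (4 * K) `^ q * vol x t &
    forall x t g, 0 < t <= b -> cancelling mu p (Bl x t) g ->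
      mu.-integrable setT (EFin \o (fun y => f y * g y)) /\
      Lambda g = \int[mu]_y (f y * g y)].
Proof.
have [C [C0 hC]] := L1_le_oscillation mu_gt0 LD AM Ic b0 R0b.
pose m := fine (mu setT); have m0 : 0 < m.
  by rewrite fine_gt0// mu_gt0/= ltey_eq mu_fin_num.
exists (C * 4 * 2 + m); split; first by rewrite !addr_ge0 ?mulr_ge0// ltW.
move=> V Lambda K e K0 eK Vlin Llin Latom.
have [f [mf hf]] := global_density mu_gt0 LD AM b0 R0b p0 q0 pq K0 Vlin Llin Latom.
have K40 : 0 <= 4 * K by rewrite mulr_ge0.
have mB x t := measurable_ball (M := M) x t.
have v0 x t : 0 < t <= b -> 0 < vol x t by move=> /andP[t0 _]; exact: vol_gt0.
have [||intf [kappa hk]] := hC f (4 * K) K40 mf.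
- move=> x t tb; have [phi [c [L1 L2 L3 _ L5]]] := hf x t tb.
  exact: (density_integrable p0 q0 pq (mB x t) mf L1 L5).
- move=> x t tb; have [phi [c [L1 L2 L3 _ L5]]] := hf x t tb.
  exact: (density_oscillation p0 q0 pq (mB x t) (v0 x t tb) K40 mf L1 L3 L2 L5).
pose delta := e - (\int[mu]_y f y) / m.
pose g y := f y + delta.
have mg : measurable_fun setT g by exact: measurable_funD.
have intg : mu.-integrable setT (EFin \o g).
  by apply: integrable_add => //; exact: finite_measure_integrable_cst.
have gE x t phi c : {ae mu, forall y, Bl x t y -> f y = phi y + c} ->
    {ae mu, forall y, Bl x t y -> g y = phi y + (c + delta)}.
  by move=> h; apply: filterS h => y h By; rewrite /g (h By) -addrA.
have intgE : \int[mu]_y g y = e * m.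
  rewrite RintegralD//; last exact: finite_measure_integrable_cst.
  by rewrite Rintegral_cst// /delta -/m mulrBl divfK ?gt_eqF// addrC subrK.
have ifk : mu.-integrable setT (EFin \o (fun y => f y - kappa)).
  exact: integrable_sub_cst.
exists g; split => //.
- have ek : (kappa + delta) * m = e * m - \int[mu]_y (f y - kappa).
    rewrite RintegralB//; last exact: finite_measure_integrable_cst.
    by rewrite Rintegral_cst// /delta -/m mulrDl mulrBl divfK ?gt_eqF//; ring.
  have hk' : `|\int[mu]_y (f y - kappa)| <= C * (4 * K).
    exact: le_trans (le_normr_Rintegral measurableT ifk) hk.
  have kd : `|kappa + delta| * m <= K * m + C * (4 * K).
    rewrite -{1}(gtr0_norm m0) -normrM ek (le_trans (ler_normB _ _))//.
    by rewrite lerD// normrM (gtr0_norm m0) ler_wpM2r// ltW.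
  apply: (@le_trans _ _ (\int[mu]_y (`|f y - kappa| + `|kappa + delta|))).
    apply: le_Rintegral => //.
    - exact: (integrable_norm intg).
    - apply: integrable_add; first exact: (integrable_norm ifk).
      exact: finite_measure_integrable_cst.
    - move=> y _; apply: le_trans (ler_normD _ _).
      by rewrite addrA subrK.
  rewrite RintegralD//; [|exact: (integrable_norm ifk)|exact: finite_measure_integrable_cst].
  by rewrite Rintegral_cst//; move: hk kd; rewrite -/m; lra.
- move=> x t tb; have [phi [c [L1 L2 L3 _ L5]]] := hf x t tb.
  exact: (density_pow p0 q0 pq (mB x t) (v0 x t tb) mg L1 L3 L2 (gE _ _ _ _ L5)).
- move=> x t h tb ch; have [phi [c [L1 L2 L3 L4 L5]]] := hf x t tb.
  have [ih hE] := density_pairing p0 q0 pq mg L1 (gE _ _ _ _ L5) ch.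
  by split => //; rewrite L4// hE.
Qed.

End mean_zero_functional.

(** * Complex-valued integrals *)

Section complex_modulus.
Variable R : realType.
Implicit Types (z w c : R[i]) (a : R).

Lemma CmodE z : Cmod z = Num.sqrt (complex.Re z ^+ 2 + complex.Im z ^+ 2).
Proof. by case: z. Qed.

Lemma Cmod_ge0 z : 0 <= Cmod z.
Proof. by rewrite CmodE sqrtr_ge0. Qed.

Lemma Cmod0 : Cmod (0 : R[i]) = 0.
Proof. exact: Normc.normc0. Qed.

Lemma CmodM z w : Cmod (z * w) = Cmod z * Cmod w.
Proof. exact: Normc.normcM. Qed.

Lemma CmodD z w : Cmod (z + w) <= Cmod z + Cmod w.
Proof. exact: le_normcD. Qed.

Lemma Cmod_real a : Cmod a%:C%C = `|a|.
Proof. by rewrite CmodE/= expr0n/= addr0 sqrtr_sqr. Qed.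

Lemma Cmod_Re z : `|complex.Re z| <= Cmod z.
Proof. by rewrite CmodE -sqrtr_sqr ler_wsqrtr// lerDl sqr_ge0. Qed.

Lemma Cmod_Im z : `|complex.Im z| <= Cmod z.
Proof. by rewrite CmodE -sqrtr_sqr ler_wsqrtr// lerDr sqr_ge0. Qed.

Lemma Cmod_le z : Cmod z <= `|complex.Re z| + `|complex.Im z|.
Proof.
rewrite CmodE -[leRHS]ger0_norm ?addr_ge0// -sqrtr_sqr ler_wsqrtr//.
rewrite sqrrD !real_normK ?num_real// -addrA lerD2l lerDr.
by rewrite mulrn_wge0// mulr_ge0.
Qed.

Lemma Cmod_homo z w : `|complex.Re z| <= `|complex.Re w| ->
  `|complex.Im z| <= `|complex.Im w| -> Cmod z <= Cmod w.
Proof.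
move=> h1 h2; rewrite !CmodE ler_wsqrtr// lerD//.
  by rewrite -[X in X <= _]real_normK ?num_real// -[X in _ <= X]real_normK ?num_real// lerXn2r ?nnegrE.
by rewrite -[X in X <= _]real_normK ?num_real// -[X in _ <= X]real_normK ?num_real// lerXn2r ?nnegrE.
Qed.

Lemma Re_lin c z w : complex.Re (c * z + w) =
  complex.Re c * complex.Re z + (- complex.Im c * complex.Im z + complex.Re w).
Proof. by case: c => ? ?; case: z => ? ?; case: w => ? ? /=; rewrite mulNr addrA. Qed.

Lemma Im_lin c z w : complex.Im (c * z + w) =
  complex.Re c * complex.Im z + (complex.Im c * complex.Re z + complex.Im w).
Proof. by case: c => ? ?; case: z => ? ?; case: w => ? ? /=; rewrite addrA. Qed.

Lemma ReM c z : complex.Re (c * z) =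
  complex.Re c * complex.Re z - complex.Im c * complex.Im z.
Proof. by case: c => ? ?; case: z => ? ?. Qed.

Lemma ImM c z : complex.Im (c * z) =
  complex.Re c * complex.Im z + complex.Im c * complex.Re z.
Proof. by case: c => ? ?; case: z => ? ?. Qed.

Lemma ReB z w : complex.Re (z - w) = complex.Re z - complex.Re w.
Proof. by case: z => ? ?; case: w => ? ?. Qed.

Lemma ImB z w : complex.Im (z - w) = complex.Im z - complex.Im w.
Proof. by case: z => ? ?; case: w => ? ?. Qed.

Lemma complex_ext z w : complex.Re z = complex.Re w ->
  complex.Im z = complex.Im w -> z = w.
Proof. by case: z => ? ?; case: w => ? ? /= -> ->. Qed.

(** Cauchy-Schwarz in the plane. *)
Lemma Cmod_inner z w : complex.Re z * complex.Re w + complex.Im z * complex.Im w <=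
  Cmod z * Cmod w.
Proof.
have -> : Cmod z = Cmod (complex.Re z -i* complex.Im z)%C by rewrite !CmodE/= sqrrN.
rewrite -CmodM; apply: le_trans (Cmod_Re _); rewrite ReM/= mulNr opprK.
exact: ler_norm.
Qed.

End complex_modulus.

(** An almost everywhere statement about points of [M], as opposed to points of
    [borel M], does not display the filter it is about; these are the filter
    rules for that form. *)
Section almost_everywhere_metric.
Context {R : realType} {M : pointedMetricType R}.
Variable mu : {measure set (borel M) -> \bar R}.
Implicit Types P Q : M -> Prop.

Lemma ae_mono P Q : (forall x, P x -> Q x) ->
  {ae mu, forall x, P x} -> {ae mu, forall x, Q x}.
Proof.
move=> PQ [N [mN N0 h]]; exists N; split => // x nQ; apply: h => Px.
by apply: nQ; exact: PQ.
Qed.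

Lemma ae_and P Q : {ae mu, forall x, P x} -> {ae mu, forall x, Q x} ->
  {ae mu, forall x, P x /\ Q x}.
Proof.
move=> [N [mN N0 h]] [N' [mN' N0' h']]; exists (N `|` N'); split.
- exact: measurableU.
- exact: null_set_setU.
- move=> x nPQ; have [Px|nP] := pselect (P x); last by left; apply: h.
  by right; apply: h' => Qx; apply: nPQ.
Qed.

Lemma ae_all P : (forall x, P x) -> {ae mu, forall x, P x}.
Proof. by move=> h; exists set0; split => // x; apply. Qed.

End almost_everywhere_metric.

Section complex_integral.
Context {R : realType} {M : pointedMetricType R}.
Variable mu : {finite_measure set (borel M) -> \bar R}.
Implicit Types (f g : M -> R[i]) (c : R[i]) (D : set (borel M)).

Local Notation re f := (fun x : borel M => complex.Re (f x)).
Local Notation im f := (fun x : borel M => complex.Im (f x)).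

Definition Cmeasurable f := measurable_fun setT (re f) /\ measurable_fun setT (im f).

Lemma Cintegrable_measurable f : Cintegrable mu setT f -> Cmeasurable f.
Proof.
by move=> [h1 h2]; split; apply/measurable_EFinP;
  [exact: (measurable_int mu h1)|exact: (measurable_int mu h2)].
Qed.

Lemma Cmeasurable_lin c f g : Cmeasurable f -> Cmeasurable g ->
  Cmeasurable (fun x => c * f x + g x).
Proof.
move=> [f1 f2] [g1 g2]; split.
- under eq_fun do rewrite Re_lin.
  apply: measurable_funD; first exact: measurable_funM.
  by apply: measurable_funD => //; exact: measurable_funM.
- under eq_fun do rewrite Im_lin.
  apply: measurable_funD; first exact: measurable_funM.
  by apply: measurable_funD => //; exact: measurable_funM.
Qed.

Lemma Cmeasurable_mul f g : Cmeasurable f -> Cmeasurable g ->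
  Cmeasurable (fun x => f x * g x).
Proof.
move=> [f1 f2] [g1 g2]; split.
- under eq_fun do rewrite ReM.
  by apply: measurable_funB; exact: measurable_funM.
- under eq_fun do rewrite ImM.
  by apply: measurable_funD; exact: measurable_funM.
Qed.

Lemma Cmeasurable_cst c : Cmeasurable (fun=> c).
Proof. by split; exact: measurable_cst. Qed.

Lemma Cmeasurable_real (f : borel M -> R) : measurable_fun setT f ->
  Cmeasurable (fun x => (f x)%:C%C).
Proof. by move=> mf; split => //; exact: measurable_cst. Qed.

Lemma measurable_Cmod f : Cmeasurable f ->
  measurable_fun setT (fun x : borel M => Cmod (f x)).
Proof.
move=> [f1 f2]; under eq_fun do rewrite CmodE.
apply: (@measurableT_comp _ _ _ _ _ _ (@Num.sqrt R)).
  by apply: continuous_measurable_fun; exact: sqrt_continuous.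
by apply: measurable_funD; exact: measurable_funX.
Qed.

(** A complex function is integrable as soon as its modulus is dominated by an
    integrable function. *)
Lemma Cintegrable_dominated f (h : borel M -> R) : Cmeasurable f ->
  (forall x, Cmod (f x) <= h x) -> mu.-integrable setT (EFin \o h) ->
  Cintegrable mu setT f.
Proof.
move=> [f1 f2] fh ih; split.
- apply: (integrable_dominated f1 _ ih) => x.
  exact: le_trans (Cmod_Re _) (fh x).
- apply: (integrable_dominated f2 _ ih) => x.
  exact: le_trans (Cmod_Im _) (fh x).
Qed.

Lemma integrable_Cmod f : Cintegrable mu setT f ->
  mu.-integrable setT (EFin \o (fun x : borel M => Cmod (f x))).
Proof.
move=> [f1 f2].
have mf := measurable_Cmod (Cintegrable_measurable (conj f1 f2)).
apply: (integrable_dominated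
  (g := fun x : borel M => `|complex.Re (f x)| + `|complex.Im (f x)|) mf).
- by move=> x; rewrite ger0_norm ?Cmod_ge0// Cmod_le.
- by apply: integrable_add; [exact: (integrable_norm f1)|exact: (integrable_norm f2)].
Qed.

Lemma Cintegrable_lin c f g : Cintegrable mu setT f -> Cintegrable mu setT g ->
  Cintegrable mu setT (fun x => c * f x + g x).
Proof.
move=> fi gi; have [mf mg] := (Cintegrable_measurable fi, Cintegrable_measurable gi).
apply: (@Cintegrable_dominated _ (fun x => Cmod c * Cmod (f x) + Cmod (g x))).
- exact: Cmeasurable_lin.
- by move=> x; rewrite (le_trans (CmodD _ _))// CmodM.
- apply: integrable_add (integrable_Cmod gi).
  exact: integrable_scale (integrable_Cmod fi).
Qed.

Lemma Cintegral_lin c f g : Cintegrable mu setT f -> Cintegrable mu setT g ->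
  Cintegral mu setT (fun x => c * f x + g x) =
  c * Cintegral mu setT f + Cintegral mu setT g.
Proof.
move=> [f1 f2] [g1 g2]; apply: complex_ext.
- rewrite Re_lin /=; under eq_Rintegral do rewrite Re_lin.
  rewrite RintegralD//; [|exact: integrable_scale|apply: integrable_add => //; exact: integrable_scale].
  by rewrite RintegralD ?RintegralZl//; exact: integrable_scale.
- rewrite Im_lin /=; under eq_Rintegral do rewrite Im_lin.
  rewrite RintegralD//; [|exact: integrable_scale|apply: integrable_add => //; exact: integrable_scale].
  by rewrite RintegralD ?RintegralZl//; exact: integrable_scale.
Qed.

Lemma Cintegrable0 : Cintegrable mu setT (fun=> 0).
Proof. by split; exact: integrable0. Qed.

Lemma Cintegrable_ae f g : {ae mu, forall x, f x = g x} -> Cmeasurable f ->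
  Cintegrable mu setT g -> Cintegrable mu setT f.
Proof.
move=> fg [f1 f2] [g1 g2]; split.
- by apply: (ae_integrable (g := re g) _ f1) => //; apply: ae_mono fg => x ->.
- by apply: (ae_integrable (g := im g) _ f2) => //; apply: ae_mono fg => x ->.
Qed.

Lemma Cintegral_ae f g : {ae mu, forall x, f x = g x} -> Cmeasurable f ->
  Cmeasurable g -> Cintegral mu setT f = Cintegral mu setT g.
Proof.
move=> fg [f1 f2] [g1 g2]; apply: complex_ext => /=.
- by apply: (ae_Rintegral (g := re g) _ f1) => //; apply: ae_mono fg => x ->.
- by apply: (ae_Rintegral (g := im g) _ f2) => //; apply: ae_mono fg => x ->.
Qed.

(** With [I] the integral, [|I|^2] is the integral of the inner product of [I]
    and [f], at most [|I|] times the integral of [|f|]. *)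
Lemma Cmod_Cintegral_le f : Cintegrable mu setT f ->
  Cmod (Cintegral mu setT f) <= \int[mu]_x Cmod (f x).
Proof.
move=> fi; have [f1 f2] := fi; have ic := integrable_Cmod fi.
set I := Cintegral mu setT f.
have [I0|I0] := eqVneq (Cmod I) 0.
  by rewrite I0; apply: Rintegral_ge0 => x _; exact: Cmod_ge0.
have Igt : 0 < Cmod I by rewrite lt_neqAle eq_sym I0 Cmod_ge0.
rewrite -(ler_pM2l Igt).
have -> : Cmod I * Cmod I = \int[mu]_x (complex.Re I * complex.Re (f x) +
    complex.Im I * complex.Im (f x)).
  rewrite RintegralD//; try exact: integrable_scale.
  rewrite !RintegralZl// -expr2 CmodE sqr_sqrtr ?addr_ge0 ?sqr_ge0//.
rewrite -RintegralZl//; apply: le_Rintegral => //.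
- by apply: integrable_add; exact: integrable_scale.
- exact: integrable_scale.
- by move=> x _; exact: Cmod_inner.
Qed.

Lemma L1norm_EFin f : Cintegrable mu setT f ->
  L1norm mu f = (\int[mu]_x Cmod (f x))%:E.
Proof.
move=> fi; rewrite /L1norm /Rintegral fineK//.
exact: integrable_fin_num (integrable_Cmod fi).
Qed.

(** Clears the root of an average, which is a power of an extended real. *)
Lemma Lq_average_le (q S : R) D f : 0 < q -> 0 <= S -> 0 < fine (mu D) ->
  ((Lq_average mu q D f <= S%:E) =
   (\int[mu]_(x in D) (Cmod (f x) `^ q)%:E <= (S `^ q * fine (mu D))%:E))%E.
Proof.
move=> q0 S0 v0; rewrite /Lq_average.
have : (0 <= \int[mu]_(x in D) (Cmod (f x) `^ q)%:E)%E.
  by apply: integral_ge0 => x _; rewrite lee_fin powR_ge0.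
case: (\int[mu]_(x in D) (Cmod (f x) `^ q)%:E)%E => [X|_|//]; last first.
  by rewrite gt0_muley ?lte_fin ?invr_gt0// poweRyr ?invr_neq0 ?gt_eqF.
rewrite lee_fin => X0; rewrite -EFinM poweR_EFin !lee_fin.
have Y0 : 0 <= (fine (mu D))^-1 * X by rewrite mulr_ge0// invr_ge0 ltW.
rewrite -[in RHS]ler_pdivrMr// [X / _]mulrC; apply/idP/idP => h.
- rewrite -[leLHS](powRr1 Y0) -(mulVf (lt0r_neq0 q0)) powRrM.
  by rewrite ge0_ler_powR ?nnegrE ?powR_ge0// ltW.
- rewrite -[leRHS](powRr1 S0) -(mulfV (lt0r_neq0 q0)) powRrM.
  by rewrite ge0_ler_powR ?nnegrE ?powR_ge0 ?invr_ge0// ltW.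
Qed.

End complex_integral.

(** * Finite and infinite atomic sums *)

Section atomic_sums.
Context {R : realType} {M : pointedMetricType R}.
Variable mu : {finite_measure set (borel M) -> \bar R}.
Variables b p : R.
Implicit Types (f g h : M -> R[i]) (c : R[i]).
Local Notation Cint := (Cintegrable mu setT).

Lemma exceptional_integrable : Cint (exceptional_atom mu).
Proof. by split; exact: finite_measure_integrable_cst. Qed.

Lemma atom_integrable (a : M -> R[i]) : atom mu b p a -> Cint a.
Proof. by case=> [[x [s [_ []]]]|->] //; exact: exceptional_integrable. Qed.

Lemma partial_sumS (lam : nat -> R[i]) (a : nat -> M -> R[i]) n :
  partial_sum lam a n.+1 = fun x => lam n * a n x + partial_sum lam a n x.
Proof. by apply/funext => x; rewrite /partial_sum big_ord_recr/= addrC. Qed.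

Lemma partial_sum0 (lam : nat -> R[i]) (a : nat -> M -> R[i]) :
  partial_sum lam a 0 = fun=> 0.
Proof. by apply/funext => x; rewrite /partial_sum big_ord0. Qed.

Lemma partial_sum_integrable (lam : nat -> R[i]) (a : nat -> M -> R[i]) n :
  (forall k, (k < n)%N -> atom mu b p (a k)) -> Cint (partial_sum lam a n).
Proof.
elim: n => [|n ih] ha; first by rewrite partial_sum0; exact: Cintegrable0.
rewrite partial_sumS; apply: Cintegrable_lin; first exact/atom_integrable/ha.
by apply: ih => k kn; apply: ha; exact: ltnW.
Qed.

Lemma L1norm_ae0 f : Cmeasurable f -> {ae mu, forall x, f x = 0} -> L1norm mu f = 0%E.
Proof.
move=> mf f0; rewrite /L1norm.
rewrite (@ae_eq_integral _ _ _ mu setT (cst 0)) ?integral0//.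
- by apply/measurable_EFinP; exact: measurable_Cmod.
- by apply: ae_mono f0 => x -> _; rewrite Cmod0.
Qed.

Lemma eseries_finite (u : nat -> R) n : (forall k, (n <= k)%N -> u k = 0) ->
  (\sum_(0 <= k <oo) (u k)%:E)%E = (\sum_(k < n) u k)%:E.
Proof.
move=> u0; rewrite -sumEFin -(big_mkord xpredT (fun k => (u k)%:E)).
apply/cvg_lim => //; apply: cvg_near_cst; exists n => // m /= nm.
rewrite (big_cat_nat (leq0n n) nm)//= [X in (_ + X)%E](_ : _ = 0%E) ?adde0//.
by rewrite big_nat big1// => k /andP[nk _]; rewrite u0.
Qed.

(** A finite sum of atoms is a series whose remaining coefficients vanish. *)
Lemma finite_decomposition g n (lam : nat -> R[i]) (a : nat -> M -> R[i]) :
  Cint g -> (forall k, (k < n)%N -> atom mu b p (a k)) ->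
  {ae mu, forall x, g x = partial_sum lam a n x} ->
  exists lam' a', atomic_decomposition mu b p g lam' a' /\
    (\sum_(0 <= k <oo) (Cmod (lam' k))%:E)%E = (\sum_(k < n) Cmod (lam k))%:E.
Proof.
move=> ig ha gE.
pose lam' k := if (k < n)%N then lam k else 0.
pose a' k := if (k < n)%N then a k else exceptional_atom mu.
have sE : (\sum_(0 <= k <oo) (Cmod (lam' k))%:E)%E = (\sum_(k < n) Cmod (lam k))%:E.
  rewrite (@eseries_finite _ n) => [|k nk]; last by rewrite /lam' ltnNge nk Cmod0.
  by congr (_%:E); apply: eq_bigr => k _; rewrite /lam' ltn_ord.
have ha' k : atom mu b p (a' k).
  by rewrite /a'; case: ifP => [|_]; [exact: ha|right].
have psE m : (n <= m)%N -> partial_sum lam' a' m = partial_sum lam a n.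
  move=> nm; apply/funext => x; rewrite /partial_sum.
  rewrite -(big_mkord xpredT (fun k => lam' k * a' k x)) (big_cat_nat (leq0n n) nm)//=.
  rewrite [X in _ + X](_ : _ = 0) ?addr0; last first.
    by rewrite big_nat big1// => k /andP[nk _]; rewrite /lam' ltnNge nk mul0r.
  by rewrite big_mkord; apply: eq_bigr => k _; rewrite /lam' /a' ltn_ord.
exists lam', a'; split => //; split => //; first by rewrite sE ltry.
apply: cvg_near_cst; exists n => // m /= nm; rewrite psE//; apply: L1norm_ae0.
  have := Cmeasurable_lin (-1) (Cintegrable_measurable (partial_sum_integrable lam ha))
    (Cintegrable_measurable ig).
  by congr Cmeasurable; apply/funext => x; rewrite mulN1r addrC.
by apply: ae_mono gE => x ->; rewrite subrr.
Qed.

Lemma H1r_fin_H1r g : H1r_fin mu b p g -> H1r mu b p g.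
Proof.
move=> [ig [n [lam [a [ha gE]]]]]; split => //.
by have [lam' [a' [h _]]] := finite_decomposition ig ha gE; exists lam', a'.
Qed.

Lemma H1r_fin_lin c g h : H1r_fin mu b p g -> H1r_fin mu b p h ->
  H1r_fin mu b p (fun x => c * g x + h x).
Proof.
move=> [ig [n [lam [a [ha gE]]]]] [ih [m [lam2 [a2 [ha2 hE]]]]].
split; first exact: Cintegrable_lin.
exists (n + m)%N, (fun k => if (k < n)%N then c * lam k else lam2 (k - n)%N),
  (fun k => if (k < n)%N then a k else a2 (k - n)%N); split.
  move=> k knm; case: ifP => [|/negbT]; first exact: ha.
  by rewrite -leqNgt => nk; apply: ha2; rewrite ltn_subLR.
apply: ae_mono (ae_and gE hE) => x [-> ->].
rewrite /partial_sum big_split_ord/= mulr_sumr; congr (_ + _).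
  by apply: eq_bigr => k _; rewrite ltn_ord mulrA.
by apply: eq_bigr => k _; rewrite ltnNge leq_addr/= addKn.
Qed.

Lemma H1r_fin_null g : Cint g -> {ae mu, forall x, g x = 0} -> H1r_fin mu b p g.
Proof.
move=> ig g0; split => //; exists 0%N, (fun=> 0), (fun=> exceptional_atom mu).
by split => //; rewrite partial_sum0.
Qed.

Lemma H1r_fin0 : H1r_fin mu b p (fun=> 0).
Proof. by apply: H1r_fin_null; [exact: Cintegrable0|exact: ae_all]. Qed.

Lemma H1r_fin_atom (a : M -> R[i]) : atom mu b p a -> H1r_fin mu b p a.
Proof.
move=> ha; split; first exact: atom_integrable.
exists 1%N, (fun=> 1), (fun=> a); split => //.
by apply: ae_all => x; rewrite /partial_sum big_ord1 mul1r.
Qed.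

Lemma H1r_fin_partial_sum (lam : nat -> R[i]) (a : nat -> M -> R[i]) n :
  (forall k, (k < n)%N -> atom mu b p (a k)) -> H1r_fin mu b p (partial_sum lam a n).
Proof.
by move=> ha; split; [exact: partial_sum_integrable|exists n, lam, a; split => //; exact: ae_all].
Qed.

(** The one-term decomposition. *)
Lemma H1r_norm_atom (a : M -> R[i]) : atom mu b p a -> (H1r_norm mu b p a <= 1)%E.
Proof.
move=> ha; have ia := atom_integrable ha.
have [||lam' [a' [hd hs]]] := @finite_decomposition a 1 (fun=> 1) (fun=> a) ia.
- by [].
- by apply: ae_all => x; rewrite /partial_sum big_ord1 mul1r.
apply: ereal_inf_lbound; exists lam', a'; split => //; rewrite hs big_ord1.
by rewrite -[X in Cmod X]/((1 : R)%:C%C) Cmod_real normr1.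
Qed.

(** Real homogeneity of the atomic norm, one decomposition at a time. *)
Lemma decomposition_scale g lam a (c : R) : 0 <= c -> Cint g ->
  atomic_decomposition mu b p g lam a ->
  atomic_decomposition mu b p (fun x => c%:C%C * g x) (fun k => c%:C%C * lam k) a /\
  (\sum_(0 <= k <oo) (Cmod (c%:C%C * lam k))%:E =
    c%:E * \sum_(0 <= k <oo) (Cmod (lam k))%:E)%E.
Proof.
move=> c0 ig [ha hs hc].
have sE : (\sum_(0 <= k <oo) (Cmod (c%:C%C * lam k))%:E =
    c%:E * \sum_(0 <= k <oo) (Cmod (lam k))%:E)%E.
  rewrite -nneseriesZl//; last by move=> k _; rewrite lee_fin Cmod_ge0.
  by apply: eq_eseriesr => k _; rewrite CmodM Cmod_real ger0_norm.
split => //; split => //.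
  by rewrite sE lte_mul_pinfty ?lee_fin.
have -> : (fun n => L1norm mu (fun x => c%:C%C * g x -
    partial_sum (fun k => c%:C%C * lam k) a n x)) =
    (fun n => c%:E * L1norm mu (fun x => g x - partial_sum lam a n x)%R)%E.
  apply/funext => n; rewrite /L1norm -ge0_integralZl_EFin//.
  - apply: eq_integral => x _; rewrite -EFinM; congr (_%:E).
    rewrite -[c in RHS]ger0_norm// -Cmod_real -CmodM mulrBr /partial_sum mulr_sumr.
    by congr (Cmod (_ - _)); apply: eq_bigr => k _; rewrite mulrA.
  - by move=> x _; rewrite lee_fin Cmod_ge0.
  - apply/measurable_EFinP; apply: measurable_Cmod.
    have := Cmeasurable_lin (-1) (Cintegrable_measurable
       (partial_sum_integrable lam (fun k (_ : (k < n)%N) => ha k)))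
       (Cintegrable_measurable ig).
    by congr Cmeasurable; apply/funext => x; rewrite mulN1r addrC.
by rewrite -[X in _ --> X](mule0 c%:E); apply: cvgeZl.
Qed.

(** Continuity at 0 gives [|l h| < 1] when [h] has norm below [d]. A [g] in the
    unit ball has a decomposition of total less than 2, hence [d / 2 * g] has norm
    below [d]. *)
Lemma dual_norm_finite l : H1r_linear mu b p l -> H1r_continuous mu b p l ->
  (H1r_dual_norm mu b p l < +oo)%E.
Proof.
move=> [_ llin] lc.
have H0 : H1r mu b p (fun=> 0) by apply: H1r_fin_H1r; exact: H1r_fin0.
have l0 : l (fun=> 0) = 0.
  have := llin (-1) _ _ H0 H0.
  rewrite (_ : (fun x : M => -1 * (fun=> 0) x + (fun=> 0) x) = (fun=> 0 : R[i])).
    by rewrite mulN1r addNr.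
  by apply/funext => x; rewrite mulr0 addr0.
have [d [d0 hd]] := lc _ H0 1 ltr01.
apply: (@le_lt_trans _ _ (2 / d)%:E); last exact: ltry.
apply: ge_ereal_sup => _ [g [Hg ng] <-]; rewrite lee_fin.
have [ig [lam0 [a0 _]]] := Hg.
have [_ [lam [a [hdec ->]]] s2] : exists2 s, [set s | exists lam a,
   atomic_decomposition mu b p g lam a /\
   s = (\sum_(0 <= k <oo) (Cmod (lam k))%:E)%E] s & (s < 2%:E)%E.
  by apply: ereal_inf_lt; apply: le_lt_trans ng _; rewrite lte_fin ltr1n.
pose c := d / 2; have c0 : 0 < c by rewrite divr_gt0.
have [dec sE] := decomposition_scale (ltW c0) ig hdec.
pose h x := c%:C%C * g x.
have Hh : H1r mu b p h.
  split; last by eexists; eexists; exact: dec.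
  have := Cintegrable_lin c%:C%C ig (Cintegrable0 mu).
  by congr (Cintegrable mu setT); apply/funext => x; rewrite addr0.
have nh : (H1r_norm mu b p (fun x => h x - (fun=> 0) x)%R < d%:E)%E.
  have -> : (fun x => h x - (fun=> 0) x)%R = h by apply/funext => x; rewrite subr0.
  apply: (@le_lt_trans _ _ (c%:E * \sum_(0 <= k <oo) (Cmod (lam k))%:E)%E).
    by apply: ereal_inf_lbound; do 2 eexists; split; [exact: dec|rewrite sE].
  rewrite [X in (_ < X)%E](_ : _ = c%:E * 2%:E)%E; last by rewrite -EFinM /c divfK.
  by rewrite lte_pmul2l// lte_fin.
have := hd h Hh nh; rewrite l0 subr0.
have -> : l h = c%:C%C * l g.
  have := llin c%:C%C _ _ Hg H0; rewrite l0 addr0 => <-.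
  by congr l; apply/funext => x; rewrite addr0.
rewrite CmodM Cmod_real gtr0_norm// => /ltW h1.
by rewrite -[X in _ <= X]invf_div -[leRHS]mul1r ler_pdivlMr// mulrC.
Qed.

Lemma dual_norm_atom l (a : M -> R[i]) : atom mu b p a ->
  ((Cmod (l a))%:E <= H1r_dual_norm mu b p l)%E.
Proof.
move=> ha; apply: ereal_sup_ubound; exists a => //; split.
  by apply: H1r_fin_H1r; exact: H1r_fin_atom.
exact: H1r_norm_atom.
Qed.

End atomic_sums.

(** * Every continuous functional is represented *)

Section representation.
Context {R : realType} {M : pointedMetricType R}.
Variable mu : {finite_measure set (borel M) -> \bar R}.
Hypothesis mu_gt0 : (0 < mu setT)%E.
Hypothesis LD : locally_doubling mu.
Variables (b p q : R).
Hypotheses (p0 : 0 < p) (q0 : 0 < q) (pq : p^-1 + q^-1 = 1).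
Implicit Types (f : M -> R[i]) (g h : borel M -> R).
Local Notation Cint := (Cintegrable mu setT).
Local Notation vol x s := (fine (mu (ball x s))).
Local Notation Bl x s := (ball x s : set (borel M)).
Local Notation emb g := (fun y : M => (g y)%:C%C).

Let p1 : 1 < p. Proof. exact: conjugate_gt1 q0 pq p0. Qed.

Lemma Lq_average_Lp (r S : R) (B : set (borel M)) f : 0 < r -> 0 <= S ->
  measurable B -> 0 < fine (mu B) -> Cmeasurable f ->
  (Lq_average mu r B f <= S%:E)%E ->
  Lp mu r (fun y : borel M => \1_B y * Cmod (f y)) /\
  pow_int mu r (fun y : borel M => \1_B y * Cmod (f y)) <= S `^ r * fine (mu B).
Proof.
move=> r0 S0 mB v0 mf; rewrite Lq_average_le// => le.
have mm : measurable_fun setT (fun y : borel M => \1_B y * Cmod (f y)).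
  by apply: measurable_funM; [exact: measurable_indic|exact: measurable_Cmod].
have eI : (\int[mu]_y (`|\1_B y * Cmod (f y)| `^ r)%:E =
    \int[mu]_(y in B) (Cmod (f y) `^ r)%:E)%E.
  rewrite [RHS]integral_mkcond; apply: eq_integral => y _; rewrite patchE indicE.
  case: (y \in B); first by rewrite mul1r ger0_norm// Cmod_ge0.
  by rewrite mul0r normr0 powR0// gt_eqF.
have L : Lp mu r (fun y : borel M => \1_B y * Cmod (f y)).
  split => //; apply/integrableP; split.
    by apply/measurable_EFinP; exact: measurable_pow.
  under eq_integral do rewrite /= ger0_norm ?powR_ge0//.
  by rewrite eI; exact: le_lt_trans le (ltry _).
by split => //; rewrite -lee_fin -pow_int_EFin// eI.
Qed.

Lemma pow_int_eq0 g : Lp mu p g -> pow_int mu p g = 0 ->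
  {ae mu, forall x : M, g x = 0}.
Proof.
move=> Lg I0; have [mg _] := Lg.
have mp : measurable_fun setT (fun x : borel M => (`|g x| `^ p)%:E).
  by apply/measurable_EFinP; exact: measurable_pow.
have := (ae_eq_integral_abs mu measurableT mp).1.
under eq_integral do rewrite gee0_abs ?lee_fin ?powR_ge0//.
rewrite pow_int_EFin// I0 => /(_ erefl).
apply: ae_mono => x /(_ I)[/powR_eq0_eq0 /eqP].
by rewrite normr_eq0 => /eqP.
Qed.

(** The exponents in [atom_size] are chosen for this normalization. *)
Lemma cancelling_atom x t g : 0 < t -> cancelling mu p (Bl x t) g ->
  0 < atom_size mu p (Bl x t) g ->
  standard_atom mu p (ball x t)
    (emb (fun y => (atom_size mu p (Bl x t) g)^-1 * g y)).
Proof.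
move=> t0 [Lg gB g0]; set lam := atom_size _ _ _ _ => lam0.
have v0 := vol_gt0 mu_gt0 LD x t0; have mB := measurable_ball x t.
have lam0' := ltW lam0; have lami : 0 <= lam^-1 by rewrite invr_ge0.
have ig := Lp_integrable (ltW p1) Lg.
have gin : \int[mu]_(y in Bl x t) (lam^-1 * g y) = 0.
  rewrite -Rintegral_mul_indic -[RHS](mulr0 lam^-1) -g0 -RintegralZl//.
  apply: eq_Rintegral => y _; rewrite indicE.
  have [yB|yB] := boolP (y \in _); first by rewrite mul1r.
  by rewrite mul0r gB ?mulr0//; rewrite notin_setE in yB.
split.
- by split; [exact: (integrable_scale lam^-1 ig)|exact: integrable0].
- by apply: ae_all => y By; rewrite gB// mulr0.
- by apply: complex_ext => /=; rewrite ?gin// Rintegral_cst// mul0r.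
- rewrite Lq_average_le// ?invr_ge0 ?(ltW v0)//.
  have Ls : Lp mu p (fun y => lam^-1 * g y).
    have := Lp_lin lam^-1 (ltW p0) Lg (Lp_indic mu (ltW p0) measurable0).
    by congr Lp; apply/funext => y; rewrite indic0 addr0.
  apply: (@le_trans _ _ (\int[mu]_y (`|lam^-1 * g y| `^ p)%:E)%E).
    under eq_integral do rewrite Cmod_real.
    apply: ge0_subset_integral => //.
    by apply/measurable_EFinP; apply: measurable_pow; case: Ls.
  rewrite pow_int_EFin// lee_fin.
  have -> : pow_int mu p (fun y => lam^-1 * g y) = lam^-1 `^ p * pow_int mu p g.
    rewrite /pow_int -RintegralZl//; last by case: Lg.
    by apply: eq_Rintegral => y _; rewrite normrM powRM// (ger0_norm lami).
  have I0 := pow_int_ge0 mu p g.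
  have lamp : lam `^ p = vol x t `^ (p - 1) * pow_int mu p g.
    by rewrite /lam -powRrM mulVf ?gt_eqF// powRr1// mulr_ge0// powR_ge0.
  have Ip : 0 < pow_int mu p g.
    rewrite lt_neqAle I0 andbT; apply/negP => /eqP I0'.
    have : 0 < lam `^ p by rewrite powR_gt0.
    by rewrite lamp -I0' mulr0 ltxx.
  rewrite -(powR_inv1 lam0') -powRrM mulN1r powRN lamp invfM mulfVK ?gt_eqF//.
  rewrite -(powR_inv1 (ltW v0)) -powRrM mulN1r -{3}[vol x t](powRr1 (ltW v0)).
  rewrite -powRD; last by rewrite (gt_eqF v0) implybT.
  by rewrite -powRN opprB addrC.
Qed.

Lemma emb_lin (c : R) g h :
  emb (fun y => c * g y + h y) = (fun y => c%:C%C * emb g y + emb h y).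
Proof. by apply/funext => y; apply: complex_ext => /=; rewrite ?mul0r ?subr0 ?mulr0 ?addr0. Qed.

Lemma H1r_fin_real_lin (c : R) g h : H1r_fin mu b p (emb g) -> H1r_fin mu b p (emb h) ->
  H1r_fin mu b p (emb (fun y => c * g y + h y)).
Proof. by move=> Vg Vh; rewrite emb_lin; exact: H1r_fin_lin. Qed.

Section functional.
Variable l : (M -> R[i]) -> R[i].
Hypothesis llin : H1r_linear mu b p l.
Variable K : R.
Hypothesis lK : forall a, atom mu b p a -> Cmod (l a) <= K.

Let V g := H1r_fin mu b p (emb g).

Let V_H1r g : V g -> H1r mu b p (emb g).
Proof. exact: H1r_fin_H1r. Qed.

Let V_lin (c : R) g h : V g -> V h -> V (fun y => c * g y + h y).
Proof. exact: H1r_fin_real_lin. Qed.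

Let l_lin (c : R) g h : V g -> V h ->
  l (emb (fun y => c * g y + h y)) = c%:C%C * l (emb g) + l (emb h).
Proof.
by move=> Vg Vh; rewrite emb_lin; apply: llin.2; exact: V_H1r.
Qed.

Let l0 : l (fun=> 0) = 0.
Proof.
have H0 : H1r mu b p (fun=> 0) by apply: H1r_fin_H1r; exact: H1r_fin0.
have := llin.2 (-1) _ _ H0 H0.
rewrite (_ : (fun x : M => -1 * (fun=> 0) x + (fun=> 0) x) = (fun=> 0 : R[i])).
  by rewrite mulN1r addNr.
by apply/funext => x; rewrite mulr0 addr0.
Qed.

Let K0 : 0 <= K.
Proof. by apply: le_trans (lK (a := exceptional_atom mu) _); [exact: Cmod_ge0|right]. Qed.

(** Division by the size makes an atom, unless the size is 0; then the function
    vanishes almost everywhere and so does [l] at it. *)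
Let V_atom x t g : 0 < t <= b -> cancelling mu p (Bl x t) g ->
  V g /\ Cmod (l (emb g)) <= K * atom_size mu p (Bl x t) g.
Proof.
move=> /[dup] tb /andP[t0 _] cg; have [Lg gB g0] := cg.
have ig : Cint (emb g).
  by split; [exact: Lp_integrable (ltW p1) Lg|exact: integrable0].
have v0 := vol_gt0 mu_gt0 LD x t0.
have [size0|size0] := eqVneq (atom_size mu p (Bl x t) g) 0.
  have I0 : pow_int mu p g = 0.
    have /powR_eq0_eq0 /eqP := size0; rewrite mulf_eq0 => /orP[/eqP|/eqP//].
    by move/powR_eq0_eq0 => v00; move: v0; rewrite v00 ltxx.
  have gae : {ae mu, forall y : M, emb g y = 0}.
    by apply: ae_mono (pow_int_eq0 Lg I0) => y ->.
  have Vg : V g by exact: H1r_fin_null.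
  split => //; rewrite size0 mulr0.
  have H0 : H1r mu b p (fun=> 0) by apply: H1r_fin_H1r; exact: H1r_fin0.
  by rewrite (llin.1 _ _ (V_H1r Vg) H0 gae) l0 Cmod0.
have lam0 : 0 < atom_size mu p (Bl x t) g.
  by rewrite lt_neqAle eq_sym size0 powR_ge0.
have ha := cancelling_atom t0 cg lam0.
set lam := atom_size mu p (Bl x t) g in lam0 ha *.
have hatom : atom mu b p (emb (fun y => lam^-1 * g y)) by left; exists x, t.
have Vg' : V (fun y => lam^-1 * g y) by exact: H1r_fin_atom.
have V0 : V (fun=> 0) by exact: H1r_fin0.
have gE : g = (fun y => lam * (lam^-1 * g y) + (fun=> 0) y).
  by apply/funext => y; rewrite addr0 mulVKf ?gt_eqF.
split; first by rewrite gE; exact: V_lin.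
rewrite {1}gE l_lin// [l (emb (fun=> 0))]l0 addr0 CmodM Cmod_real gtr0_norm//.
by rewrite mulrC; apply: (ler_wpM2r (ltW lam0)); exact: (lK hatom).
Qed.

Variable C : R.
Hypothesis hC : forall (Lambda : (borel M -> R) -> R) (K e : R),
  0 <= K -> `|e| <= K ->
  (forall c g h, V g -> V h ->
    Lambda (fun y => c * g y + h y) = c * Lambda g + Lambda h) ->
  (forall x t g, 0 < t <= b -> cancelling mu p (Bl x t) g ->
    V g /\ `|Lambda g| <= K * atom_size mu p (Bl x t) g) ->
  exists f : borel M -> R,
  [/\ mu.-integrable setT (EFin \o f), \int[mu]_y `|f y| <= C * K,
    \int[mu]_y f y = e * fine (mu setT),
    forall x t, 0 < t <= b ->
      mu.-integrable (Bl x t) (EFin \o (fun y => `|f y - mean mu (Bl x t) f| `^ q)) /\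
      \int[mu]_(y in Bl x t) (`|f y - mean mu (Bl x t) f| `^ q) <=
        (4 * K) `^ q * vol x t &
    forall x t g, 0 < t <= b -> cancelling mu p (Bl x t) g ->
      mu.-integrable setT (EFin \o (fun y => f y * g y)) /\
      Lambda g = \int[mu]_y (f y * g y)].

(** The real and the imaginary part of [l], restricted to real functions, have
    real densities [f1] and [f2], with [K] and the values at the exceptional atom
    as data. As the real and imaginary parts of an atom are, almost everywhere,
    real functions of mean zero on its ball, [f1 + i f2] represents [l] on atoms,
    and by linearity on their finite combinations. *)
Lemma functional_representation : exists f, [/\ BMO mu b q f,
  (BMO_norm mu b q f <= ((2 * C + 16) * K)%:E)%E & represented_by mu b p l f].
Proof.
have hexc : atom mu b p (exceptional_atom mu) by right.
pose e := l (exceptional_atom mu).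
have [||||f1 [i1 n1 e1 osc1 rep1]] := hC (Lambda := fun g => complex.Re (l (emb g)))
    (K := K) (e := complex.Re e).
- exact: K0.
- exact: le_trans (Cmod_Re _) (lK hexc).
- by move=> c g h Vg Vh; rewrite l_lin// Re_lin/= oppr0 mul0r add0r.
- move=> x t g tb cg; have [Vg le] := V_atom tb cg; split => //.
  exact: le_trans (Cmod_Re _) le.
have [||||f2 [i2 n2 e2 osc2 rep2]] := hC (Lambda := fun g => complex.Im (l (emb g)))
    (K := K) (e := complex.Im e).
- exact: K0.
- exact: le_trans (Cmod_Im _) (lK hexc).
- by move=> c g h Vg Vh; rewrite l_lin// Im_lin/= mul0r add0r.
- move=> x t g tb cg; have [Vg le] := V_atom tb cg; split => //.
  exact: le_trans (Cmod_Im _) le.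
pose f (y : M) : R[i] := (f1 y +i* f2 y)%C.
have fi : Cint f by split.
have mf := Cintegrable_measurable fi.
have mT : 0 < fine (mu setT).
  by rewrite fine_gt0// mu_gt0/= ltey_eq mu_fin_num.
have L1 : \int[mu]_y Cmod (f y) <= 2 * C * K.
  apply: (@le_trans _ _ (\int[mu]_y (`|f1 y| + `|f2 y|))).
    apply: le_Rintegral => //; first exact: integrable_Cmod.
    - by apply: integrable_add; [exact: (integrable_norm i1)|exact: (integrable_norm i2)].
    - by move=> y _; exact: Cmod_le.
  rewrite RintegralD//; [|exact: (integrable_norm i1)|exact: (integrable_norm i2)].
  lra.
have q1 : 1 < q by apply: (@conjugate_gt1 _ _ p) => //; rewrite addrC.
have semi : (BMO_seminorm mu b q f <= (16 * K)%:E)%E.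
  apply: ge_ereal_sup => _ [x [t [tb ->]]].
  have /andP[t0 _] := tb; have v0 := vol_gt0 mu_gt0 LD x t0.
  have mB := measurable_ball x t.
  have K16 : 0 <= 16 * K by rewrite mulr_ge0.
  rewrite Lq_average_le//.
  have [j1 le1] := osc1 x t tb; have [j2 le2] := osc2 x t tb.
  set c1 := mean mu (Bl x t) f1 in j1 le1.
  set c2 := mean mu (Bl x t) f2 in j2 le2.
  have avE : average mu (ball x t) f = (c1 +i* c2)%C.
    by apply: complex_ext => /=; rewrite mul0r ?subr0 ?addr0.
  have j12 : mu.-integrable (Bl x t) (EFin \o (fun y => `|f1 y - c1| `^ q + `|f2 y - c2| `^ q)).
    exact: (integrableD mB j1 j2).
  have mh : measurable_fun setT (fun y : borel M => Cmod (f y - average mu (ball x t) f)).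
    apply: (measurable_Cmod (f := fun y => f y - average mu (ball x t) f)).
    have := Cmeasurable_lin 1 mf (Cmeasurable_cst (M := M) (- average mu (ball x t) f)).
    by congr Cmeasurable; apply/funext => y; rewrite mul1r.
  apply: (@le_trans _ _ (\int[mu]_(y in Bl x t)
      (2 `^ q * (`|f1 y - c1| `^ q + `|f2 y - c2| `^ q))%:E)%E).
    apply: ge0_le_integral => //.
    - by move=> y _; rewrite lee_fin powR_ge0.
    - apply/measurable_EFinP; apply: (measurableT_comp (measurable_powR _)).
      exact: measurable_funS mh.
    - by apply: (measurable_int mu); exact: (integrableZl mB (2 `^ q) j12).
    - move=> y _; rewrite lee_fin; apply: le_trans (powRD_le (ltW q0) _ _) => //.
      rewrite ge0_ler_powR ?nnegrE ?addr_ge0 ?Cmod_ge0 ?(ltW q0)//.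
      by rewrite avE; apply: le_trans (Cmod_le _) _.
  rewrite -[leLHS]fineK; last first.
    by apply: (integrable_fin_num mB); exact: (integrableZl mB (2 `^ q) j12).
  rewrite lee_fin -[leLHS]/(\int[mu]_(y in Bl x t) (2 `^ q * (`|f1 y - c1| `^ q + `|f2 y - c2| `^ q))).
  rewrite RintegralZl// RintegralD//.
  apply: (@le_trans _ _ (2 `^ q * (2 * ((4 * K) `^ q * vol x t)))).
    apply: (ler_wpM2l (powR_ge0 _ _)); rewrite mulr_natl mulr2n; exact: (lerD le1 le2).
  rewrite (_ : 16 * K = 2 * (2 * (4 * K))); last by rewrite !mulrA -!natrM.
  have K4 : 0 <= 4 * K by rewrite mulr_ge0.
  rewrite [leRHS](_ : _ = 2 `^ q * (2 `^ q * ((4 * K) `^ q * vol x t))); last first.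
    by rewrite powRM ?mulr_ge0// powRM ?mulr_ge0// !mulrA.
  rewrite ler_wpM2l ?powR_ge0// ler_wpM2r ?mulr_ge0 ?powR_ge0 ?(ltW v0)//.
  by rewrite le1r_powR// ?ler1n// ltW.
exists f; split.
- by split => //; exact: le_lt_trans semi (ltry _).
- rewrite /BMO_norm L1norm_EFin//; apply: (@le_trans _ _ ((2 * C * K)%:E + (16 * K)%:E)%E).
    by apply: leeD; rewrite ?lee_fin.
  by rewrite -EFinD -mulrDl lexx.
have rep_real x t g : 0 < t <= b -> cancelling mu p (Bl x t) g ->
    Cint (fun y => f y * emb g y) /\ l (emb g) = Cintegral mu setT (fun y => f y * emb g y).
  move=> tb cg; have [j1 h1] := rep1 x t g tb cg; have [j2 h2] := rep2 x t g tb cg.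
  have fE : (fun y => f y * emb g y) = (fun y => (f1 y * g y +i* (f2 y * g y))%C).
    by apply/funext => y; apply: complex_ext => /=; rewrite ?mulr0 ?subr0 ?add0r.
  rewrite fE; split; first by split.
  by apply: complex_ext.
have rep_atom a : atom mu b p a ->
    Cint (fun y => f y * a y) /\ l a = Cintegral mu setT (fun y => f y * a y).
  move=> ha; have ia := atom_integrable ha; have ma := Cintegrable_measurable ia.
  case: (ha) => [[x [t [tb [_ aB a0 asize]]]]|->]; last first.
    have fE : (fun y => f y * exceptional_atom mu y) =
        (fun y => (fine (mu setT))^-1%:C%C * f y + (fun=> 0) y).
      by apply/funext => y; rewrite addr0 mulrC.
    rewrite fE; split; first by apply: Cintegrable_lin => //; exact: Cintegrable0.
    rewrite Cintegral_lin//; last exact: Cintegrable0.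
    have -> : Cintegral mu setT (fun=> 0) = 0.
      by apply: complex_ext => /=; rewrite Rintegral_cst// mul0r.
    rewrite addr0; apply: complex_ext => /=.
      by rewrite e1 mul0r subr0 mulrC mulfK ?gt_eqF.
    by rewrite e2 mul0r addr0 mulrC mulfK ?gt_eqF.
  have /andP[t0 _] := tb; have v0 := vol_gt0 mu_gt0 LD x t0.
  have mB := measurable_ball x t.
  have vi0 : 0 <= (vol x t)^-1 by rewrite invr_ge0 ltW.
  have [La _] := Lq_average_Lp p0 vi0 mB v0 ma asize.
  pose g1 (y : borel M) := \1_(Bl x t) y * complex.Re (a y).
  pose g2 (y : borel M) := \1_(Bl x t) y * complex.Im (a y).
  have [ma1 ma2] := ma.
  have small (u : borel M -> R) : measurable_fun setT u -> (forall y, `|u y| <= Cmod (a y)) ->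
      \int[mu]_(y in Bl x t) u y = 0 ->
      cancelling mu p (Bl x t) (fun y => \1_(Bl x t) y * u y).
    move=> mu' ua u0; split.
    - apply: (Lp_dominated (ltW p0) _ _ La).
        by apply: measurable_funM => //; exact: measurable_indic.
      by move=> y; rewrite !normrM ler_wpM2l// (ger0_norm (Cmod_ge0 _)).
    - by move=> y By; rewrite indicE memNset// mul0r.
    - by rewrite Rintegral_mul_indic.
  have c1 : cancelling mu p (Bl x t) g1.
    apply: small => //; first by move=> y; exact: Cmod_Re.
    exact: (congr1 (@complex.Re R) a0).
  have c2 : cancelling mu p (Bl x t) g2.
    apply: small => //; first by move=> y; exact: Cmod_Im.
    exact: (congr1 (@complex.Im R) a0).
  have [j1 h1] := rep_real x t g1 tb c1; have [j2 h2] := rep_real x t g2 tb c2.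
  have [V1 _] := V_atom tb c1; have [V2 _] := V_atom tb c2.
  have aE : {ae mu, forall y, a y = 'i%C * emb g2 y + emb g1 y}.
    apply: ae_mono aB => y hy; have [By|nBy] := pselect (ball x t y).
      apply: complex_ext; rewrite ?Re_lin ?Im_lin /= /g1 /g2 !indicE !mem_set//=;
        rewrite !mul1r ?mul0r ?mulr0 ?oppr0 ?addr0 ?add0r//; ring.
    rewrite hy//; apply: complex_ext; rewrite ?Re_lin ?Im_lin /= /g1 /g2 !indicE !memNset//=;
      rewrite !mul0r ?mulr0 ?oppr0 ?addr0//; ring.
  have ige : Cint (fun y => 'i%C * emb g2 y + emb g1 y).
    apply: Cintegrable_lin; first by case: V2.
    by case: V1.
  have Hsum : H1r mu b p (fun y => 'i%C * emb g2 y + emb g1 y).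
    by apply: H1r_fin_H1r; exact: H1r_fin_lin.
  have Ha : H1r mu b p a by apply: H1r_fin_H1r; exact: H1r_fin_atom.
  have fsE : {ae mu, forall y, f y * a y = 'i%C * (f y * emb g2 y) + f y * emb g1 y}.
    by apply: ae_mono aE => y ->; rewrite mulrDr mulrCA.
  have mfa : Cmeasurable (fun y => f y * a y) by exact: Cmeasurable_mul.
  have isum : Cint (fun y => 'i%C * (f y * emb g2 y) + f y * emb g1 y).
    exact: Cintegrable_lin.
  split; first exact: Cintegrable_ae fsE mfa isum.
  rewrite (llin.1 _ _ Ha Hsum aE) (llin.2 _ _ _ (V_H1r V2) (V_H1r V1)) h1 h2.
  rewrite (Cintegral_ae fsE mfa (Cintegrable_measurable isum)).
  by rewrite Cintegral_lin.
move=> g Hg; have [ig [n [lam [a [ha gE]]]]] := Hg.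
have sum m : (m <= n)%N -> Cint (fun y => f y * partial_sum lam a m y) /\
    l (partial_sum lam a m) = Cintegral mu setT (fun y => f y * partial_sum lam a m y).
  elim: m => [_|m ih mn].
    rewrite partial_sum0 l0.
    have -> : (fun y => f y * 0) = (fun=> 0) by apply/funext => y; rewrite mulr0.
    split; first exact: Cintegrable0.
    by apply/esym; apply: complex_ext => /=; rewrite Rintegral_cst// mul0r.
  have [im hm] := ih (ltnW mn); have [ia hla] := rep_atom (a m) (ha m mn).
  rewrite partial_sumS.
  have -> : (fun y => f y * (lam m * a m y + partial_sum lam a m y)) =
      (fun y => lam m * (f y * a m y) + f y * partial_sum lam a m y).
    by apply/funext => y; rewrite mulrDr mulrCA.
  split; first exact: Cintegrable_lin.
  rewrite Cintegral_lin// -hla -hm; apply: llin.2; apply: H1r_fin_H1r.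
    exact: H1r_fin_atom (ha m mn).
  by apply: H1r_fin_partial_sum => k km; apply: ha; exact: ltn_trans mn.
have [isum hsum] := sum n (leqnn n).
have fgE : {ae mu, forall y, f y * g y = f y * partial_sum lam a n y}.
  by apply: ae_mono gE => y ->.
have mfg : Cmeasurable (fun y => f y * g y).
  exact: Cmeasurable_mul mf (Cintegrable_measurable ig).
split; first exact: Cintegrable_ae fgE mfg isum.
rewrite (Cintegral_ae fgE mfg (Cintegrable_measurable isum)) -hsum.
apply: llin.1 gE; apply: H1r_fin_H1r => //.
exact: H1r_fin_partial_sum.
Qed.

End functional.
End representation.

(** * Every function of bounded mean oscillation acts on atoms *)

Section pairing.
Context {R : realType} {M : pointedMetricType R}.
Variable mu : {finite_measure set (borel M) -> \bar R}.
Variables (p q : R).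
Hypotheses (p0 : 0 < p) (q0 : 0 < q) (pq : p^-1 + q^-1 = 1).
Implicit Types (f a : M -> R[i]) (c : R[i]) (B : set (borel M)).
Local Notation Cint := (Cintegrable mu setT).

Lemma Cintegral_supported B a : measurable B -> Cmeasurable a ->
  {ae mu, forall x, ~ B x -> a x = 0} -> Cintegral mu setT a = Cintegral mu B a.
Proof.
move=> mB [ma1 ma2] aB; apply: complex_ext; rewrite /= -[RHS]Rintegral_mul_indic.
- apply: ae_Rintegral => //; last first.
    by apply: measurable_funM => //; exact: measurable_indic.
  apply: ae_mono aB => x h; rewrite indicE; have [xB|xB] := boolP (x \in B).
    by rewrite mul1r.
  by rewrite h ?mul0r//; rewrite notin_setE in xB.
- apply: ae_Rintegral => //; last first.
    by apply: measurable_funM => //; exact: measurable_indic.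
  apply: ae_mono aB => x h; rewrite indicE; have [xB|xB] := boolP (x \in B).
    by rewrite mul1r.
  by rewrite h ?mul0r//; rewrite notin_setE in xB.
Qed.

(** As [a] has mean zero, [f] may be replaced by [f - c]. Hoelder's inequality
    then bounds the pairing by the L^q average of [f - c] times the L^p average of
    [a] times the measure of [B], and the last two factors cancel. *)
Lemma pairing_standard_atom B f a c (S : R) : measurable B -> 0 < fine (mu B) ->
  0 <= S -> Cmeasurable f ->
  (Lq_average mu q B (fun y => f y - c)%R <= S%:E)%E ->
  standard_atom mu p B a ->
  Cint (fun y => f y * a y) /\ Cmod (Cintegral mu setT (fun y => f y * a y)) <= S.
Proof.
move=> mB v0 S0 mf fS [ia aB a0 asize].
have ma := Cintegrable_measurable ia.
have mfc : Cmeasurable (fun y => f y - c).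
  have := Cmeasurable_lin 1 mf (Cmeasurable_cst (M := M) (- c)).
  by congr Cmeasurable; apply/funext => y; rewrite mul1r.
have vi0 : 0 <= (fine (mu B))^-1 by rewrite invr_ge0 ltW.
have [Lf If] := Lq_average_Lp q0 S0 mB v0 mfc fS.
have [La Ia] := Lq_average_Lp p0 vi0 mB v0 ma asize.
have qp : q^-1 + p^-1 = 1 by rewrite addrC.
have [iuv Iuv] := Lp_hoelder q0 p0 qp Lf La.
set u := (fun y : borel M => \1_B y * Cmod (f y - c)) in iuv Iuv If.
set v := (fun y : borel M => \1_B y * Cmod (a y)) in iuv Iuv Ia.
pose h (y : M) := (\1_B (y : borel M) : R)%:C%C * ((f y - c) * a y).
have hE y : Cmod (h y) = u y * v y.
  rewrite /h /u /v 2!CmodM Cmod_real indicE.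
  by case: (y \in B); rewrite ?normr1 ?normr0 ?mul1r ?mul0r.
have mh : Cmeasurable h.
  apply: Cmeasurable_mul; last exact: Cmeasurable_mul.
  by apply: (Cmeasurable_real (f := \1_B)); exact: measurable_indic.
have ih : Cint h by apply: (Cintegrable_dominated mh _ iuv) => y; rewrite hE.
have hS : Cmod (Cintegral mu setT h) <= S.
  apply: le_trans (Cmod_Cintegral_le ih) _.
  have -> : \int[mu]_y Cmod (h y) = \int[mu]_y `|u y * v y|.
    apply: eq_Rintegral => y _; rewrite hE ger0_norm//.
    by rewrite /u /v !mulr_ge0 ?Cmod_ge0// indicE.
  apply: le_trans Iuv _.
  have -> : S = ((S `^ q * fine (mu B)) `^ q^-1) *
      (((fine (mu B))^-1 `^ p * fine (mu B)) `^ p^-1).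
    rewrite !powRM ?powR_ge0 ?(ltW v0)// -!powRrM !mulfV ?gt_eqF//.
    rewrite !powRr1// mulrACA -mulrA [_ * (_^-1 * _)]mulrCA -powRD; last first.
      by rewrite (gt_eqF v0) implybT.
    by rewrite qp powRr1 ?(ltW v0)// mulrCA mulVf ?gt_eqF// mulr1.
  apply: ler_pM; rewrite ?powR_ge0//.
    by rewrite ge0_ler_powR ?nnegrE ?pow_int_ge0 ?invr_ge0 ?mulr_ge0 ?powR_ge0 ?(ltW v0) ?(ltW q0).
  by rewrite ge0_ler_powR ?nnegrE ?pow_int_ge0 ?invr_ge0 ?mulr_ge0 ?powR_ge0 ?(ltW v0) ?(ltW p0).
have faE : {ae mu, forall y, f y * a y = c * a y + h y}.
  apply: ae_mono aB => y hy; rewrite /h indicE.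
  have [yB|yB] := boolP (y \in B).
    by rewrite mul1r -mulrDl addrC subrK.
  by rewrite hy ?mulr0 ?addr0//; rewrite notin_setE in yB.
have mfa : Cmeasurable (fun y => f y * a y) by exact: Cmeasurable_mul.
have isum : Cint (fun y => c * a y + h y) by exact: Cintegrable_lin.
split; first exact: Cintegrable_ae faE mfa isum.
rewrite (Cintegral_ae faE mfa (Cintegrable_measurable isum)) Cintegral_lin//.
by rewrite (Cintegral_supported mB ma aB) a0 mulr0 add0r.
Qed.

End pairing.

Section clamping.
Context {R : realType} {M : pointedMetricType R}.
Variable mu : {finite_measure set (borel M) -> \bar R}.
Implicit Types (f : M -> R[i]) (z w c : R[i]).

Definition Cclamp n z : R[i] := (clamp n (complex.Re z) +i* clamp n (complex.Im z))%C.

Lemma Cclamp_lipschitz n z w : Cmod (Cclamp n z - Cclamp n w) <= Cmod (z - w).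
Proof. by apply: Cmod_homo; rewrite !(ReB, ImB) clamp_lipschitz. Qed.

Lemma Cclamp_le n z : Cmod (Cclamp n z) <= Cmod z.
Proof. by apply: Cmod_homo; exact: clamp_norm. Qed.

Lemma Cclamp_bound n z : Cmod (Cclamp n z) <= 2 * n%:R.
Proof.
rewrite mulr_natl mulr2n; apply: le_trans (Cmod_le _) _.
by apply: lerD; exact: clamp_bound.
Qed.

Lemma Cmeasurable_clamp n f : Cmeasurable f -> Cmeasurable (fun y => Cclamp n (f y)).
Proof. by move=> [f1 f2]; split; exact: measurable_clamp. Qed.

(** Truncation does not increase the oscillation about a constant, provided that
    the constant is truncated too. *)
Lemma Lq_average_clamp (q S : R) B f c n : 0 < q -> 0 <= S -> measurable B ->
  0 < fine (mu B) -> Cmeasurable f ->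
  (Lq_average mu q B (fun y => f y - c)%R <= S%:E)%E ->
  (Lq_average mu q B (fun y => Cclamp n (f y) - Cclamp n c)%R <= S%:E)%E.
Proof.
move=> q0 S0 mB v0 mf; rewrite (Lq_average_le _ q0 S0 v0) => le.
rewrite (Lq_average_le _ q0 S0 v0); apply: le_trans le.
have mpow (g : M -> R[i]) d : Cmeasurable g ->
    measurable_fun B (fun y : borel M => (Cmod (g y - d) `^ q)%:E).
  move=> mg; apply/measurable_EFinP; apply: (measurableT_comp (measurable_powR _)).
  apply: (@measurable_funS _ _ _ _ setT) => //.
  apply: (measurable_Cmod (f := fun y => g y - d)).
  have := Cmeasurable_lin 1 mg (Cmeasurable_cst (M := M) (- d)).
  by congr Cmeasurable; apply/funext => y; rewrite mul1r.
apply: ge0_le_integral => //.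
- by move=> y _; rewrite lee_fin powR_ge0.
- by apply: mpow; exact: Cmeasurable_clamp.
- exact: mpow.
- move=> y _; rewrite lee_fin ge0_ler_powR ?nnegrE ?Cmod_ge0 ?(ltW q0)//.
  exact: Cclamp_lipschitz.
Qed.

End clamping.

Section pairing_all.
Context {R : realType} {M : pointedMetricType R}.
Variable mu : {finite_measure set (borel M) -> \bar R}.
Hypothesis mu_gt0 : (0 < mu setT)%E.
Hypothesis LD : locally_doubling mu.
Variables (b p q : R).
Hypotheses (p0 : 0 < p) (q0 : 0 < q) (pq : p^-1 + q^-1 = 1).
Implicit Types (f a : M -> R[i]).
Local Notation Cint := (Cintegrable mu setT).
Local Notation m := (fine (mu setT)).

Lemma pairing_exceptional f : Cint f ->
  Cint (fun y => f y * exceptional_atom mu y) /\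
  Cmod (Cintegral mu setT (fun y => f y * exceptional_atom mu y)) <=
    m^-1 * \int[mu]_y Cmod (f y).
Proof.
move=> fi.
have -> : (fun y => f y * exceptional_atom mu y) =
    (fun y => m^-1%:C%C * f y + (fun=> 0) y).
  by apply/funext => y; rewrite addr0 mulrC.
have i0 := Cintegrable0 (M := M) mu.
split; first exact: Cintegrable_lin.
rewrite Cintegral_lin//.
have -> : Cintegral mu setT (fun=> 0) = 0.
  by apply: complex_ext => /=; rewrite Rintegral_cst// mul0r.
rewrite addr0 CmodM Cmod_real ger0_norm ?invr_ge0 ?fine_ge0//.
by rewrite ler_wpM2l ?invr_ge0 ?fine_ge0//; exact: Cmod_Cintegral_le.
Qed.

Lemma pairing_atom f a (K : R) : 0 <= K -> Cint f ->
  m^-1 * \int[mu]_y Cmod (f y) <= K ->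
  (forall x s, 0 < s <= b -> exists c,
     (Lq_average mu q (ball x s) (fun y => f y - c)%R <= K%:E)%E) ->
  atom mu b p a ->
  Cint (fun y => f y * a y) /\ Cmod (Cintegral mu setT (fun y => f y * a y)) <= K.
Proof.
move=> K0 fi fK osc [[x [s [/[dup] sb /andP[s0 _] ha]]]|->]; last first.
  by have [ifa le] := pairing_exceptional fi; split => //; exact: le_trans le fK.
have [c fc] := osc x s sb.
exact: (pairing_standard_atom p0 q0 pq (measurable_ball x s)
  (vol_gt0 mu_gt0 LD x s0) K0 (Cintegrable_measurable fi) fc ha).
Qed.

End pairing_all.

(** * The functional of a function of bounded mean oscillation *)

Section complex_limits.
Variable R : realType.
Implicit Types (u v : nat -> R[i]) (z w c : R[i]).

Definition Ccvg u z := complex.Re (u n) @[n --> \oo] --> complex.Re z /\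
  complex.Im (u n) @[n --> \oo] --> complex.Im z.

Lemma Ccvg_lin c u v z w : Ccvg u z -> Ccvg v w ->
  Ccvg (fun n => c * u n + v n) (c * z + w).
Proof.
move=> [u1 u2] [v1 v2]; split.
- rewrite Re_lin; under eq_fun do rewrite Re_lin.
  by apply: cvgD; [exact: cvgMr|apply: cvgD => //; exact: cvgMr].
- rewrite Im_lin; under eq_fun do rewrite Im_lin.
  by apply: cvgD; [exact: cvgMr|apply: cvgD => //; exact: cvgMr].
Qed.

Lemma Ccvg_Cmod u z : Ccvg u z -> Cmod (u n) @[n --> \oo] --> Cmod z.
Proof.
move=> [z1 z2]; rewrite CmodE; under eq_fun do rewrite CmodE.
have c : complex.Re (u n) ^+ 2 + complex.Im (u n) ^+ 2 @[n --> \oo] -->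
    complex.Re z ^+ 2 + complex.Im z ^+ 2 by rewrite !expr2; apply: cvgD; exact: cvgM.
exact: (cvg_comp _ _ c (@sqrt_continuous R _)).
Qed.

Lemma Ccvg_Cmod_le u z (K : R) : Ccvg u z -> (forall n, Cmod (u n) <= K) -> Cmod z <= K.
Proof.
move=> /Ccvg_Cmod uz uK; rewrite -(cvg_lim _ uz)//.
by apply: limr_le; [apply/cvg_ex; eexists; exact: uz|exact: nearW].
Qed.

(** Completeness of the complex numbers, in the form needed to exchange two
    limits: it is enough to approximate [u] uniformly by convergent sequences. *)
Lemma Ccvg_approx u :
  (forall e : R, 0 < e -> exists v z, Ccvg v z /\ forall n, Cmod (u n - v n) <= e) ->
  exists z, Ccvg u z.
Proof.
move=> h.
have cauchy_part (P : R[i] -> R) : (forall z w, `|P z - P w| <= Cmod (z - w)) ->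
    (forall v z, Ccvg v z -> P (v n) @[n --> \oo] --> P z) ->
    cvg (P (u n) @[n --> \oo]).
  move=> Plip Pc; apply/cauchy_cvgP/cauchy_exP => e e0.
  have e2 : 0 < e / 2 by rewrite divr_gt0.
  have [v [z [/Pc vz uv]]] := h _ e2; exists (P z).
  have /cvgrPdist_lt /(_ _ e2) := vz.
  apply: filterS => n vn /=; rewrite -ball_normE/=.
  rewrite (le_lt_trans (ler_distD (P (v n)) _ _))// [ltRHS](splitr e) ltr_leD//.
  by rewrite distrC (le_trans (Plip _ _)).
exists (limn (fun n => complex.Re (u n)) +i* limn (fun n => complex.Im (u n)))%C.
split => /=.
- apply: cauchy_part => [z w|v z []//]; rewrite -ReB; exact: Cmod_Re.
- apply: cauchy_part => [z w|v z []//]; rewrite -ImB; exact: Cmod_Im.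
Qed.

End complex_limits.

(** The product [f g] need not be integrable for a general [g] in the Hardy space,
    so the functional is defined as the limit of the integrals of [f_n g], where
    [f_n] is [f] truncated at height [n]. All [f_n] satisfy the same bound [K] on
    atoms. *)
Section extension.
Context {R : realType} {M : pointedMetricType R}.
Variable mu : {finite_measure set (borel M) -> \bar R}.
Variables (b p : R) (f : M -> R[i]) (K : R).
Hypothesis fi : Cintegrable mu setT f.
Hypothesis K0 : 0 <= K.
Hypothesis f_atom : forall a, atom mu b p a -> Cintegrable mu setT (fun y => f y * a y).
Hypothesis fK : forall n a, atom mu b p a ->
  Cmod (Cintegral mu setT (fun y => Cclamp n (f y) * a y)) <= K.
Implicit Types (g h a : M -> R[i]).
Local Notation Cint := (Cintegrable mu setT).

Let P n g := Cintegral mu setT (fun y => Cclamp n (f y) * g y).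

Let P_int n g : Cint g -> Cint (fun y => Cclamp n (f y) * g y).
Proof.
move=> ig; have mf := Cintegrable_measurable fi.
apply: (@Cintegrable_dominated _ _ _ _ (fun y => (2 * n%:R) * Cmod (g y))).
- apply: Cmeasurable_mul (Cintegrable_measurable ig); exact: Cmeasurable_clamp.
- by move=> y; rewrite CmodM ler_wpM2r ?Cmod_ge0// Cclamp_bound.
- exact: integrable_scale (integrable_Cmod ig).
Qed.

Let P_lin n c g h : Cint g -> Cint h ->
  P n (fun x => c * g x + h x) = c * P n g + P n h.
Proof.
move=> ig ih; rewrite /P -Cintegral_lin; [|exact: P_int|exact: P_int].
by congr Cintegral; apply/funext => y; rewrite mulrDr mulrCA.
Qed.

Let P_ae n g h : Cint g -> Cint h -> {ae mu, forall x, g x = h x} -> P n g = P n h.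
Proof.
move=> ig ih gh; apply: Cintegral_ae.
- by apply: ae_mono gh => y ->.
- exact: Cintegrable_measurable (P_int n ig).
- exact: Cintegrable_measurable (P_int n ih).
Qed.

Let P_bound n g : Cint g -> Cmod (P n g) <= 2 * n%:R * \int[mu]_y Cmod (g y).
Proof.
move=> ig; apply: le_trans (Cmod_Cintegral_le (P_int n ig)) _.
rewrite -RintegralZl//; last exact: integrable_Cmod.
apply: le_Rintegral => //; first exact: integrable_Cmod (P_int n ig).
  exact: integrable_scale (integrable_Cmod ig).
by move=> y _; rewrite CmodM ler_wpM2r ?Cmod_ge0// Cclamp_bound.
Qed.

Let P_cvg g : Cint g -> Cint (fun y => f y * g y) ->
  Ccvg (P ^~ g) (Cintegral mu setT (fun y => f y * g y)).
Proof.
move=> ig ifg; have icm := integrable_Cmod ifg.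
have [mfg1 mfg2] := Cintegrable_measurable ifg.
have le n y : Cmod (Cclamp n (f y) * g y) <= Cmod (f y * g y).
  by rewrite !CmodM ler_wpM2r ?Cmod_ge0// Cclamp_le.
split; apply: (cvg_Rintegral_dominated _ _ _ _ icm) => //.
- by move=> n; have [] := Cintegrable_measurable (P_int n ig).
- move=> y; rewrite ReM; under eq_fun do rewrite ReM.
  by apply: cvgB; apply: cvgMl; exact: clamp_cvg.
- by move=> n y; exact: le_trans (Cmod_Re _) (le n y).
- by move=> n; have [] := Cintegrable_measurable (P_int n ig).
- move=> y; rewrite ImM; under eq_fun do rewrite ImM.
  by apply: cvgD; apply: cvgMl; exact: clamp_cvg.
- by move=> n y; exact: le_trans (Cmod_Im _) (le n y).
Qed.

Let P0 n : P n (fun=> 0) = 0.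
Proof.
apply: complex_ext; rewrite /P /=.
  by under eq_Rintegral do rewrite !mulr0 subr0; rewrite Rintegral_cst// mul0r.
by under eq_Rintegral do rewrite !mulr0 addr0; rewrite Rintegral_cst// mul0r.
Qed.

Section decomposition.
Variables (g : M -> R[i]) (lam : nat -> R[i]) (a : nat -> M -> R[i]).
Hypothesis ig : Cint g.
Hypothesis hdec : atomic_decomposition mu b p g lam a.

Let ha k : atom mu b p (a k). Proof. by case: hdec. Qed.

Let ips k : Cint (partial_sum lam a k).
Proof. by apply: partial_sum_integrable => j _; exact: ha. Qed.

Let total := fine (\sum_(0 <= k <oo) (Cmod (lam k))%:E)%E.
Let head k := \sum_(j < k) Cmod (lam j).

Let totalE : (\sum_(0 <= k <oo) (Cmod (lam k))%:E)%E = total%:E.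
Proof.
rewrite /total fineK// ge0_fin_numE; first by case: hdec.
by apply: nneseries_ge0 => k _ _; rewrite lee_fin Cmod_ge0.
Qed.

Let head_le k : head k <= total.
Proof.
rewrite -lee_fin -totalE /head -sumEFin -(big_mkord xpredT (fun j => (Cmod (lam j))%:E)).
by apply: nneseries_lim_ge => j _ _; rewrite lee_fin Cmod_ge0.
Qed.

Let head_cvg : head k @[k --> \oo] --> total.
Proof.
have : (\sum_(0 <= j < k) (Cmod (lam j))%:E)%E @[k --> \oo] -->
    (\sum_(0 <= j <oo) (Cmod (lam j))%:E)%E.
  by apply: is_cvg_ereal_nneg_natsum_cond => j _ _; rewrite lee_fin Cmod_ge0.
rewrite totalE => /fine_cvg; apply: cvg_trans; apply: near_eq_cvg.
by apply: nearW => k /=; rewrite big_mkord sumEFin.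
Qed.

Let P_step n k m : (k <= m)%N ->
  Cmod (P n (partial_sum lam a m) - P n (partial_sum lam a k)) <= K * (head m - head k).
Proof.
elim: m => [|m ih].
  by rewrite leqn0 => /eqP ->; rewrite !subrr Cmod0 mulr0.
rewrite leq_eqVlt => /orP[/eqP ->|]; first by rewrite !subrr Cmod0 mulr0.
rewrite ltnS => km; rewrite partial_sumS P_lin//; last exact: atom_integrable (ha m).
rewrite /head big_ord_recr/= -/(head m) -/(head k) -addrA.
apply: le_trans (CmodD _ _) _; rewrite CmodM [leLHS]addrC.
rewrite (_ : K * _ = K * (head m - head k) + Cmod (lam m) * K); last by ring.
apply: lerD; first exact: ih.
by rewrite ler_wpM2l ?Cmod_ge0//; exact: fK.
Qed.

(** For fixed [n] the partial sums of the decomposition may be integrated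
    against the bounded function [f_n] and converge; each atom contributes at most
    [K]. The resulting bound is uniform in [n]. *)
Lemma truncated_tail n k : Cmod (P n g - P n (partial_sum lam a k)) <= K * (total - head k).
Proof.
apply/ler_addgt0Pr => e e0.
have n1 : 0 < 2 * n%:R + 1 :> R by rewrite ltr_wpDl.
have e1 : 0 < e / (2 * n%:R + 1) by rewrite divr_gt0.
have [_ _ hcv] := hdec.
have [N _ hN] : \forall m \near \oo,
    fine (L1norm mu (fun x => g x - partial_sum lam a m x)) < e / (2 * n%:R + 1).
  have c : fine (L1norm mu (fun x => g x - partial_sum lam a m x)) @[m --> \oo] --> (0 : R).
    exact: fine_cvg.
  have /cvgrPdist_lt /(_ _ e1) := c.
  apply: filterS => m /=; rewrite sub0r normrN; exact: le_lt_trans (ler_norm _).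
pose m := maxn N k.
have /hN near_m : (N <= m)%N by rewrite leq_maxl.
have idiff : Cint (fun x => -1 * partial_sum lam a m x + g x).
  exact: Cintegrable_lin.
have diffE : (fun x => g x - partial_sum lam a m x) =
    (fun x => -1 * partial_sum lam a m x + g x).
  by apply/funext => x; rewrite mulN1r addrC.
have lt : \int[mu]_x Cmod (-1 * partial_sum lam a m x + g x) < e / (2 * n%:R + 1).
  by move: near_m; rewrite /= diffE L1norm_EFin.
have le1 : Cmod (P n g - P n (partial_sum lam a m)) <= e.
  have -> : P n g - P n (partial_sum lam a m) = P n (fun x => -1 * partial_sum lam a m x + g x).
    by rewrite P_lin// mulN1r addrC.
  apply: le_trans (P_bound n idiff) _.
  move: lt; rewrite ltr_pdivlMr// => /ltW; apply: le_trans; rewrite mulrC.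
  rewrite ler_wpM2l//; last by rewrite lerDl.
  by apply: Rintegral_ge0 => y _; exact: Cmod_ge0.
have -> : P n g - P n (partial_sum lam a k) = (P n (partial_sum lam a m) - P n (partial_sum lam a k)) +
   (P n g - P n (partial_sum lam a m)) by ring.
apply: le_trans (CmodD _ _) _; apply: lerD => //.
apply: le_trans (P_step n (leq_maxr N k)) _.
by rewrite ler_wpM2l// lerD2r head_le.
Qed.

Lemma truncated_bound n : Cmod (P n g) <= K * total.
Proof.
have := truncated_tail n 0; rewrite partial_sum0 P0 subr0.
by rewrite /head big_ord0 subr0.
Qed.

(** For every partial sum the truncated integrals converge to the integral against
    [f]; the uniform bound on the tails lets this pass to [g]. *)
Lemma truncated_cvg : exists z, Ccvg (P ^~ g) z.
Proof.
apply: Ccvg_approx => e e0.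
have [k le] : exists k, K * (total - head k) <= e.
  have K1 : 0 < K + 1 by rewrite ltr_wpDl.
  have /cvgrPdist_le /(_ (e / (K + 1))) [|N _ hN] := head_cvg; first by rewrite divr_gt0.
  exists N; have := hN N (leqnn N); rewrite /= ger0_norm ?subr_ge0 ?head_le//.
  rewrite ler_pdivlMr//; apply: le_trans; rewrite mulrC ler_wpM2l ?lerDl//.
  by rewrite subr_ge0 head_le.
suff [z hz] : exists z, Ccvg (P ^~ (partial_sum lam a k)) z.
  exists (P ^~ (partial_sum lam a k)), z; split => // n.
  exact: le_trans (truncated_tail n k) le.
elim: k {le} => [|k [z hz]].
  by exists 0; rewrite partial_sum0; under eq_fun do rewrite P0; split; exact: cvg_cst.
exists (lam k * Cintegral mu setT (fun y => f y * a k y) + z).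
have iak := atom_integrable (ha k).
rewrite partial_sumS; under eq_fun do rewrite P_lin//.
by apply: Ccvg_lin => //; apply: P_cvg => //; exact: f_atom.
Qed.

Lemma truncated_limit z : Ccvg (P ^~ g) z ->
  ((Cmod z)%:E <= K%:E * \sum_(0 <= k <oo) (Cmod (lam k))%:E)%E.
Proof.
move=> hz; rewrite totalE -EFinM lee_fin.
by apply: Ccvg_Cmod_le hz _ => n; exact: truncated_bound.
Qed.

End decomposition.

Let ell g : R[i] := (limn (fun n => complex.Re (P n g)) +i*
  limn (fun n => complex.Im (P n g)))%C.

Let ellE g z : Ccvg (P ^~ g) z -> ell g = z.
Proof.
by move=> [z1 z2]; apply: complex_ext => /=; exact/cvg_lim.
Qed.

Let ell_cvg g : H1r mu b p g -> Ccvg (P ^~ g) (ell g).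
Proof.
move=> [ig [lam [a hdec]]]; have [z hz] := truncated_cvg ig hdec.
by rewrite (ellE hz).
Qed.

Let ell_lin : H1r_linear mu b p ell.
Proof.
split=> [g h [ig _] [ih _] gh|c g h Hg Hh].
  by rewrite /ell; congr (limn _ +i* limn _)%C; apply/funext => n; rewrite (P_ae n ig ih gh).
apply: ellE; have [ig _] := Hg; have [ih _] := Hh.
under eq_fun do rewrite P_lin//.
by apply: Ccvg_lin; exact: ell_cvg.
Qed.

Let ell_le g : H1r mu b p g -> ((Cmod (ell g))%:E <= K%:E * H1r_norm mu b p g)%E.
Proof.
move=> Hg; have cg := ell_cvg Hg; have [ig _] := Hg.
have dec_le lam (a : nat -> M -> R[i]) : atomic_decomposition mu b p g lam a ->
    ((Cmod (ell g))%:E <= K%:E * \sum_(0 <= k <oo) (Cmod (lam k))%:E)%E.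
  by move=> hdec; exact: (truncated_limit ig hdec cg).
have [Kz|Kn0] := eqVneq K 0.
  have [_ [lam [a hdec]]] := Hg; have := dec_le _ _ hdec.
  by rewrite Kz !mul0e.
have Kgt : 0 < K by rewrite lt_neqAle eq_sym Kn0.
rewrite -lee_pdivrMl//; apply/ereal_infP => _ [lam [a [hdec ->]]].
by rewrite lee_pdivrMl//; exact: dec_le hdec.
Qed.

(** On finite combinations of atoms [f g] is integrable and dominates [f_n g]. *)
Let ell_rep : represented_by mu b p ell f.
Proof.
move=> g [ig [n [lam [a [ha gE]]]]].
have isum m : (m <= n)%N -> Cint (fun y => f y * partial_sum lam a m y).
  elim: m => [_|m ih mn].
    rewrite partial_sum0; have -> : (fun y => f y * 0) = (fun=> 0).
      by apply/funext => y; rewrite mulr0.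
    exact: Cintegrable0.
  rewrite partial_sumS.
  have -> : (fun y => f y * (lam m * a m y + partial_sum lam a m y)) =
      (fun y => lam m * (f y * a m y) + f y * partial_sum lam a m y).
    by apply/funext => y; rewrite mulrDr mulrCA.
  by apply: Cintegrable_lin; [exact/f_atom/ha|exact/ih/ltnW].
have fgE : {ae mu, forall y, f y * g y = f y * partial_sum lam a n y}.
  by apply: ae_mono gE => y ->.
have ifg : Cint (fun y => f y * g y).
  apply: Cintegrable_ae fgE _ (isum n (leqnn n)).
  exact: Cmeasurable_mul (Cintegrable_measurable fi) (Cintegrable_measurable ig).
by split => //; apply: ellE; exact: P_cvg.
Qed.

Lemma functional_extension : exists l, [/\ H1r_linear mu b p l,
  H1r_bounded mu b p l, represented_by mu b p l f &
  (H1r_dual_norm mu b p l <= K%:E)%E].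
Proof.
exists ell; split => //; first by exists K => g; exact: ell_le.
apply: ge_ereal_sup => _ [g [Hg g1] <-].
apply: le_trans (ell_le Hg) _; rewrite -[leRHS]mule1.
by rewrite lee_wpmul2l ?lee_fin.
Qed.

End extension.

Section bmo_functional.
Context {R : realType} {M : pointedMetricType R}.
Variable mu : {finite_measure set (borel M) -> \bar R}.
Hypothesis mu_gt0 : (0 < mu setT)%E.
Hypothesis LD : locally_doubling mu.
Variables (b p q : R).
Hypotheses (b0 : 0 < b) (p0 : 0 < p) (q0 : 0 < q) (pq : p^-1 + q^-1 = 1).

(** A standard atom contributes at most the oscillation of [f], the exceptional
    atom at most the L^1 norm of [f] divided by the mass of the space, and both
    bounds are inherited by the truncations of [f]. *)
Lemma BMO_functional f : BMO mu b q f -> exists l, [/\ H1r_linear mu b p l,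
  H1r_bounded mu b p l, represented_by mu b p l f &
  (H1r_dual_norm mu b p l <=
    (Num.max 1 (fine (mu setT))^-1)%:E * BMO_norm mu b q f)%E].
Proof.
move=> [fi fS]; have mf := Cintegrable_measurable fi.
set S := BMO_seminorm mu b q f in fS; set L1 := \int[mu]_y Cmod (f y).
have osc x s : 0 < s <= b ->
    (Lq_average mu q (ball x s) (fun y => f y - average mu (ball x s) f)%R <= S)%E.
  by move=> sb; apply: ereal_sup_ubound; exists x, s.
have S0 : (0 <= S)%E.
  apply: le_trans (osc point b _); first exact: poweR_ge0.
  by rewrite b0 lexx.
have SE : S = (fine S)%:E by rewrite fineK// ge0_fin_numE.
have s0 : 0 <= fine S by rewrite fine_ge0.
have L10 : 0 <= L1 by apply: Rintegral_ge0 => y _; exact: Cmod_ge0.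
set c := Num.max 1 (fine (mu setT))^-1; pose K := c * (L1 + fine S).
have c1 : 1 <= c by rewrite le_max lexx.
have cm : (fine (mu setT))^-1 <= c by rewrite le_max lexx orbT.
have SK : fine S <= K.
  apply: (@le_trans _ _ (L1 + fine S)); first by rewrite lerDr.
  by rewrite -[leLHS]mul1r ler_wpM2r// addr_ge0.
have LK : (fine (mu setT))^-1 * L1 <= K.
  apply: (@le_trans _ _ (c * L1)); first by rewrite ler_wpM2r.
  by rewrite ler_wpM2l ?lerDl// (le_trans ler01).
have K0 : 0 <= K by exact: le_trans s0 SK.
have oscK x s : 0 < s <= b ->
    (Lq_average mu q (ball x s) (fun y => f y - average mu (ball x s) f)%R <= K%:E)%E.
  by move=> sb; apply: le_trans (osc x s sb) _; rewrite SE lee_fin.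
have -> : (c%:E * BMO_norm mu b q f)%E = K%:E.
  by rewrite /BMO_norm L1norm_EFin// -/S SE -EFinD -EFinM.
apply: functional_extension => //.
- move=> a ha; apply: (proj1 (pairing_atom mu_gt0 LD p0 q0 pq K0 fi LK _ ha)).
  by move=> x s sb; exists (average mu (ball x s) f); exact: oscK.
- move=> n a ha.
  have fni : Cintegrable mu setT (fun y => Cclamp n (f y)).
    apply: (Cintegrable_dominated (Cmeasurable_clamp n mf) _ (integrable_Cmod fi)).
    by move=> y; exact: Cclamp_le.
  have LnK : (fine (mu setT))^-1 * \int[mu]_y Cmod (Cclamp n (f y)) <= K.
    apply: le_trans LK; rewrite ler_wpM2l ?invr_ge0 ?fine_ge0//.
    apply: le_Rintegral => //; first exact: integrable_Cmod fni.
      exact: integrable_Cmod.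
    by move=> y _; exact: Cclamp_le.
  apply: (proj2 (pairing_atom mu_gt0 LD p0 q0 pq K0 fni LnK _ ha)).
  move=> x s /[dup] sb /andP[s0' _]; exists (Cclamp n (average mu (ball x s) f)).
  apply: Lq_average_clamp => //; [exact: measurable_ball|exact: vol_gt0|exact: oscK].
Qed.

End bmo_functional.

(** * The duality theorem *)

(* The factor max(1, 1/mu(M)) in the norm bound of the first part is 1 as soon
   as 1 <= mu(M).  It cannot be dropped when mu(M) < 1: for f = 1 the functional
   takes the value 1 at the exceptional atom, while the BMO norm of f is
   mu(M). *)
Theorem theorem4p4 (R : realType) (M : pointedMetricType R)
    (mu : {finite_measure set (borel M) -> \bar R})
    (R0 beta b r r' : R)
    (mu_gt0 : (0 < mu setT)%E)
    (M_unbounded : unbounded_space (M := M))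
    (LD : locally_doubling mu)
    (AM : approximate_midpoint (M := M) R0 beta)
    (Ic : complementary_isoperimetric mu)
    (scale : R0 / (1 - beta) < b)
    (r_gt1 : 1 < r) (conj_rr' : r^-1 + r'^-1 = 1) :
  (forall f : M -> R[i], BMO mu b r' f ->
    exists l : (M -> R[i]) -> R[i],
      [/\ H1r_linear mu b r l,
          H1r_bounded mu b r l,
          represented_by mu b r l f &
          (H1r_dual_norm mu b r l <=
             (Num.max 1 (fine (mu setT))^-1)%:E * BMO_norm mu b r' f)%E])
  /\
  (exists C : R, forall l : (M -> R[i]) -> R[i],
    H1r_linear mu b r l -> H1r_continuous mu b r l ->
    exists f : M -> R[i],
      [/\ BMO mu b r' f,
          (BMO_norm mu b r' f <= C%:E * H1r_dual_norm mu b r l)%E &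
          represented_by mu b r l f]).
Proof.
have [R00 beta_gt beta_lt _] := AM.
have R0b : R0 < b.
  apply: le_lt_trans scale; rewrite ler_pdivlMr ?subr_gt0//.
  by rewrite ler_piMr//; lra.
have b0 : 0 < b by exact: le_lt_trans R0b.
have r0 : 0 < r by exact: lt_trans r_gt1.
have r'0 : 0 < r'.
  rewrite -invr_gt0 -[X in 0 < X](addKr r^-1) conj_rr' addrC subr_gt0.
  by rewrite invf_lt1.
split; first by move=> f; exact: BMO_functional.
(* The class [V] of the real theory consists of the real functions that are
   finite combinations of atoms. *)
have [C0 [C00 rep]] := mean_zero_functional_rep mu_gt0 LD AM Ic b0 R0b r0 r'0 conj_rr'.
exists (2 * C0 + 16) => l llin lcont.
have nfin := dual_norm_finite llin lcont.
have n0 : (0 <= H1r_dual_norm mu b r l)%E.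
  apply: le_trans (dual_norm_atom l (or_intror erefl)).
  by rewrite lee_fin Cmod_ge0.
have nE : H1r_dual_norm mu b r l = (fine (H1r_dual_norm mu b r l))%:E.
  by rewrite fineK// ge0_fin_numE.
have lK a : atom mu b r a -> Cmod (l a) <= fine (H1r_dual_norm mu b r l).
  by move=> ha; rewrite -lee_fin -nE; exact: dual_norm_atom.
rewrite nE -EFinM; apply: functional_representation => //.
move=> Lambda K e K0 eK Llin LK.
apply: (rep (fun g => H1r_fin mu b r (fun y => (g y)%:C%C))) => // c g h.
exact: H1r_fin_real_lin.
Qed.
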